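(* Let $N\ge 1$, let $\Omega\subset\mathbb{R}^N$ be a smooth bounded domain, and let $f:\mathbb{R}\to\mathbb{R}$ be a continuous function with primitive $F(t)=\int_0^t f(s)\,ds$. Suppose that: (1) there exist constants $2<p<2^*$, $0\le K_2<\lambda_{1,0,0}$ and $K_p\ge 0$ such that $|f(t)|\le K_2|t|+K_p|t|^{p-1}$ for all $t\in\mathbb{R}$; (2) $f(t)t\ge 0$ for all $t$, and $t\mapsto f(t)/|t|$ is non-decreasing on $(-\infty,0)$ and on $(0,+\infty)$; (3) $\lim_{|t|\to+\infty}F(t)/t^2=+\infty$. Then there exists $\mu_0>0$, depending only on $\Omega$ and $f$, such that for all $0<\mu<\mu_0$ the problem $$-\Delta u=\lambda u+f(u)\ \text{ in }\Omega,\qquad u=0\ \text{ on }\partial\Omega,\qquad \int_\Omega u^2\,dx=\mu$$ has a solution $(u,\lambda)\in H^1_0(\Omega)\times[0,\lambda_{1,0,0}]$.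
   Context: $\lambda_{1,0,0}>0$ is the first eigenvalue of $-\Delta$ on $H^1_0(\Omega)$ (Dirichlet). $2^*=\frac{2N}{N-2}$ if $N\ge3$ and $2^*=+\infty$ if $N=1,2$. A pair $(u,\lambda)\in H^1_0(\Omega)\times\mathbb{R}$ is a solution if $\int_\Omega u^2\,dx=\mu$ and $\int_\Omega\nabla u\cdot\nabla v\,dx=\lambda\int_\Omega uv\,dx+\int_\Omega f(u)v\,dx$ for all $v\in H^1_0(\Omega)$. *)

(* Defs.v *)
(* MathComp-Analysis; [R] is an arbitrary [realType]. *)
From HB Require Import structures.
From mathcomp Require Import all_boot all_order all_algebra.
From mathcomp Require Import all_classical all_reals all_analysis.

Set Implicit Arguments.
Unset Strict Implicit.
Unset Printing Implicit Defensive.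
Import Order.TTheory GRing.Theory Num.Theory.
Import numFieldNormedType.Exports.

Local Open Scope classical_set_scope.
Local Open Scope ring_scope.

(* ['rV[R]_n] carries the product sigma-algebra of the Borel sets of [R], that
   is, the Borel sigma-algebra of R^n.  Every Lebesgue measurable function is
   a.e. equal to a Borel one, so this yields the usual spaces L^2. *)
Section row_measurable.
Context {R : realType} (n : nat).

Definition row_coord (i : 'I_n) (x : 'rV[R]_n) : R := x 0 i.

Let row_set0 : g_sigma_preimage row_coord set0.
Proof. exact: sigma_algebra0. Qed.

Let row_setC A : g_sigma_preimage row_coord A ->
  g_sigma_preimage row_coord (~` A).
Proof. exact: sigma_algebraC. Qed.

Let row_bigcup (F : (set 'rV[R]_n)^nat) :
  (forall i, g_sigma_preimage row_coord (F i)) ->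
  g_sigma_preimage row_coord (\bigcup_i (F i)).
Proof. exact: sigma_algebra_bigcup. Qed.

HB.instance Definition _ := @isMeasurable.Build
  (measure_tuple_display default_measure_display)
  'rV[R]_n (g_sigma_preimage row_coord) row_set0 row_setC row_bigcup.

End row_measurable.

Lemma measurable_row_coord (R : realType) n (i : 'I_n) :
  measurable_fun [set: 'rV[R]_n] (row_coord i).
Proof.
move=> _ Y mY; rewrite setTI; apply: sub_sigma_algebra => /=.
rewrite -bigcup_seq/=; exists i => /=; first by rewrite mem_index_enum.
by exists Y => //; rewrite setTI.
Qed.

Lemma measurable_fun_rowP (R : realType) n d (T : measurableType d)
    (f : T -> 'rV[R]_n) :
  (forall i, measurable_fun [set: T] (fun x => f x 0 i)) ->
  measurable_fun [set: T] f.
Proof.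
move=> mf _ A mA; rewrite setTI.
have sub : measurable `<=` [set B : set 'rV[R]_n | measurable (f @^-1` B)].
  apply: smallest_sub.
    split => /=.
    - by rewrite preimage_set0.
    - by move=> B mB; rewrite setTD -preimage_setC; exact: measurableC.
    - by move=> F mF; rewrite preimage_bigcup; exact: bigcup_measurable.
  rewrite -bigcup_seq; apply: bigcup_sub => i _ B [C mC <-] /=.
  by rewrite setTI -comp_preimage -[X in measurable X]setTI; exact: mf.
exact: sub.
Qed.

Section lebesgue_row.
Context {R : realType}.

Definition row_cons n (p : R * 'rV[R]_n) : 'rV[R]_n.+1 :=
  \row_i (if unlift ord0 i is Some j then p.2 0 j else p.1).

Lemma measurable_row_cons n : measurable_fun setT (@row_cons n).
Proof.
apply: measurable_fun_rowP => i.
under eq_fun do rewrite mxE.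
case: (unlift ord0 i) => [j|]; last exact: measurable_fst.
exact: (measurableT_comp (measurable_row_coord j) measurable_snd).
Qed.

Definition row_uncons n (x : 'rV[R]_n.+1) : R * 'rV[R]_n :=
  (x 0 ord0, \row_j x 0 (lift ord0 j)).

Lemma measurable_row_uncons n : measurable_fun setT (@row_uncons n).
Proof.
apply/measurable_fun_pairP; split; first exact: measurable_row_coord.
apply: measurable_fun_rowP => j /=.
by under eq_fun do rewrite mxE; exact: measurable_row_coord.
Qed.

Lemma row_consK n : cancel (@row_cons n) (@row_uncons n).
Proof.
move=> [a x]; congr pair; first by rewrite mxE unlift_none.
by apply/rowP => j; rewrite !mxE liftK.
Qed.

Lemma row_unconsK n : cancel (@row_uncons n) (@row_cons n).
Proof.
move=> x; apply/rowP => i; rewrite mxE.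
by case: unliftP => [j ->|->]; rewrite //= mxE.
Qed.

Section step.
Variables (n : nat) (mu : {sigma_finite_measure set 'rV[R]_n -> \bar R}).

Definition lebesgue_row_step : set 'rV[R]_n.+1 -> \bar R :=
  pushforward (@lebesgue_measure R \x mu)%E (@row_cons n).

HB.instance Definition _ := Measure.copy lebesgue_row_step
  (measure_function_pushforward__canonical__measure_function_Measure
    (@lebesgue_measure R \x mu)%E (@measurable_row_cons n)).

Let lebesgue_row_step_sigma_finite : sigma_finite setT lebesgue_row_step.
Proof.
have /sigma_finiteP[F [TF ndF Foo]] := sigma_finiteT (@lebesgue_measure R).
have /sigma_finiteP[G [TG ndG Goo]] := sigma_finiteT mu.
exists (fun k => @row_uncons n @^-1` (F k `*` G k)).
  apply/esym; rewrite -subTset => x _.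
  have [i _ Fi] : (\bigcup_k F k) (row_uncons x).1 by rewrite -TF.
  have [j _ Gj] : (\bigcup_k G k) (row_uncons x).2 by rewrite -TG.
  exists (maxn i j) => //; split.
  - by have /subsetPset := ndF _ _ (leq_maxl i j); exact.
  - by have /subsetPset := ndG _ _ (leq_maxr i j); exact.
move=> k; have [mF Fk] := Foo k; have [mG Gk] := Goo k; split.
  rewrite -[X in measurable X]setTI.
  by apply: measurable_row_uncons => //; exact: measurableX.
rewrite /lebesgue_row_step /pushforward -comp_preimage.
rewrite (_ : _ \o _ = id); last by apply/funext => x /=; rewrite row_consK.
rewrite [X in (X < _)%E]product_measure1E//.
by rewrite lte_mul_pinfty// ge0_fin_numE.
Qed.

HB.instance Definition _ := Measure_isSigmaFinite.Build _ _ _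
  lebesgue_row_step lebesgue_row_step_sigma_finite.

End step.

(* Lebesgue measure on R^n: the n-fold product of the Lebesgue measure of R
   (for n = 0, the unit mass on the one-point space). *)
Fixpoint lebesgue_row n : {sigma_finite_measure set 'rV[R]_n -> \bar R} :=
  if n is m.+1 then lebesgue_row_step (lebesgue_row m) else \d_(0 : 'rV[R]_0).

End lebesgue_row.

Section smooth.
Context {R : realType}.

Definition partial n (i : 'I_n) (g : 'rV[R]_n -> R) : 'rV[R]_n -> R :=
  fun x => 'D_(delta_mx 0 i) g x.

Definition smooth n (g : 'rV[R]_n -> R) :=
  forall s : seq 'I_n, let h := foldr (@partial n) g s in
    continuous h /\ forall i x, derivable h x (delta_mx 0 i).

(* Up to permuting the coordinates and reversing the orientation of an axis,
   Omega is, near each of its boundary points, the open region above the graph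
   of a smooth function of the other n - 1 coordinates. *)
Definition smooth_boundary n (Omega : set 'rV[R]_n) :=
  forall x0, (closure Omega `\` Omega) x0 ->
  exists (i : 'I_n) (b : bool) (gamma : 'rV[R]_n.-1 -> R) (r : R),
    [/\ smooth gamma, 0 < r &
        forall x, ball x0 r x ->
          (Omega x <-> gamma (col' i x) < (-1) ^+ b * x 0 i)].

Definition smooth_bounded_domain n (Omega : set 'rV[R]_n) :=
  [/\ open Omega, connected Omega, Omega !=set0, bounded_set Omega &
      smooth_boundary Omega].

Definition test_function n (Omega : set 'rV[R]_n) (phi : 'rV[R]_n -> R) :=
  [/\ smooth phi, compact (closure [set x | phi x != 0]) &
      closure [set x | phi x != 0] `<=` Omega].

End smooth.

(* Elements of L^2(Omega) and H^1(Omega) are represented by functions on R^n of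
   which only the values on Omega matter. *)
Section sobolev.
Context {R : realType} {n : nat}.
Variable Omega : set 'rV[R]_n.
Implicit Types (u v : 'rV[R]_n -> R) (G H : 'I_n -> 'rV[R]_n -> R).

Local Notation mu := (@lebesgue_row R n).

Definition L2norm u : \bar R := ('N[mu]_2%:E [EFin \o u \_ Omega])%E.

Definition L2 u := measurable_fun Omega u /\ (L2norm u < +oo)%E.

Definition weak_gradient u G := forall (phi : 'rV[R]_n -> R) (i : 'I_n),
  test_function Omega phi ->
  \int[mu]_(x in Omega) (u x * partial i phi x) =
  - \int[mu]_(x in Omega) (G i x * phi x).

Definition H1 u G := [/\ L2 u, forall i, L2 (G i) & weak_gradient u G].

(* [H10 u G]: u belongs to H^1_0(Omega), the closure of C_c^oo(Omega) in
   H^1(Omega), and G is its weak gradient. *)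
Definition H10 u G := H1 u G /\
  exists phi : nat -> 'rV[R]_n -> R,
    [/\ forall k, test_function Omega (phi k),
        L2norm (phi k \- u) @[k --> \oo] --> 0%E &
        forall i, L2norm (partial i (phi k) \- G i) @[k --> \oo] --> 0%E].

Definition dirichlet_form G H : R :=
  \int[mu]_(x in Omega) (\sum_(i < n) G i x * H i x).

Definition dirichlet_eigenvalue (l : R) := exists u G,
  [/\ H10 u G, ~ {ae mu, forall x, Omega x -> u x = 0} &
      forall v H, H10 v H ->
        dirichlet_form G H = l * \int[mu]_(x in Omega) (u x * v x)].

(* The Dirichlet spectrum of a bounded domain is discrete and bounded below, so
   the infimum is attained: it is the first eigenvalue. *)
Definition dirichlet_lambda1 : R := inf [set l | dirichlet_eigenvalue l].

(* Under the growth condition on f with p < 2^*, the function f(u) v is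
   integrable for all u, v in H^1_0, so the convention that the integral of a
   non-integrable function has a default value plays no role. *)
Definition normalized_solution (f : R -> R) (m : R) u (l : R) := exists G,
  [/\ H10 u G, \int[mu]_(x in Omega) (u x ^+ 2) = m &
      forall v H, H10 v H ->
        dirichlet_form G H = l * \int[mu]_(x in Omega) (u x * v x)
                             + \int[mu]_(x in Omega) (f (u x) * v x)].

End sobolev.

Definition critical_exponent (R : realType) (N : nat) : \bar R :=
  if (N <= 2)%N then +oo%E else ((2 * N)%:R / (N - 2)%:R)%:E.

Definition primitive (R : realType) (f : R -> R) (t : R) : R :=
  if 0 <= t then \int[lebesgue_measure]_(s in `[0, t]) f s
  else - \int[lebesgue_measure]_(s in `[t, 0]) f s.

(* Main.v *)
(* Minimize E(u) = 1/2 int |grad u|^2 - int F(u) over the test functions u with int u^2 = mu and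
   int |grad u|^2 < rho.  The Sobolev inequality makes E coercive on this set for small rho, and
   for small mu the minimizing sequences stay away from the boundary int |grad u|^2 = rho.

   Weak compactness is avoided.  Averages over dyadic cells approximate a test function in L^p,
   p < 2^*, with an error controlled by its energy; hence a bounded set of test functions is
   totally bounded in L^p, and a pigeonhole argument extracts from a minimizing sequence one which
   is Cauchy in L^2 and L^p.  By the parallelogram identity for the energy, two almost minimizers
   which are close in L^2 and L^p are also close in H^1_0, so that the sequence converges strongly
   to a minimizer u.

   Since f(t)/|t| is non-decreasing and f(t) t >= 0, f is non-decreasing, F is convex and
   2 F(t) <= f(t) t.  Convexity gives int F(v) >= int F(u) + int f(u) (v - u), and comparing u with
   a curve on the sphere yields the equation with
   lambda = (int |grad u|^2 - int f(u) u) / mu.  Then lambda <= lambda_1 follows from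
   int |grad u|^2 - int f(u) u <= 2 E(u) <= lambda_1 mu, and lambda >= 0 from Poincare and Sobolev.
   The same minimization with f = 0 shows that lambda_1 is the infimum of the Rayleigh quotient. *)
Require Import Defs.
From HB Require Import structures.
From mathcomp Require Import all_boot all_order all_algebra.
From mathcomp Require Import all_classical all_reals all_analysis.
From mathcomp Require Import measurable_realfun ring lra zify.

Set Implicit Arguments.
Unset Strict Implicit.
Unset Printing Implicit Defensive.
Import Order.TTheory GRing.Theory Num.Theory.
Import numFieldNormedType.Exports.

Local Open Scope classical_set_scope.
Local Open Scope ring_scope.

(** * Dyadic cells and Lebesgue measure on row vectors *)

Section dyadic.
Context {R : realType} {n : nat}.
Implicit Types (x y a : 'rV[R]_n) (k : nat) (l : R).

(** A nonlinearity of large growth can make the energy unbounded below on the sphere, hence the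
    extra constraint on int |grad u|^2: the minimizer is only local, and the smallness of mu serves
    to keep the constraint inactive. Only test functions compete, since H^1_0 is by definition their
    closure; limits are measured by integrals of t^2 + |t|^p instead of norms. The subcritical
    condition is kept in the form (n - 2)(q - 2) < 4, which is what dyadic cells produce. Between
    the generations k and k + 1 the averages of a function of bounded energy differ, in the integral
    of the q-th power, by at most a constant times (2^n / 4)^(k (q - 2) / 2) / 4^k: the Poincare
    inequality on a cube gains 4^-k, the passage from the exponent 2 to q costs the other factor.
    The product decays geometrically exactly under that condition. The same estimate gives the
    Sobolev inequality (start at generation 0) and total boundedness (start at a late generation).
    Extraction acts on sets of competitors that still contain almost minimizers; nested sets of
    shrinking diameter replace subsequences. *)

Definition box a l : set 'rV[R]_n := [set y | forall i, a 0 i <= y 0 i < a 0 i + l].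

Definition corner k x : 'rV[R]_n :=
  \row_i ((Num.floor (2 ^+ k * x 0 i))%:~R / 2 ^+ k).

(** Half-open boxes make the cells of one generation a partition of the space, so that being in the
    same cell is an equality of floors ([cellP]). *)
Definition cell k x : set 'rV[R]_n := box (corner k x) (2 ^- k).

Lemma measurable_box a l : measurable (box a l).
Proof.
have -> : box a l = \bigcap_(i in [set: 'I_n]) (@row_coord R n i @^-1` `[a 0 i, a 0 i + l[).
  apply/seteqP; split => [y ya i _ /=|y ya i]; first by rewrite in_itv/=; exact: ya.
  by have := ya i I; rewrite /= in_itv.
apply: fin_bigcap_measurable => // i _.
by rewrite -[X in measurable X]setTI; apply: measurable_row_coord.
Qed.

Lemma cellP k x y :
  cell k x y <-> forall i, Num.floor (2 ^+ k * y 0 i) = Num.floor (2 ^+ k * x 0 i).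
Proof.
have k0 : 0 < 2 ^+ k :> R by rewrite exprn_gt0.
have E (z : int) (t : R) : (z%:~R / 2 ^+ k <= t < z%:~R / 2 ^+ k + 2 ^- k) =
    (Num.floor (2 ^+ k * t) == z).
  rewrite floor_eq -[X in _ + X]mul1r -mulrDl ler_pdivrMr// ltr_pdivlMr//.
  by rewrite [t * _]mulrC intrD.
split => xy i.
  by have := xy i; rewrite !mxE E => /eqP.
by rewrite !mxE E; apply/eqP.
Qed.

Lemma cell_refl k x : cell k x x. Proof. by apply/cellP. Qed.

Lemma cell_sym k x y : cell k x y -> cell k y x.
Proof. by move=> /cellP xy; apply/cellP => i; rewrite xy. Qed.

Lemma cell_eq k x y : cell k x y -> cell k y = cell k x.
Proof.
move=> /cellP xy; rewrite /cell; congr (box _ _).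
by apply/rowP => i; rewrite !mxE xy.
Qed.

Lemma cellS k x : cell k.+1 x `<=` cell k x.
Proof.
move=> y /cellP xy; apply/cellP => i; have := xy i.
rewrite exprS -!mulrA; set s := _ * y 0 i; set t := _ * x 0 i => e.
(* Twice the floor of u is an integer below 2u, hence at most the floor of 2v, so the floor of u is
   at most v. Exchanging u and v gives equality: the floor of 2u determines that of u. *)
have h (u v : R) : Num.floor (2 * u) = Num.floor (2 * v) -> Num.floor u <= Num.floor v.
  move=> uv; rewrite floor_ge_int.
  have : ((Num.floor u) *+ 2)%:~R <= 2 * v.
    rewrite -floor_ge_int -uv floor_ge_int mulr2n intrD.
    by have := floor_le u; lra.
  by rewrite mulr2n intrD => ?; lra.
by apply/eqP; rewrite eq_le !h.
Qed.

Lemma cell_dist k x y : cell k x y -> forall i, `|x 0 i - y 0 i| < 2 ^- k.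
Proof.
move=> xy i; have := xy i; have := cell_refl k x i; rewrite ltr_norml.
by move=> /andP[? ?] /andP[? ?]; apply/andP; split; lra.
Qed.

Lemma half_pow_lt (e : R) : 0 < e -> exists k, forall m, (k <= m)%N -> 2 ^- m < e :> R.
Proof.
move=> e0.
have /cvgrPdist_lt/(_ _ e0)[k _ ke] : (2^-1 : R) ^+ m @[m --> \oo] --> 0.
  by apply: cvg_expr; rewrite ger0_norm ?invr_ge0// invf_lt1// ltr1n.
exists k => m km; have := ke m km.
by rewrite /= sub0r normrN ger0_norm ?exprn_ge0 ?invr_ge0// exprVn.
Qed.

Lemma open_cell (U : set 'rV[R]_n) x : open U -> U x ->
  exists k, forall m, (k <= m)%N -> cell m x `<=` U.
Proof.
move=> oU Ux; have /nbhs_ballP[e /= e0 eU] : nbhs x U by exact: open_nbhs_nbhs.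
have [k ke] := half_pow_lt e0; exists k => m km y xy; apply: eU; split => // i j.
rewrite (ord1 i); apply: lt_trans (ke m km); exact: cell_dist.
Qed.

(** The sigma-algebra is generated by the coordinates, the topology by the sup norm. They meet
    because an open set is the union of the dyadic cells that it contains, and these are countably
    many. *)
Lemma open_measurable_row (U : set 'rV[R]_n) : open U -> measurable U.
Proof.
move=> oU.
pose B (kz : nat * 'rV[int]_n) := box (\row_i ((kz.2 0 i)%:~R / 2 ^+ kz.1)) (2 ^- kz.1 : R).
pose F kz := if `[< B kz `<=` U >] then B kz else set0.
have -> : U = \bigcup_kz F kz.
  apply/seteqP; split => [x Ux|x [kz _]]; last first.
    by rewrite /F; case: asboolP => // BU; exact: BU.
  have [k /(_ _ (leqnn k)) kU] := open_cell oU Ux.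
  have e : B (k, \row_i Num.floor (2 ^+ k * x 0 i)) = cell k x.
    by rewrite /B /cell; congr box; apply/rowP => i; rewrite !mxE.
  exists (k, \row_i Num.floor (2 ^+ k * x 0 i)) => //; rewrite /F e.
  by case: asboolP => // _; exact: cell_refl.
apply: countable_bigcupT_measurable; first exact: countableP.
by move=> kz; rewrite /F; case: asboolP => // _; exact: measurable_box.
Qed.

Lemma continuous_measurable_row (g : 'rV[R]_n -> R) : continuous g ->
  measurable_fun setT g.
Proof.
move=> /continuousP cg; apply: (measurability _ (RGenOpens.measurableE R)).
move=> _ [_ [a [b ->] <-]]; rewrite setTI; apply: open_measurable_row.
exact/cg/interval_open.
Qed.

Lemma continuous_cell (g : 'rV[R]_n -> R) x (e : R) : continuous g -> 0 < e ->
  exists k, forall m, (k <= m)%N -> forall y, cell m x y -> `|g x - g y| < e.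
Proof.
move=> cg e0; have /cvgrPdist_lt/(_ _ e0) := cg x.
move=> /nbhs_ballP[d /= d0 dg]; have [k kd] := half_pow_lt d0.
exists k => m km y xy; apply: dg; split => // i j; rewrite (ord1 i).
by apply: lt_trans (kd m km); exact: cell_dist.
Qed.

End dyadic.

(** * Lebesgue measure one coordinate at a time *)

Section lebesgue_row_theory.
Context {R : realType}.
Implicit Types n : nat.

Lemma ge0_integral_row n (g : 'rV[R]_n.+1 -> \bar R) :
  measurable_fun [set: 'rV[R]_n.+1] g -> (forall x, (0 <= g x)%E) ->
  (\int[lebesgue_row n.+1]_x g x =
   \int[lebesgue_measure]_s \int[lebesgue_row n]_y g (row_cons (s, y)))%E.
Proof.
move=> mg g0; rewrite [LHS]ge0_integral_pushforward//; last exact: measurable_row_cons.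
rewrite preimage_setT fubini_tonelli1//=.
by apply: measurableT_comp => //; exact: measurable_row_cons.
Qed.

Definition row_tail n (a : 'rV[R]_n.+1) : 'rV[R]_n := \row_j a 0 (lift ord0 j).

Lemma box_row_cons n (a : 'rV[R]_n.+1) (l : R) s y :
  box a l (row_cons (s, y)) <-> a 0 ord0 <= s < a 0 ord0 + l /\ box (row_tail a) l y.
Proof.
split => [h|[h0 h] i].
  split; first by have := h ord0; rewrite mxE unlift_none.
  by move=> i; have := h (lift ord0 i); rewrite !mxE liftK.
by rewrite !mxE; case: unliftP => [j ->|->] //=; have := h j; rewrite !mxE.
Qed.

Lemma lebesgue_row_box n (a : 'rV[R]_n) (l : R) : 0 <= l ->
  lebesgue_row n (box a l) = (l ^+ n)%:E.
Proof.
move=> l0; elim: n a => [|n IH] a.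
  rewrite expr0 /= diracE; case: (boolP (_ \in _)) => //.
  by move=> /negP; elim; rewrite inE => -[].
rewrite /= /lebesgue_row_step /pushforward.
have -> : row_cons (n := n) @^-1` box a l = `[a 0 ord0, a 0 ord0 + l[ `*` box (row_tail a) l.
  apply/seteqP; split => -[s y] /=; rewrite in_itv/=; first by move/box_row_cons.
  by move=> h; apply/box_row_cons.
rewrite [LHS]product_measure1E//; last exact: measurable_box.
rewrite [X in (X * _)%E]lebesgue_measure_itv/= lte_fin IH exprS.
case: ifPn => [h|]; first by rewrite -EFinB -EFinM; congr (_ * _)%:E; lra.
rewrite ltrDl -leNgt => l0'; have -> : l = 0 by apply/eqP; rewrite eq_le l0 l0'.
by rewrite mul0e mul0r.
Qed.

Lemma lebesgue_row_cell n k (x : 'rV[R]_n) : lebesgue_row n (cell k x) = ((2 ^- k) ^+ n)%:E.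
Proof. by rewrite lebesgue_row_box// invr_ge0 exprn_ge0. Qed.

End lebesgue_row_theory.

(** * Tonelli's theorem on product sets *)

Section tonelli.
Context {d1 d2} {T1 : measurableType d1} {T2 : measurableType d2} {R : realType}.
Variables (m1 : {sigma_finite_measure set T1 -> \bar R})
  (m2 : {sigma_finite_measure set T2 -> \bar R}) (A : set T1) (B : set T2).
Variable h : T1 -> T2 -> \bar R.
Hypotheses (mA : measurable A) (mB : measurable B)
  (mh : measurable_fun [set: T1 * T2] (fun z => h z.1 z.2))
  (h0 : forall x y, (0 <= h x y)%E).

Lemma measurable_integral_section :
  measurable_fun [set: T1] (fun x => \int[m2]_(y in B) h x y)%E.
Proof.
pose hB : T1 * T2 -> \bar R := (fun z => h z.1 z.2) \_ (setT `*` B).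
have mhB : measurable_fun setT hB.
  apply/(measurable_restrict _ _ measurableT); first exact: measurableX.
  exact: measurable_funTS.
have hB0 z : (0 <= hB z)%E by rewrite /hB patchE; case: ifP.
have -> : (fun x => \int[m2]_(y in B) h x y)%E = fubini_F m2 hB; last first.
  exact: measurable_fun_fubini_tonelli_F.
apply/funext => x; rewrite /fubini_F [LHS]integral_mkcond; apply: eq_integral => y _.
by rewrite /hB !patchE in_setX in_setT.
Qed.

Lemma tonelli_swap :
  (\int[m1]_(x in A) \int[m2]_(y in B) h x y =
   \int[m2]_(y in B) \int[m1]_(x in A) h x y)%E.
Proof.
pose hB : T1 * T2 -> \bar R := (fun z => h z.1 z.2) \_ (A `*` B).
have mhB : measurable_fun setT hB.
  apply/(measurable_restrict _ _ measurableT); first exact: measurableX.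
  exact: measurable_funTS.
have hB0 z : (0 <= hB z)%E by rewrite /hB patchE; case: ifP.
rewrite [LHS]integral_mkcond [RHS]integral_mkcond.
transitivity (\int[m1]_x \int[m2]_y hB (x, y))%E.
  apply: eq_integral => x _; rewrite patchE; case: ifPn => xA.
    rewrite [LHS]integral_mkcond; apply: eq_integral => y _.
    by rewrite /hB !patchE in_setX xA.
  by rewrite integral0_eq// => y _; rewrite /hB patchE in_setX (negbTE xA).
rewrite fubini_tonelli//; apply: eq_integral => y _; rewrite patchE; case: ifPn => yB.
  rewrite [RHS]integral_mkcond; apply: eq_integral => x _.
  by rewrite /hB !patchE in_setX yB andbT.
by rewrite integral0_eq// => x _; rewrite /hB patchE in_setX (negbTE yB) andbF.
Qed.

End tonelli.

(** * The Poincare inequality on a box *)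

Section c1.
Context {R : realType}.
Implicit Types n : nat.

(** Regularity along the coordinate axes only. It passes to slices ([c1_slice]), which the
    inductions on the dimension require, and every test function has it. *)
Definition c1 n (g : 'rV[R]_n -> R) := continuous g /\
  forall i, (forall x, derivable g x (delta_mx 0 i)) /\ continuous (partial i g).

Definition sqgrad n (g : 'rV[R]_n -> R) (x : 'rV[R]_n) : R :=
  \sum_(i < n) partial i g x ^+ 2.

Lemma c1_measurable n (g : 'rV[R]_n -> R) : c1 g -> measurable_fun setT g.
Proof. by move=> [cg _]; exact: continuous_measurable_row. Qed.

Lemma c1_measurable_partial n (g : 'rV[R]_n -> R) i :
  c1 g -> measurable_fun setT (partial i g).
Proof. by move=> [_ cg]; apply: continuous_measurable_row; exact: (cg i).2. Qed.

Lemma measurable_sqgrad n (g : 'rV[R]_n -> R) : c1 g -> measurable_fun setT (sqgrad g).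
Proof.
move=> cg; apply: measurable_sum => i; apply: measurable_funX.
exact: c1_measurable_partial.
Qed.

Lemma sqgrad_ge0 n (g : 'rV[R]_n -> R) x : 0 <= sqgrad g x.
Proof. by apply: sumr_ge0 => i _; exact: sqr_ge0. Qed.

Lemma ball_row_cons n (s t e : R) (x y : 'rV[R]_n) :
  ball s e t -> ball x e y -> ball (row_cons (s, x)) e (row_cons (t, y)).
Proof.
move=> st [e0 xy]; split => // i j; rewrite !mxE.
by case: (unlift ord0 j) => [k|] //=; exact: xy.
Qed.

Lemma continuous_slice n (g : 'rV[R]_n.+1 -> R) s : continuous g ->
  continuous (fun y => g (row_cons (s, y))).
Proof.
move=> cg y; apply: (@continuous_comp _ _ _ (fun y => row_cons (s, y))); last exact: cg.
move=> A /nbhs_ballP[e /= e0 eA]; apply/nbhs_ballP; exists e => // z xy.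
by apply: eA; apply: ball_row_cons => //; exact: ballxx.
Qed.

Lemma continuous_slice0 n (g : 'rV[R]_n.+1 -> R) y : continuous g ->
  continuous (fun s => g (row_cons (s, y))).
Proof.
move=> cg s; apply: (@continuous_comp _ _ _ (fun s => row_cons (s, y))); last exact: cg.
move=> A /nbhs_ballP[e /= e0 eA]; apply/nbhs_ballP; exists e => // z xy.
by apply: eA; apply: ball_row_cons => //; exact: ballxx.
Qed.

(** The difference quotients agree before any limit is taken, so derivability and the value of the
    derivative pass to slices together. *)
Lemma shift_slice n (g : 'rV[R]_n.+1 -> R) s y j :
  (fun h : R => h^-1 *: (((fun y => g (row_cons (s, y))) \o shift y) (h *: delta_mx 0 j)
     - g (row_cons (s, y)))) =
  (fun h : R => h^-1 *: ((g \o shift (row_cons (s, y))) (h *: delta_mx 0 (lift ord0 j))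
     - g (row_cons (s, y)))).
Proof.
apply/funext => h /=; congr (_ *: (g _ - _)); apply/rowP => k; rewrite !mxE eqxx /=.
case: unliftP => [i ->|->]; first by rewrite !mxE eqxx (inj_eq lift_inj).
by rewrite eq_liftF mulr0 add0r.
Qed.

Lemma shift_slice0 n (g : 'rV[R]_n.+1 -> R) (s : R) y :
  (fun h : R => h^-1 *: (((fun s => g (row_cons (s, y))) \o shift s) (h *: 1)
     - g (row_cons (s, y)))) =
  (fun h : R => h^-1 *: ((g \o shift (row_cons (s, y))) (h *: delta_mx 0 ord0)
     - g (row_cons (s, y)))).
Proof.
apply/funext => h /=; congr (_ *: (g _ - _)); apply/rowP => k; rewrite !mxE eqxx /=.
case: unliftP => [i ->|->]; last by rewrite eqxx.
by rewrite eq_sym eq_liftF mulr0 add0r.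
Qed.

Lemma partial_slice n (g : 'rV[R]_n.+1 -> R) s y j :
  partial j (fun y => g (row_cons (s, y))) y = partial (lift ord0 j) g (row_cons (s, y)).
Proof. by rewrite /partial /derive shift_slice. Qed.

Lemma derive_slice0 n (g : 'rV[R]_n.+1 -> R) (s : R) y :
  'D_1 (fun s => g (row_cons (s, y))) s = partial ord0 g (row_cons (s, y)).
Proof. by rewrite /partial /derive shift_slice0. Qed.

Lemma c1_slice n (g : 'rV[R]_n.+1 -> R) s : c1 g -> c1 (fun y => g (row_cons (s, y))).
Proof.
move=> [cg dg]; split; first exact: continuous_slice.
move=> i; split; last first.
  rewrite (_ : partial i _ = (fun y => partial (lift ord0 i) g (row_cons (s, y)))).
    by apply: continuous_slice; exact: (dg _).2.
  by apply/funext => y; rewrite partial_slice.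
by move=> y; rewrite /derivable shift_slice; exact: (dg _).1.
Qed.

Lemma derivable_slice0 n (g : 'rV[R]_n.+1 -> R) (s : R) y : c1 g ->
  derivable (fun s => g (row_cons (s, y))) s 1.
Proof. by move=> [cg dg]; rewrite /derivable shift_slice0; exact: (dg _).1. Qed.

End c1.

Section poincare_box.
Context {R : realType}.
Implicit Types n : nat.

Lemma FTC_sub (h h' : R -> R) (s t : R) : s <= t ->
  (forall x, derivable h x 1) -> (forall x, 'D_1 h x = h' x) -> continuous h' ->
  (\int[lebesgue_measure]_(x in `[s, t]) h' x = h t - h s)%R.
Proof.
rewrite le_eqVlt => /orP[/eqP <- _ _ _|st dh h'E ch].
  by rewrite set_itv1 Rintegral_set1 subrr.
rewrite /Rintegral (@continuous_FTC2 _ _ h)//.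
- exact: continuous_subspaceT.
- split; first by move=> x _; exact: dh.
  + by apply: cvg_at_right_filter; apply: differentiable_continuous; apply/derivable1_diffP.
  + by apply: cvg_at_left_filter; apply: differentiable_continuous; apply/derivable1_diffP.
- by move=> x _; rewrite derive1E.
Qed.

Lemma continuous_integrable_itv (h : R -> R) (s t : R) : continuous h ->
  lebesgue_measure.-integrable `[s, t] (EFin \o h).
Proof.
move=> ch; apply: continuous_compact_integrable; first exact: segment_compact.
exact: continuous_subspaceT.
Qed.

Lemma sqr_sub_le_integral (h h' : R -> R) (a l s t : R) :
  (forall x, derivable h x 1) -> (forall x, 'D_1 h x = h' x) -> continuous h' ->
  a <= s < a + l -> a <= t < a + l ->
  (((h s - h t) ^+ 2)%:E <= l%:E * \int[lebesgue_measure]_(r in `[a, (a + l)%R[) (h' r ^+ 2)%:E)%E.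
Proof.
move=> dh h'E ch.
wlog st : s t / s <= t.
  move=> H sI tI; have [st|/ltW ts] := leP s t; first exact: H.
  by rewrite -sqrrN opprB; exact: H.
move=> /andP[as_ sl] /andP[at_ tl].
have l0 : 0 <= l by lra.
have mh' : measurable_fun setT h' by exact: continuous_measurable_fun.
move: st; rewrite le_eqVlt => /orP[/eqP ->|st].
  rewrite subrr expr0n mule_ge0// ?lee_fin// integral_ge0// => x _.
  by rewrite lee_fin sqr_ge0.
apply: (@le_trans _ _ (l%:E * \int[lebesgue_measure]_(r in `[s, t]) (h' r ^+ 2)%:E)%E); last first.
  apply: lee_wpmul2l; rewrite ?lee_fin//.
  apply: ge0_subset_integral => //.
  - by apply/measurable_EFinP; apply: measurable_funTS; exact: measurable_funX.
  - by move=> x _; rewrite lee_fin sqr_ge0.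
  - by move=> x /=; rewrite !in_itv/= => /andP[? ?]; apply/andP; split; lra.
have ch2 : continuous (fun r => h' r ^+ 2).
  by move=> x; apply: (@continuous_comp _ _ _ h' (fun r => r ^+ 2)); [exact: ch|exact: exprn_continuous].
have ih2 := continuous_integrable_itv s t ch2.
have ih := continuous_integrable_itv s t ch.
rewrite -(fineK (integrable_fin_num _ ih2))// -EFinM lee_fin.
rewrite -[fine _]/(Rintegral lebesgue_measure `[s, t]%classic (fun r => h' r ^+ 2)).
set J := Rintegral _ _ _.
(* The mean slope. Integrating 2 c h' - c^2 <= h'^2 over [s, t] gives the Cauchy-Schwarz
   inequality. *)
pose c := (h t - h s) / (t - s).
have : c * (h t - h s) *+ 2 - c ^+ 2 * (t - s) <= J.
  rewrite -(FTC_sub (ltW st) dh h'E ch).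
  have -> : c ^+ 2 * (t - s) = (\int[lebesgue_measure]_(x in `[s, t]) c ^+ 2)%R.
    rewrite Rintegral_cst//; congr (_ * _).
    by rewrite [X in fine X]lebesgue_measure_itv/= lte_fin st.
  rewrite -mulr_natl mulrA -RintegralZl//.
  have ic : lebesgue_measure.-integrable `[s, t]%classic (EFin \o cst (c ^+ 2)).
    by apply: continuous_integrable_itv; exact: cst_continuous.
  have i2 : lebesgue_measure.-integrable `[s, t]%classic (EFin \o (fun x => 2 * c * h' x)).
    exact: (integrableZl _ (2 * c) ih).
  rewrite -RintegralB//; apply: le_Rintegral => //; first exact: (integrableB _ i2 ic).
  by move=> x _; have := sqr_ge0 (h' x - c); rewrite sqrrB; nra.
have ts0 : t - s != 0 by rewrite subr_eq0 gt_eqF.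
have -> : c * (h t - h s) *+ 2 - c ^+ 2 * (t - s) = (h s - h t) ^+ 2 / (t - s).
  by rewrite /c; field.
rewrite ler_pdivrMr ?subr_gt0// => H; apply: (le_trans H).
have J0 : 0 <= J by apply: Rintegral_ge0 => x _; exact: sqr_ge0.
by rewrite mulrC ler_wpM2r//; lra.
Qed.

Lemma ge0_integral_box n (a : 'rV[R]_n.+1) l (g : 'rV[R]_n.+1 -> \bar R) :
  measurable_fun [set: 'rV[R]_n.+1] g -> (forall x, (0 <= g x)%E) ->
  (\int[lebesgue_row n.+1]_(x in box a l) g x =
   \int[lebesgue_measure]_(s in `[(a 0 ord0)%R, (a 0 ord0 + l)%R[)
     \int[lebesgue_row n]_(y in box (row_tail a) l) g (row_cons (s, y)))%E.
Proof.
move=> mg g0; rewrite integral_mkcond ge0_integral_row; last 2 first.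
- apply/(measurable_restrict _ _ measurableT); first exact: measurable_box.
  exact: measurable_funTS.
- by move=> x; rewrite patchE; case: ifP.
rewrite [RHS]integral_mkcond; apply: eq_integral => s _.
have memE y : (row_cons (s, y) \in box a l) =
    (s \in `[(a 0 ord0)%R, a 0 ord0 + l[%classic) && (y \in box (row_tail a) l).
  apply/idP/andP => [|[]]; rewrite !inE /= in_itv/=; first by move=> /box_row_cons.
  by move=> sI yB; apply/box_row_cons.
rewrite patchE; case: ifPn => sI.
  by rewrite [RHS]integral_mkcond; apply: eq_integral => y _; rewrite !patchE memE sI.
by rewrite integral0_eq// => y _; rewrite patchE memE (negbTE sI).
Qed.

(** Going from (s, y) to (t, z) through (t, y) splits the difference into a leg along the first
    axis, bounded by [sqr_sub_le_integral], and a leg inside the slice at t, left to the induction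
    hypothesis. Each use of (a + b)^2 <= 2 a^2 + 2 b^2 doubles the constant, whence 2^n. The double
    integral avoids any mention of the mean. *)
Lemma poincare_box n (a : 'rV[R]_n) l (g : 'rV[R]_n -> R) : c1 g -> 0 <= l ->
  (\int[lebesgue_row n]_(x in box a l) \int[lebesgue_row n]_(y in box a l)
     ((g x - g y) ^+ 2)%:E <=
   (2 ^+ n * l ^+ (n + 2))%:E * \int[lebesgue_row n]_(x in box a l) (sqgrad g x)%:E)%E.
Proof.
move=> cg l0; elim: n a g cg => [|n IH] a g cg.
  rewrite integral0_eq ?mule_ge0 ?integral_ge0//.
  - by rewrite lee_fin mulr_ge0 ?exprn_ge0.
  - by move=> x _; rewrite lee_fin sqgrad_ge0.
  - move=> x _; rewrite integral0_eq// => y _.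
    by rewrite [x]thinmx0 [y]thinmx0 subrr expr0n.
have sq0 (r : R) : (0 <= (r ^+ 2)%:E)%E by rewrite lee_fin sqr_ge0.
have mg := c1_measurable cg.
have mdg := c1_measurable_partial ord0 cg.
set I := `[(a 0 ord0)%R, (a 0 ord0 + l)%R[%classic.
have mmI : measurable I by exact: measurable_itv.
set B := box (row_tail a) l.
have mB : measurable B by exact: measurable_box.
have mBl : lebesgue_row n B = (l ^+ n)%:E by exact: lebesgue_row_box.
have mI : lebesgue_measure I = l%:E.
  rewrite lebesgue_measure_itv/= lte_fin ltrDl; case: ifPn => [_|].
    by rewrite -EFinB addrAC subrr add0r.
  by rewrite -leNgt => l0'; congr EFin; apply/eqP; rewrite eq_le l0 l0'.
have mcons (T : Type) : measurable_fun [set: 'rV[R]_n * R] (fun z => row_cons (z.2, z.1)).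
  by apply: measurableT_comp; [exact: measurable_row_cons|exact: measurable_fun_pair].
pose J y := (\int[lebesgue_measure]_(r in I) ((partial ord0 g (row_cons (r, y))) ^+ 2)%:E)%E.
have mJ : measurable_fun setT J.
  apply: (@measurable_integral_section _ _ _ _ _ lebesgue_measure I
    (fun y r => ((partial ord0 g (row_cons (r, y))) ^+ 2)%:E)) => //.
  apply/measurable_EFinP; apply: measurable_funX.
  by apply: measurableT_comp => //; exact: (mcons unit).
have J0 y : (0 <= J y)%E by exact: integral_ge0.
pose G t y := (\int[lebesgue_row n]_(z in B)
   ((g (row_cons (t, y)) - g (row_cons (t, z))) ^+ 2)%:E)%E.
have mG : measurable_fun [set: 'rV[R]_n * R] (fun z => G z.2 z.1).
  apply: (@measurable_integral_section _ _ _ _ _ (lebesgue_row n) B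
    (fun x z => ((g (row_cons (x.2, x.1)) - g (row_cons (x.2, z))) ^+ 2)%:E)) => //=.
  apply/measurable_EFinP; apply: measurable_funX; apply: measurable_funB.
    by apply: measurableT_comp => //; exact: (measurableT_comp (mcons unit) measurable_fst).
  apply: measurableT_comp => //; apply: measurableT_comp; first exact: measurable_row_cons.
  by apply: measurable_fun_pair => //; exact: (measurableT_comp measurable_snd measurable_fst).
have G0 t y : (0 <= G t y)%E by exact: integral_ge0.
pose K y := (\int[lebesgue_measure]_(t in I) G t y)%E.
have mK : measurable_fun setT K.
  by apply: (@measurable_integral_section _ _ _ _ _ lebesgue_measure I (fun y t => G t y)).
have K0 y : (0 <= K y)%E by exact: integral_ge0.
have mGy y : measurable_fun setT (G^~ y).
  exact: (measurable_fun_pair2 y mG).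
(* A bound for the integral of (g (s, y) - g w)^2 over w that does not depend on s; the remaining
   integration over s then only contributes a factor l. [J] carries the leg along the axis, [K] the
   legs inside the slices. *)
pose Psi y := ((2 * l ^+ (n + 2))%:E * J y + 2%:E * K y)%E.
have mgs s : measurable_fun setT (fun y => g (row_cons (s, y))).
  exact: c1_measurable (c1_slice s cg).
have claim1 s y : I s -> B y ->
    (\int[lebesgue_row n.+1]_(w in box a l) ((g (row_cons (s, y)) - g w) ^+ 2)%:E <= Psi y)%E.
  move=> Is By; rewrite ge0_integral_box//; last first.
    by apply/measurable_EFinP; apply: measurable_funX; exact: measurable_funB.
  have le_t t : I t -> (\int[lebesgue_row n]_(z in B)
      ((g (row_cons (s, y)) - g (row_cons (t, z))) ^+ 2)%:E <=
      (2 * l ^+ n.+1)%:E * J y + 2%:E * G t y)%E.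
    move=> It; apply: (@le_trans _ _ (\int[lebesgue_row n]_(z in B)
        ((2 * l)%:E * J y + 2%:E * ((g (row_cons (t, y)) - g (row_cons (t, z))) ^+ 2)%:E)))%E.
      have mr : measurable_fun B (fun z : 'rV[R]_n => (2%:E *
          ((g (row_cons (t, y)) - g (row_cons (t, z))) ^+ 2)%:E)%E).
        apply: measurable_funTS; under eq_fun do rewrite -EFinM.
        apply/measurable_EFinP; apply: measurable_funM => //; apply: measurable_funX.
        exact: measurable_funB.
      apply: ge0_le_integral => //.
      - apply/measurable_EFinP; apply: measurable_funX; apply: measurable_funB => //.
        exact: measurable_funTS.
      - exact: emeasurable_funD.
      move=> z Bz; have H := @sqr_sub_le_integral (fun s => g (row_cons (s, y)))
        (fun s => partial ord0 g (row_cons (s, y))) (a 0 ord0) l s t.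
      apply: (@le_trans _ _ (2%:E * ((g (row_cons (s, y)) - g (row_cons (t, y))) ^+ 2)%:E +
         2%:E * ((g (row_cons (t, y)) - g (row_cons (t, z))) ^+ 2)%:E))%E.
        rewrite -!EFinM -EFinD lee_fin.
        set u := g _; set v := g _; set w := g (row_cons (t, y)).
        by have := sqr_ge0 (u - w - (w - v)); nra.
      apply: leeD => //; rewrite [(2 * l)%:E]EFinM -muleA.
      apply: lee_wpmul2l; rewrite ?lee_fin//; apply: H.
      - by move=> r; exact: derivable_slice0.
      - by move=> r; exact: derive_slice0.
      - by apply: continuous_slice0; exact: (cg.2 ord0).2.
      - by move: Is; rewrite /I/= in_itv.
      - by move: It; rewrite /I/= in_itv.
    rewrite ge0_integralD//; last 3 first.
    - by move=> z _; rewrite mule_ge0// lee_fin mulr_ge0.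
    - by move=> z _; rewrite mule_ge0// lee_fin.
    - apply: measurable_funTS; under eq_fun do rewrite -EFinM.
      apply/measurable_EFinP; apply: measurable_funM => //; apply: measurable_funX.
      exact: measurable_funB.
    have -> : (\int[lebesgue_row n]_(z in B) ((2 * l)%:E * J y) = (2 * l)%:E * J y * (l ^+ n)%:E)%E.
      by rewrite -mBl; exact: integral_cst.
    rewrite ge0_integralZl//; last first.
      apply: measurable_funTS.
      by apply/measurable_EFinP; apply: measurable_funX; exact: measurable_funB.
    by rewrite muleAC -EFinM exprS mulrA.
  apply: (@le_trans _ _ (\int[lebesgue_measure]_(t in I)
      ((2 * l ^+ n.+1)%:E * J y + 2%:E * G t y)))%E.
    apply: ge0_le_integral => //.
    - by move=> t _; exact: integral_ge0.
    - apply: measurable_funTS; apply: (@measurable_integral_section _ _ _ _ _ (lebesgue_row n) B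
        (fun t z => ((g (row_cons (s, y)) - g (row_cons (t, z))) ^+ 2)%:E)) => //.
      apply/measurable_EFinP; apply: measurable_funX; apply: measurable_funB => //.
      apply: measurableT_comp => //; apply: measurableT_comp; first exact: measurable_row_cons.
      exact: measurable_fun_pair.
    - apply: emeasurable_funD => //; apply: measurable_funeM; exact: measurable_funTS (mGy y).
  rewrite ge0_integralD//; last 3 first.
  - by move=> t _; rewrite mule_ge0// lee_fin mulr_ge0// exprn_ge0.
  - by move=> t _; rewrite mule_ge0// lee_fin.
  - by apply: measurable_funeM; exact: measurable_funTS (mGy y).
  have -> : (\int[lebesgue_measure]_(t in I) ((2 * l ^+ n.+1)%:E * J y) =
     (2 * l ^+ n.+1)%:E * J y * l%:E)%E.
    by rewrite -mI; exact: integral_cst.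
  rewrite ge0_integralZl//; last exact: measurable_funTS (mGy y).
  by rewrite /Psi muleAC -EFinM addn2 [l ^+ n.+2]exprSr mulrA.
have mPsi : measurable_fun setT Psi.
  by apply: emeasurable_funD; exact: measurable_funeM.
have Psi0 y : (0 <= Psi y)%E.
  by rewrite adde_ge0// mule_ge0// lee_fin// mulr_ge0// exprn_ge0.
have mH : measurable_fun setT (fun x => \int[lebesgue_row n.+1]_(y in box a l)
    ((g x - g y) ^+ 2)%:E)%E.
  apply: (@measurable_integral_section _ _ _ _ _ (lebesgue_row n.+1) (box a l)
      (fun x y => ((g x - g y) ^+ 2)%:E)) => //.
    exact: measurable_box.
  apply/measurable_EFinP; apply: measurable_funX; apply: measurable_funB.
    exact: measurableT_comp measurable_fst.
  exact: measurableT_comp measurable_snd.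
apply: (@le_trans _ _ (l%:E * \int[lebesgue_row n]_(y in B) Psi y))%E.
  rewrite ge0_integral_box//; last first.
  - by move=> x; exact: integral_ge0.
  have -> : (l%:E * \int[lebesgue_row n]_(y in B) Psi y =
      \int[lebesgue_measure]_(s in I) \int[lebesgue_row n]_(y in B) Psi y)%E.
    by rewrite [RHS]integral_cst// muleC; congr (_ * _)%E; rewrite -mI.
  apply: ge0_le_integral => //.
  - by move=> s _; apply: integral_ge0 => y _; exact: integral_ge0.
  - apply: measurable_funTS; apply: (@measurable_integral_section _ _ _ _ _ (lebesgue_row n) B
      (fun s y => \int[lebesgue_row n.+1]_(w in box a l)
         ((g (row_cons (s, y)) - g w) ^+ 2)%:E)%E) => //; last first.
      by move=> s y; exact: integral_ge0.
    have := measurableT_comp mH (@measurable_row_cons R n).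
    by apply: eq_measurable_fun => -[].
  move=> s Is; apply: ge0_le_integral => //.
  - by move=> y By; exact: integral_ge0.
  - apply: measurable_funTS.
    exact: (measurable_fun_pair2 s (measurableT_comp mH (@measurable_row_cons R n))).
  - exact: measurable_funTS.
  - by move=> y By; exact: claim1.
rewrite ge0_integralD//; last 4 first.
- by move=> y _; rewrite mule_ge0// lee_fin mulr_ge0// exprn_ge0.
- by apply: measurable_funeM; exact: measurable_funTS.
- by move=> y _; rewrite mule_ge0// lee_fin.
- by apply: measurable_funeM; exact: measurable_funTS.
rewrite !ge0_integralZl//; last 3 first.
- exact: measurable_funTS.
- exact: measurable_funTS.
- by rewrite lee_fin mulr_ge0// exprn_ge0.
(* The part of [sqgrad g] that is seen by the slices: on the slice at t it is the [sqgrad] of the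
   restriction, to which the induction hypothesis applies. *)
pose S (x : 'rV[R]_n.+1) := \sum_(j < n) partial (lift ord0 j) g x ^+ 2.
have mS : measurable_fun setT S.
  apply: measurable_sum => i; apply: measurable_funX; exact: c1_measurable_partial.
have S0 x : 0 <= S x by apply: sumr_ge0 => i _; exact: sqr_ge0.
have -> : (\int[lebesgue_row n.+1]_(x in box a l) (sqgrad g x)%:E =
    \int[lebesgue_row n.+1]_(x in box a l) (partial ord0 g x ^+ 2)%:E +
    \int[lebesgue_row n.+1]_(x in box a l) (S x)%:E)%E.
  rewrite -ge0_integralD//.
  - by apply: eq_integral => x _; rewrite /sqgrad big_ord_recl EFinD.
  - exact: measurable_box.
  - apply: measurable_funTS; apply/measurable_EFinP; exact: measurable_funX.
  - by move=> x _; rewrite lee_fin.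
  - by apply: measurable_funTS; exact/measurable_EFinP.
have -> : (\int[lebesgue_row n]_(y in B) J y =
    \int[lebesgue_row n.+1]_(x in box a l) (partial ord0 g x ^+ 2)%:E)%E.
  rewrite ge0_integral_box//; last first.
    by apply/measurable_EFinP; exact: measurable_funX.
  rewrite [LHS](@tonelli_swap _ _ _ _ _ (lebesgue_row n) lebesgue_measure B I
    (fun y r => ((partial ord0 g (row_cons (r, y))) ^+ 2)%:E))//.
  apply/measurable_EFinP; apply: measurable_funX.
  by apply: measurableT_comp => //; exact: (mcons unit).
have KS : (\int[lebesgue_row n]_(y in B) K y <=
    (2 ^+ n * l ^+ (n + 2))%:E * \int[lebesgue_row n.+1]_(x in box a l) (S x)%:E)%E.
  rewrite [leLHS](@tonelli_swap _ _ _ _ _ (lebesgue_row n) lebesgue_measure B I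
    (fun y t => G t y))//.
  rewrite ge0_integral_box//; last exact/measurable_EFinP.
  have mSI : measurable_fun I (fun s => \int[lebesgue_row n]_(y in B) (S (row_cons (s, y)))%:E)%E.
    apply: measurable_funTS; apply: (@measurable_integral_section _ _ _ _ _ (lebesgue_row n) B
      (fun s y => (S (row_cons (s, y)))%:E)) => //.
      apply/measurable_EFinP; have := measurableT_comp mS (@measurable_row_cons R n).
      by apply: eq_measurable_fun => -[].
    by move=> *; rewrite lee_fin.
  have SI0 s : (0 <= \int[lebesgue_row n]_(y in B) (S (row_cons (s, y)))%:E)%E.
    by apply: integral_ge0 => y _; rewrite lee_fin.
  rewrite -ge0_integralZl//; last by rewrite lee_fin mulr_ge0// exprn_ge0.
  apply: ge0_le_integral => //.
  - by move=> t _; exact: integral_ge0.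
  - apply: measurable_funTS; apply: (@measurable_integral_section _ _ _ _ _ (lebesgue_row n) B
      (fun t y => G t y)) => //.
    have := measurableT_comp mG (measurable_swap (T1 := R) (T2 := 'rV[R]_n)).
    by apply: eq_measurable_fun => -[].
  - exact: measurable_funeM.
  move=> t It; have := IH (row_tail a) _ (c1_slice t cg).
  move=> /le_trans; apply; apply: lee_wpmul2l.
    by rewrite lee_fin mulr_ge0// exprn_ge0.
  rewrite le_eqVlt; apply/orP; left; apply/eqP; apply: eq_integral => y _.
  by rewrite /sqgrad /S; congr EFin; apply: eq_bigr => j _; rewrite partial_slice.
set P0 := (\int[_]_(_ in _) (_ ^+ 2)%:E)%E; set P1 := (\int[_]_(_ in _) (S _)%:E)%E in KS *.
have P00 : (0 <= P0)%E by exact: integral_ge0.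
have P10 : (0 <= P1)%E by apply: integral_ge0 => x _; rewrite lee_fin.
have ln0 : 0 <= l ^+ (n + 2) by exact: exprn_ge0.
apply: (@le_trans _ _ (l%:E * ((2 * l ^+ (n + 2))%:E * P0 +
    2%:E * ((2 ^+ n * l ^+ (n + 2))%:E * P1))))%E.
  by rewrite lee_wpmul2l ?lee_fin// leeD2l// lee_wpmul2l// lee_fin.
have p2 : 0 <= (2 ^+ n.+1 * l ^+ (n.+1 + 2) : R) by rewrite mulr_ge0// exprn_ge0.
rewrite (ge0_muleDr _ P00 P10) ge0_muleDr; last 2 first.
- by rewrite mule_ge0// lee_fin mulr_ge0.
- by rewrite mule_ge0 ?lee_fin// mule_ge0 ?lee_fin// mulr_ge0// exprn_ge0.
rewrite !muleA -!EFinM; apply: leeD; apply: lee_wpmul2r; rewrite ?lee_fin//.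
- rewrite addSn !exprS mulrCA mulrA [leRHS]mulrA ler_wpM2r//.
  by rewrite ler_wpM2r// ler_peMr// exprn_ege1// ler1n.
- by rewrite addSn !exprS le_eqVlt; apply/orP; left; apply/eqP; ring.
Qed.

End poincare_box.

(** * Powers with real exponents *)

Section real_powers.
Context {R : realType}.
Implicit Types (p t s : R).

Lemma continuous_abs_powR p : 0 < p -> continuous (fun t : R => `|t| `^ p).
Proof.
move=> p0 t; have [->|t0] := eqVneq t 0.
  apply/cvgrPdist_lt => e e0; rewrite normr0 powR0 ?gt_eqF//.
  near=> s; rewrite sub0r normrN ger0_norm ?powR_ge0//.
  have -> : e = (e `^ p^-1) `^ p by rewrite -powRrM mulVf ?gt_eqF// powRr1// ltW.
  apply: gt0_ltr_powR => //; rewrite ?nnegrE ?powR_ge0//.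
  near: s; have /cvgrPdist_lt/(_ (e `^ p^-1)) := @cvg_id _ (nbhs (0 : R)).
  rewrite powR_gt0// => /(_ isT); apply: filterS => s.
  by rewrite sub0r normrN.
apply: (@continuous_comp _ _ _ (fun t : R => `|t|) (fun t : R => t `^ p)).
  exact: norm_continuous.
apply: differentiable_continuous; apply/derivable1_diffP; apply: derivable_powR.
by rewrite in_itv/= andbT normr_gt0.
Unshelve. all: by end_near. Qed.

Lemma measurable_abs_powR p : measurable_fun setT (fun t : R => `|t| `^ p).
Proof. exact: (measurableT_comp (measurable_powR p) (@normr_measurable R setT)). Qed.

(** Twice the larger of |t| and |s| dominates |t + s|; no convexity is involved, so every p >= 0 is
    allowed. *)
Lemma powR_normD p t s : 0 <= p -> `|t + s| `^ p <= 2 `^ p * (`|t| `^ p + `|s| `^ p).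
Proof.
move=> p0; have h (u v : R) : `|u| <= `|v| -> `|u + v| `^ p <= 2 `^ p * `|v| `^ p.
  move=> uv; rewrite -powRM//; apply: ge0_ler_powR; rewrite ?nnegrE ?mulr_ge0//.
  by apply: (le_trans (ler_normD _ _)); lra.
rewrite mulrDr; have [ts|/ltW st] := leP `|t| `|s|.
  by apply: (le_trans (h _ _ ts)); rewrite lerDr mulr_ge0// powR_ge0.
by rewrite [t + s]addrC; apply: (le_trans (h _ _ st)); rewrite lerDl mulr_ge0// powR_ge0.
Qed.

Lemma geometric_sum_le (w : R) K : 0 <= w < 1 -> \sum_(0 <= j < K) w ^+ j <= (1 - w)^-1.
Proof.
move=> /andP[w0 w1].
have -> : \sum_(0 <= j < K) w ^+ j = (1 - w ^+ K) / (1 - w).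
  have w1' : 1 - w != 0 by rewrite subr_eq0 gt_eqF.
  elim: K => [|K IH]; first by rewrite big_geq// expr0 subrr mul0r.
  by rewrite big_nat_recr//= IH exprSr; field.
rewrite -[leRHS]mul1r; apply: ler_wpM2r; first by rewrite invr_ge0; lra.
by rewrite gerBl exprn_ge0.
Qed.

(* The maximum of the [|d j| / w ^+ j] is controlled by the p-th root of the sum of
   their p-th powers; this replaces Minkowski's inequality. *)
Lemma powR_sum_geometric p (w : R) (d : nat -> R) K : 0 < p -> 0 < w < 1 ->
  `|\sum_(0 <= j < K) d j| `^ p <=
  (1 - w)^-1 `^ p * \sum_(0 <= j < K) (`|d j| / w ^+ j) `^ p.
Proof.
move=> p0 /andP[w0 w1].
set S := \sum_(0 <= j < K) _ `^ p.
have S0 : 0 <= S by apply: sumr_ge0 => j _; exact: powR_ge0.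
pose M := S `^ p^-1.
have SM : S = M `^ p by rewrite -powRrM mulVf ?gt_eqF// powRr1.
have M0 : 0 <= M by exact: powR_ge0.
have dM j : (j < K)%N -> `|d j| <= M * w ^+ j.
  move=> jK; rewrite -ler_pdivrMr ?exprn_gt0//.
  have dj0 : 0 <= `|d j| / w ^+ j by rewrite divr_ge0// exprn_ge0// ltW.
  rewrite leNgt; apply/negP => H.
  have := @gt0_ltr_powR _ _ p0 M (`|d j| / w ^+ j); rewrite !nnegrE => /(_ M0 dj0 H).
  rewrite -SM ltNge => /negP; apply.
  rewrite /S big_mkord (bigD1 (Ordinal jK))//= lerDl.
  by apply: sumr_ge0 => i _; exact: powR_ge0.
rewrite {1}SM -powRM//; last by rewrite invr_ge0; lra.
apply: ge0_ler_powR; rewrite ?nnegrE ?mulr_ge0 ?invr_ge0//; [exact: ltW|lra|].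
apply: (le_trans (ler_norm_sum _ _ _)).
apply: (@le_trans _ _ (\sum_(0 <= j < K) M * w ^+ j)).
  by rewrite !big_mkord; apply: ler_sum => j _; exact: dM.
rewrite -mulr_sumr mulrC ler_wpM2r//.
by apply: geometric_sum_le; rewrite ltW.
Qed.

End real_powers.

(** * Fatou and Jensen inequalities *)

Section integral_lemmas.
Context {d} {T : measurableType d} {R : realType} (mu : {measure set T -> \bar R}).
Variable D : set T.
Hypothesis mD : measurable D.

Lemma fatou_bound (f_ : nat -> T -> \bar R) (f : T -> \bar R) (B : \bar R) :
  (forall k, measurable_fun D (f_ k)) -> measurable_fun D f ->
  (forall k x, D x -> (0 <= f_ k x)%E) ->
  {ae mu, forall x, D x -> f_ k x @[k --> \oo] --> f x} ->
  (\forall k \near \oo, \int[mu]_(x in D) f_ k x <= B)%E ->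
  (\int[mu]_(x in D) f x <= B)%E.
Proof.
move=> mf_ mf f_0 cf [N _ fB].
have mlim : measurable_fun D (fun x => limn_einf (f_ ^~ x)).
  have -> : (fun x => limn_einf (f_ ^~ x)) =
      (fun x => - limn_esup ((fun k y => - f_ k y) ^~ x))%E.
    apply/funext => x; rewrite -limn_einfN; congr limn_einf.
    by apply/funext => k /=; rewrite oppeK.
  apply: measurableT_comp => //; apply: measurable_fun_limn_esup => k.
  exact: measurableT_comp.
have ae_f : ae_eq mu D f (fun x => limn_einf (f_ ^~ x)).
  by move: cf; apply: filterS => x /[apply] /cvg_limn_einf_sup[-> _].
rewrite (ae_eq_integral _ _ mD mf mlim ae_f).
apply: (le_trans (fatou mu mD mf_ f_0)); rewrite limn_einf_lim.
apply: lime_le; first exact: is_cvg_einfs.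
(* The index [maxn k N] belongs to the tail starting at k and lies past N, beyond which the bound by
   B holds. *)
apply: nearW => k; apply: (@le_trans _ _ (\int[mu]_(x in D) f_ (maxn k N) x)%E).
  by apply: ereal_inf_lbound; exists (maxn k N) => //=; rewrite leq_maxl.
by apply: fB => /=; exact: leq_maxr.
Qed.

(** Integrate 2 c h - c^2 <= h^2, where c is the mean of h. The bound [M] provides integrability on
    a set of finite measure. *)
Lemma jensen_sqr (h : T -> R) (M V : R) : measurable_fun D h ->
  (forall x, D x -> `|h x| <= M) -> mu D = V%:E -> 0 < V ->
  (((V^-1 * \int[mu]_(x in D) h x) ^+ 2)%:E <= V^-1%:E * \int[mu]_(x in D) (h x ^+ 2)%:E)%E.
Proof.
move=> mh hM DV V0.
have Dfin : (mu D < +oo)%E by rewrite DV ltry.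
have bdd_int (g : T -> R) (C : R) : measurable_fun D g -> (forall x, D x -> `|g x| <= C) ->
    mu.-integrable D (EFin \o g).
  move=> mg gC; apply: measurable_bounded_integrable => //.
  exists C; split; first exact: num_real.
  by move=> y Cy x Dx; apply: (le_trans (gC _ Dx)); exact: ltW.
have ih := bdd_int _ _ mh hM.
have ih2 : mu.-integrable D (EFin \o (fun x => h x ^+ 2)).
  apply: (bdd_int _ (M ^+ 2)); first exact: measurable_funX.
  by move=> x Dx; rewrite normrX lerXn2r ?nnegrE ?hM//; exact: le_trans (hM _ Dx).
rewrite -(fineK (integrable_fin_num _ ih2))// -EFinM lee_fin.
rewrite -[fine _]/(Rintegral mu D (fun r => h r ^+ 2)).
set I := Rintegral mu D h; pose c := V^-1 * I.
have ic : mu.-integrable D (EFin \o cst (c ^+ 2)).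
  exact: (bdd_int _ `|c ^+ 2|).
have i2 : mu.-integrable D (EFin \o (fun x => 2 * c * h x)) := integrableZl mD (2 * c) ih.
rewrite -ler_pdivrMl ?invr_gt0// invrK.
have -> : V * c ^+ 2 = 2 * c * I - c ^+ 2 * V by rewrite /c; field; rewrite gt_eqF.
have -> : c ^+ 2 * V = Rintegral mu D (cst (c ^+ 2)) by rewrite Rintegral_cst// DV.
have -> : 2 * c * I - Rintegral mu D (cst (c ^+ 2)) =
    Rintegral mu D (fun x => 2 * c * h x - c ^+ 2).
  by rewrite (RintegralB mD i2 ic) (RintegralZl (2 * c) mD ih).
apply: le_Rintegral => //; first exact: (integrableB mD i2 ic).
by move=> x _; have := sqr_ge0 (h x - c); rewrite /cst sqrrB; nra.
Qed.

End integral_lemmas.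

(** * Averages over dyadic cells *)

Section averages.
Context {R : realType} {n : nat}.
Local Notation mu := (@lebesgue_row R n).
Implicit Types (psi : 'rV[R]_n -> R) (k : nat) (x : 'rV[R]_n).

(** The preimage of any set whatsoever is a union of cells of generation k, and there are countably
    many of them. *)
Lemma measurable_cell_constant k d (T : measurableType d) (g : 'rV[R]_n -> T) :
  (forall x y, cell k x y -> g x = g y) -> measurable_fun setT g.
Proof.
move=> gc _ Y _; rewrite setTI.
pose B (z : 'rV[int]_n) : set 'rV[R]_n := box (\row_i ((z 0 i)%:~R / 2 ^+ k)) (2 ^- k).
have BE x : B (\row_i Num.floor (2 ^+ k * x 0 i)) = cell k x.
  by rewrite /B /cell; congr box; apply/rowP => i; rewrite !mxE.
pose F z := if `[< B z `<=` g @^-1` Y >] then B z else set0.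
have -> : g @^-1` Y = \bigcup_z F z.
  apply/seteqP; split => [x Yx|x [z _]]; last first.
    by rewrite /F; case: asboolP => // BU; exact: BU.
  exists (\row_i Num.floor (2 ^+ k * x 0 i)) => //; rewrite /F BE.
  case: asboolP => [_|]; first exact: cell_refl.
  by move=> h; exfalso; apply: h => y xy; rewrite /preimage/= -(gc _ _ xy).
apply: countable_bigcupT_measurable; first exact: countableP.
by move=> z; rewrite /F; case: asboolP => // _; exact: measurable_box.
Qed.

(** Conditional expectation on the k-th dyadic partition; the prefactor is the inverse of the volume
    of a cell. *)
Definition avg k psi x : R := (2 ^+ k) ^+ n * \int[mu]_(y in cell k x) psi y.

Lemma avg_cell k psi x y : cell k x y -> avg k psi x = avg k psi y.
Proof. by move=> /cell_eq xy; rewrite /avg xy. Qed.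

Lemma measurable_avg k psi : measurable_fun setT (avg k psi).
Proof. by apply: (@measurable_cell_constant k) => x y; exact: avg_cell. Qed.

Lemma measurable_cell k x : measurable (cell k x). Proof. exact: measurable_box. Qed.

Let cell_volume k x : mu (cell k x) = (((2 ^+ k) ^+ n)^-1)%:E.
Proof. by rewrite lebesgue_row_cell exprVn. Qed.

Lemma bounded_integrable_cell k psi x (M : R) : measurable_fun setT psi ->
  (forall y, `|psi y| <= M) -> mu.-integrable (cell k x) (EFin \o psi).
Proof.
move=> mpsi psiM; apply: measurable_bounded_integrable.
- exact: measurable_cell.
- by rewrite [X in (X < _)%E]cell_volume ltry.
- exact: measurable_funTS.
- exists M; split; first exact: num_real.
  by move=> y My z _; apply: (le_trans (psiM z)); exact: ltW.
Qed.

Lemma avgB k psi x (M c : R) : measurable_fun setT psi -> (forall y, `|psi y| <= M) ->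
  (2 ^+ k) ^+ n * \int[mu]_(y in cell k x) (psi y - c) = avg k psi x - c.
Proof.
move=> mpsi psiM; have i1 := bounded_integrable_cell k x mpsi psiM.
have i2 : mu.-integrable (cell k x) (EFin \o cst c).
  by apply: (@bounded_integrable_cell _ _ _ `|c|).
rewrite (RintegralB (measurable_cell k x) i1 i2) mulrBr; congr (_ - _).
rewrite Rintegral_cst; last exact: measurable_cell.
rewrite [X in fine X]cell_volume /=.
by rewrite mulrCA divff ?mulr1// !expf_neq0.
Qed.

Lemma avg_cvg psi x : continuous psi -> (exists M, forall y, `|psi y| <= M) ->
  avg k psi x @[k --> \oo] --> psi x.
Proof.
move=> cpsi [M psiM]; have mpsi := continuous_measurable_row cpsi.
apply/cvgrPdist_le => e e0; have [k0 k0e] := continuous_cell x cpsi e0.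
exists k0 => // k /= k0k; rewrite distrC -(avgB k x (psi x) mpsi psiM).
have k20 : 0 < (2 ^+ k) ^+ n :> R by rewrite !exprn_gt0.
have mc := measurable_cell k x.
have ie (c : R) : mu.-integrable (cell k x) (EFin \o cst c).
  by apply: (@bounded_integrable_cell _ _ _ `|c|).
have ii : mu.-integrable (cell k x) (EFin \o (fun y => psi y - psi x)).
  exact: (integrableB mc (bounded_integrable_cell k x mpsi psiM) (ie _)).
rewrite normrM gtr0_norm// -ler_pdivlMl//.
apply: (le_trans (le_normr_Rintegral mc ii)).
apply: (@le_trans _ _ (\int[mu]_(y in cell k x) cst e y)).
  apply: le_Rintegral => //; first exact: integrable_norm.
  by move=> y xy; rewrite distrC /cst ltW//; exact: (k0e k k0k y xy).
rewrite Rintegral_cst// [X in fine X]cell_volume /=.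
by rewrite mulrC.
Qed.

(** The left side is the squared average of psi - [avg k psi x] over the child cell. Jensen on the
    child, enlargement to the parent, Jensen again (psi y - avg is the average of psi y - psi z over
    z) and [poincare_box] with side 2^-k give the factors (2^(k+1))^n, 2^(k n) and 2^n 2^(-k (n +
    2)). *)
Lemma avg_step k psi x : c1 psi -> (exists M, forall y, `|psi y| <= M) ->
  (((avg k.+1 psi x - avg k psi x) ^+ 2)%:E <=
   (4 ^+ n * (2 ^+ k) ^+ n / 4 ^+ k)%:E * \int[mu]_(y in cell k x) (sqgrad psi y)%:E)%E.
Proof.
move=> cpsi [M psiM]; have mpsi := c1_measurable cpsi.
have V0 j : 0 < ((2 ^+ j) ^+ n)^-1 :> R by rewrite invr_gt0 !exprn_gt0.
have sub : cell k.+1 x `<=` cell k x by exact: cellS.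
have mc j : measurable (cell j x) by exact: measurable_cell.
have msqB c A : measurable_fun A (fun y => ((psi y - c) ^+ 2)%:E).
  apply/measurable_EFinP; apply: measurable_funX; apply: measurable_funB => //.
  exact: measurable_funTS.
have sq0 (r : R) : (0 <= (r ^+ 2)%:E)%E by rewrite lee_fin sqr_ge0.
set a := avg k psi x.
have bd c y : `|psi y - c| <= M + `|c|.
  by apply: (le_trans (ler_normB _ _)); rewrite lerD2r.
rewrite -(avgB k.+1 x a mpsi psiM).
have J j c := @jensen_sqr _ _ _ mu (cell j x) (mc j) (fun y => psi y - c) (M + `|c|)
  ((2 ^+ j) ^+ n)^-1 (measurable_funTS (measurable_funB mpsi (measurable_cst c)))
  (fun y _ => bd c y) (cell_volume j x) (V0 j).
have := J k.+1 a; rewrite invrK => /le_trans; apply.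
have le1 : (\int[mu]_(y in cell k.+1 x) ((psi y - a) ^+ 2)%:E <=
   \int[mu]_(y in cell k x) ((psi y - a) ^+ 2)%:E)%E.
  exact: ge0_subset_integral.
have le2 : (\int[mu]_(y in cell k x) ((psi y - a) ^+ 2)%:E <=
   \int[mu]_(y in cell k x) (((2 ^+ k) ^+ n)%:E *
     \int[mu]_(z in cell k x) ((psi y - psi z) ^+ 2)%:E))%E.
  apply: ge0_le_integral => //.
  - apply: measurable_funeM; apply: measurable_funTS.
    apply: (@measurable_integral_section _ _ _ _ _ mu (cell k x)
      (fun x y => ((psi x - psi y) ^+ 2)%:E)) => //.
    apply/measurable_EFinP; apply: measurable_funX; apply: measurable_funB.
      exact: measurableT_comp measurable_fst.
    exact: measurableT_comp measurable_snd.
  - move=> y _; have := J k (psi y); rewrite invrK (avgB k x (psi y) mpsi psiM).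
    rewrite -[X in (X%:E <= _)%E]sqrrN opprB => /le_trans; apply.
    rewrite lee_wpmul2l ?lee_fin ?exprn_ge0//.
    rewrite le_eqVlt; apply/orP; left; apply/eqP; apply: eq_integral => z _.
    by rewrite -sqrrN opprB.
rewrite ge0_integralZl// in le2; last 2 first.
- apply: measurable_funTS.
  apply: (@measurable_integral_section _ _ _ _ _ mu (cell k x)
      (fun x y => ((psi x - psi y) ^+ 2)%:E)) => //.
  apply/measurable_EFinP; apply: measurable_funX; apply: measurable_funB.
    exact: measurableT_comp measurable_fst.
  exact: measurableT_comp measurable_snd.
- by move=> y _; exact: integral_ge0.
have le3 := @poincare_box _ n (corner k x) (2 ^- k) psi cpsi.
rewrite invr_ge0 exprn_ge0// in le3; have {}le3 := le3 isT.
have k0 : 0 < 2 ^+ k :> R by rewrite exprn_gt0.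
apply: (@le_trans _ _ (((2 ^+ k.+1) ^+ n)%:E * (((2 ^+ k) ^+ n)%:E *
  ((2 ^+ n * (2 ^- k) ^+ (n + 2))%:E * \int[mu]_(y in cell k x) (sqgrad psi y)%:E))))%E.
  apply: lee_wpmul2l; first by rewrite lee_fin !exprn_ge0.
  apply: (le_trans le1); apply: (le_trans le2).
  by apply: lee_wpmul2l => //; rewrite lee_fin !exprn_ge0.
rewrite !muleA -!EFinM; apply: lee_wpmul2r.
  by apply: integral_ge0 => y _; rewrite lee_fin sqgrad_ge0.
rewrite lee_fin le_eqVlt; apply/orP; left; apply/eqP.
have -> : (4 : R) = 2 ^+ 2 by rewrite expr2; lra.
rewrite exprS exprMn exprD -!exprM ![(2 * _)%N]mulnC [X in _ = _ * _ ^- X]mulnC.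
rewrite exprVn -exprM.
have -> : 2 ^+ (n * 2) = 2 ^+ n * 2 ^+ n :> R by rewrite exprM expr2.
have -> : 2 ^- k ^+ 2 = 2 ^- (k * 2) :> R by rewrite exprVn -exprM.
by rewrite [(2 * k)%N]mulnC; field; rewrite !expf_neq0.
Qed.

End averages.

(** * Geometric decay of the dyadic increments *)

Section telescoping.
Context {R : realType} {n : nat}.
Local Notation mu := (@lebesgue_row R n).
Implicit Types (psi : 'rV[R]_n -> R) (k : nat).

Lemma measurable_same_cell k : measurable [set z : 'rV[R]_n * 'rV[R]_n | cell k z.1 z.2].
Proof.
pose B (z : 'rV[int]_n) : set 'rV[R]_n := box (\row_i ((z 0 i)%:~R / 2 ^+ k)) (2 ^- k).
have BE (x : 'rV[R]_n) : B (\row_i Num.floor (2 ^+ k * x 0 i)) = cell k x.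
  by rewrite /B /cell; congr box; apply/rowP => i; rewrite !mxE.
pose F z := if `[< B z `*` B z `<=` [set z | cell k z.1 z.2] >] then B z `*` B z else set0.
rewrite (_ : mkset _ = \bigcup_z F z).
  apply: countable_bigcupT_measurable; first exact: countableP.
  by move=> z; rewrite /F; case: asboolP => // _; apply: measurableX; exact: measurable_box.
apply/seteqP; split => [[x y]/= xy|x [z _]]; last first.
  by rewrite /F; case: asboolP => // BU; exact: BU.
exists (\row_i Num.floor (2 ^+ k * x 0 i)) => //; rewrite /F BE.
case: asboolP => [_|]; first by split => //; exact: cell_refl.
by move=> h; exfalso; apply: h => -[u v] [/= xu xv]; rewrite (cell_eq xu).
Qed.

(** Since [cell] is symmetric, a point y is counted once for each x of its own cell, that is, with
    the volume of this cell. *)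
Lemma integral_cell_tonelli k (S : 'rV[R]_n -> R) : measurable_fun setT S ->
  (forall x, 0 <= S x) ->
  (\int[mu]_x \int[mu]_(y in cell k x) (S y)%:E =
   (((2 ^+ k) ^+ n)^-1)%:E * \int[mu]_x (S x)%:E)%E.
Proof.
move=> mS S0.
pose E := [set z : 'rV[R]_n * 'rV[R]_n | cell k z.1 z.2].
have mE : measurable E by exact: measurable_same_cell.
pose h (x y : 'rV[R]_n) : \bar R := ((fun z => (S z.2)%:E) \_ E) (x, y).
have mh : measurable_fun [set: 'rV[R]_n * 'rV[R]_n] (fun z => h z.1 z.2).
  apply: (@eq_measurable_fun _ _ _ _ _ ((fun z => (S z.2)%:E) \_ E)); first by move=> -[].
  apply/(measurable_restrict _ mE measurableT); apply: measurable_funTS.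
  by apply/measurable_EFinP; exact: measurableT_comp measurable_snd.
have h0 x y : (0 <= h x y)%E by rewrite /h patchE; case: ifP => // _; rewrite lee_fin.
have hE x y : h x y = ((fun y => (S y)%:E) \_ (cell k x)) y.
  by rewrite /h !patchE; congr (if _ then _ else _).
transitivity (\int[mu]_x \int[mu]_y h x y)%E.
  apply: eq_integral => x _; rewrite integral_mkcond; apply: eq_integral => y _.
  by rewrite hE.
rewrite (tonelli_swap mu mu measurableT measurableT mh h0).
rewrite -ge0_integralZl//; last 2 first.
- exact/measurable_EFinP.
- by move=> x _; rewrite lee_fin.
apply: eq_integral => y _; transitivity (\int[mu]_(x in cell k y) cst (S y)%:E x)%E.
  rewrite [RHS]integral_mkcond; apply: eq_integral => x _.
  rewrite hE !patchE; congr (if _ then _ else _).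
  by apply/idP/idP; rewrite !inE; exact: cell_sym.
rewrite integral_cst; last exact: measurable_box.
by rewrite muleC; congr (_ * _)%E; rewrite -exprVn; exact: lebesgue_row_cell.
Qed.

(** The subcritical condition acts here. With q = (p - 2) / 2, r = 2^n / 4 and c = 4^n r^k, the
    integral is at most c^(q + 1) (2^k)^-n A^(q + 1), and the resulting rate t = r^q / 4 is below 1
    exactly when (n - 2)(p - 2) < 4. *)
Lemma avg_step_powR (p : R) : 2 <= p -> (n%:R - 2) * (p - 2) < 4 ->
  exists C t : R, [/\ 0 <= C, 0 < t < 1 & forall psi A, c1 psi ->
    (exists M, forall y, `|psi y| <= M) -> (\int[mu]_x (sqgrad psi x)%:E <= A%:E)%E ->
    forall k, (\int[mu]_x (`|avg k.+1 psi x - avg k psi x| `^ p)%:E <=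
      (C * t ^+ k * A `^ (p / 2))%:E)%E].
Proof.
move=> p2 crit.
pose q := (p - 2) / 2; have q0 : 0 <= q by rewrite /q; lra.
pose r : R := 2 ^+ n / 4; have r0 : 0 < r by rewrite divr_gt0// exprn_gt0.
have e2 : 2 `^ 2 = 4 :> R.
  by rewrite (_ : 2 `^ 2 = 2 ^+ 2); [rewrite expr2; lra|exact: (@powR_mulrn R 2 2)].
have rq4 : r `^ q < 4.
  have -> : r = 2 `^ (n%:R - 2).
    rewrite powRB; last by rewrite pnatr_eq0 implybT.
    by rewrite e2 powR_mulrn.
  rewrite -e2.
  rewrite -powRrM /powR (gt_eqF)// ltr_expR ltr_pM2r ?ln_gt0// ?ltr1n//.
  by rewrite /q; lra.
exists (4 ^+ n * (4 ^+ n) `^ q), (r `^ q / 4); split.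
- by rewrite mulr_ge0 ?powR_ge0// exprn_ge0.
- by rewrite divr_gt0 ?powR_gt0//= ltr_pdivrMr// mul1r.
move=> psi A cpsi bpsi SA k.
have A0 : 0 <= A.
  rewrite -lee_fin; apply: le_trans SA; apply: integral_ge0 => x _.
  by rewrite lee_fin sqgrad_ge0.
pose c : R := 4 ^+ n * (2 ^+ k) ^+ n / 4 ^+ k.
have c0 : 0 <= c by rewrite divr_ge0 ?mulr_ge0 ?exprn_ge0.
have mS := measurable_sqgrad cpsi.
pose s x : \bar R := (\int[mu]_(y in cell k x) (sqgrad psi y)%:E)%E.
have s0 x : (0 <= s x)%E by apply: integral_ge0 => y _; rewrite lee_fin sqgrad_ge0.
have ms : measurable_fun setT s.
  by apply: (@measurable_cell_constant _ _ k) => x y /cell_eq xy; rewrite /s xy.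
have sA x : (s x <= A%:E)%E.
  apply: le_trans SA; apply: ge0_subset_integral => //.
  - exact: measurable_box.
  - exact/measurable_EFinP.
  - by move=> y _; rewrite lee_fin sqgrad_ge0.
(* Write |d|^p as (d^2)^q d^2. The factor (d^2)^q is bounded uniformly, by (c A)^q; only d^2 keeps
   the local energy [s x], which is then integrated. *)
have pt x : ((`|avg k.+1 psi x - avg k psi x| `^ p)%:E <= ((c * A) `^ q * c)%:E * s x)%E.
  have sfin : s x \is a fin_num.
    by rewrite ge0_fin_numE//; apply: le_lt_trans (sA x) _; exact: ltry.
  have := avg_step k x cpsi bpsi; rewrite -/c -/(s x) -(fineK sfin) -!EFinM !lee_fin.
  have s0' : 0 <= fine (s x) by rewrite -lee_fin fineK.
  have sA' : fine (s x) <= A by rewrite -lee_fin fineK.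
  set d := _ - _ => dle.
  have -> : p = 2%:R * (q + 1) by rewrite /q; field.
  rewrite powRrM powR_mulrn// real_normK ?num_real// powRD; last first.
    by rewrite (_ : (q + 1 == 0) = false)//; apply/negP => /eqP; lra.
  rewrite powRr1 ?sqr_ge0// -mulrA; apply: ler_pM => //; rewrite ?powR_ge0 ?sqr_ge0//.
  apply: ge0_ler_powR; rewrite ?nnegrE ?sqr_ge0//; first by rewrite mulr_ge0.
  by apply: (le_trans dle); rewrite ler_wpM2l.
have cA0 : 0 <= (c * A) `^ q * c by rewrite mulr_ge0// powR_ge0.
apply: (@le_trans _ _ (\int[mu]_x (((c * A) `^ q * c)%:E * s x))%E).
  apply: ge0_le_integral => //.
  - apply/measurable_EFinP; apply: (measurableT_comp (measurable_abs_powR p)).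
    by apply: measurable_funB; exact: measurable_avg.
  - exact: measurable_funeM.
rewrite ge0_integralZl// integral_cell_tonelli//; last exact: sqgrad_ge0.
rewrite muleA -EFinM.
have V0 : 0 <= ((2 ^+ k) ^+ n)^-1 :> R by rewrite invr_ge0 !exprn_ge0.
apply: (@le_trans _ _ (((c * A) `^ q * c * ((2 ^+ k) ^+ n)^-1)%:E * A%:E)%E).
  by rewrite lee_wpmul2l// lee_fin mulr_ge0.
rewrite -EFinM lee_fin le_eqVlt; apply/orP; left; apply/eqP.
rewrite powRM// (_ : p / 2 = q + 1); last by rewrite /q; field.
rewrite powRD; last first.
  by rewrite (_ : (q + 1 == 0) = false)//; apply/negP => /eqP; lra.
rewrite (powRr1 A0).
have -> : c `^ q = (4 ^+ n) `^ q * (r `^ q) ^+ k.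
  have -> : c = 4 ^+ n * r ^+ k.
    by rewrite /c /r exprMn exprVn mulrA -!exprM mulnC.
  rewrite powRM ?exprn_ge0// ?ltW//; congr (_ * _).
  by rewrite -powR_mulrn ?ltW// powRAC powR_mulrn// powR_ge0.
rewrite exprMn exprVn /c; field.
by rewrite !expf_neq0.
Qed.

(** The averages converge pointwise to the continuous psi, so psi - [avg k psi] is the sum of the
    increments from generation k on; Fatou passes from the finite sums to the limit. *)
Lemma avg_approx (p : R) : 2 <= p -> (n%:R - 2) * (p - 2) < 4 ->
  exists C t : R, [/\ 0 <= C, 0 < t < 1 & forall psi A, c1 psi ->
    (exists M, forall y, `|psi y| <= M) -> (\int[mu]_x (sqgrad psi x)%:E <= A%:E)%E ->
    forall k, (\int[mu]_x (`|psi x - avg k psi x| `^ p)%:E <=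
      (C * t ^+ k * A `^ (p / 2))%:E)%E].
Proof.
move=> p2 crit; have [C [t [C0 /andP[t0 t1] H]]] := avg_step_powR p2 crit.
have p0 : 0 < p by lra.
(* Half of the decay is spent: with w^p = s = sqrt t, the weights in [powR_sum_geometric] cost s^-j
   against the t^j of the increments and leave the summable s^j. *)
pose s := Num.sqrt t; have s0 : 0 < s by rewrite sqrtr_gt0.
have ss : s * s = t by rewrite -expr2 sqr_sqrtr// ltW.
have s1 : s < 1 by have := s0; nra.
pose w := s `^ p^-1.
have wp : w `^ p = s by rewrite /w -powRrM mulVf ?gt_eqF// powRr1// ltW.
have w0 : 0 < w by rewrite powR_gt0.
have w1 : w < 1.
  rewrite ltNge; apply/negP => w1; have := @ge0_ler_powR _ p (ltW p0) 1 w.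
  by rewrite !nnegrE ler01 (ltW w0) powR1 wp => /(_ isT isT w1); rewrite leNgt s1.
pose W : R := (1 - w)^-1 `^ p.
have W0 : 0 <= W by exact: powR_ge0.
exists (W * C * (1 - s)^-1), t; split.
- by rewrite !mulr_ge0// invr_ge0; lra.
- by rewrite t0.
move=> psi A cpsi bpsi SA k; set B := A `^ (p / 2).
have B0 : 0 <= B by exact: powR_ge0.
have md j : measurable_fun setT (fun x => avg j.+1 psi x - avg j psi x).
  by apply: measurable_funB; exact: measurable_avg.
have mpsi := c1_measurable cpsi.
apply: (@fatou_bound _ _ _ mu setT _
    (fun K x => (`|avg (k + K) psi x - avg k psi x| `^ p)%:E)) => //.
- move=> K; apply/measurable_EFinP; apply: (measurableT_comp (measurable_abs_powR p)).
  by apply: measurable_funB; exact: measurable_avg.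
- apply/measurable_EFinP; apply: (measurableT_comp (measurable_abs_powR p)).
  by apply: measurable_funB => //; exact: measurable_avg.
- apply: aeW => x _; apply/fine_cvgP; split; first exact: nearW.
  apply: (@continuous_cvg _ _ _ _ _ _ (fun t : R => `|t| `^ p)).
    exact: continuous_abs_powR.
  apply: cvgB; last exact: cvg_cst.
  rewrite (_ : (fun K => avg (k + K) psi x) = (fun K => avg (K + k) psi x)); last first.
    by apply/funext => K; rewrite addnC.
  have := avg_cvg (x := x) cpsi.1 bpsi; rewrite -(cvg_shiftn k); exact.
apply: nearW => K.
pose e j : R := s ^- j.
have we (u : R) j : 0 <= u -> (u / w ^+ j) `^ p = e j * u `^ p.
  move=> u0; have wj : 0 <= w^-1 by rewrite invr_ge0 ltW.
  rewrite powRM// ?invr_ge0 ?exprn_ge0// 1?ltW// mulrC; congr (_ * _).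
  rewrite -exprVn -powR_mulrn// powRAC powR_mulrn ?powR_ge0//.
  by rewrite -(powR_inv1 (ltW w0)) powRAC wp powR_inv1 ?exprVn// ltW.
have pt x : ((`|avg (k + K) psi x - avg k psi x| `^ p)%:E <=
    \sum_(0 <= j < K) (W * e j)%:E * (`|avg (k + j).+1 psi x - avg (k + j) psi x| `^ p)%:E)%E.
  have -> : avg (k + K) psi x - avg k psi x =
      \sum_(0 <= j < K) (avg (k + j).+1 psi x - avg (k + j) psi x).
    rewrite -[in RHS](@eq_big_nat _ _ _ _ _ (fun j => avg (k + j.+1) psi x - avg (k + j) psi x)).
      by rewrite (@telescope_sumr _ 0 K (fun j => avg (k + j) psi x))// addn0.
    by move=> j _; rewrite addnS.
  rewrite [leRHS](_ : _ = (\sum_(0 <= j < K)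
      W * e j * (`|avg (k + j).+1 psi x - avg (k + j) psi x| `^ p))%:E); last first.
    by rewrite -sumEFin; apply: eq_bigr => j _; rewrite EFinM.
  rewrite lee_fin; apply: (le_trans (@powR_sum_geometric _ p w _ _ p0 _)).
    by rewrite w0 w1.
  rewrite -/W mulr_sumr; apply: ler_sum => j _; rewrite -mulrA ler_wpM2l//.
  by rewrite we.
have mt j : measurable_fun setT
    (fun x => (W * e j)%:E * (`|avg (k + j).+1 psi x - avg (k + j) psi x| `^ p)%:E)%E.
  apply: measurable_funeM; apply/measurable_EFinP.
  exact: (measurableT_comp (measurable_abs_powR p)).
have e0 j : 0 <= e j by rewrite invr_ge0 exprn_ge0// ltW.
have t0' j x : (0 <= (W * e j)%:E * (`|avg (k + j).+1 psi x - avg (k + j) psi x| `^ p)%:E)%E.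
  by rewrite mule_ge0// lee_fin ?powR_ge0// mulr_ge0.
apply: (@le_trans _ _ (\int[mu]_x \sum_(0 <= j < K)
    ((W * e j)%:E * (`|avg (k + j).+1 psi x - avg (k + j) psi x| `^ p)%:E))%E).
  apply: ge0_le_integral => //.
  - apply/measurable_EFinP; apply: (measurableT_comp (measurable_abs_powR p)).
    by apply: measurable_funB; exact: measurable_avg.
  - exact: emeasurable_sum.
rewrite ge0_integral_sum//.
apply: (@le_trans _ _ (\sum_(0 <= j < K) (W * e j * (C * t ^+ (k + j) * B))%:E)%E).
  apply: lee_sum => j _; rewrite ge0_integralZl//; last 2 first.
  - by apply/measurable_EFinP; exact: (measurableT_comp (measurable_abs_powR p)).
  - by rewrite lee_fin mulr_ge0.
  rewrite [leRHS]EFinM lee_wpmul2l ?lee_fin ?mulr_ge0//.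
  exact: H.
rewrite sumEFin lee_fin.
have -> : \sum_(0 <= j < K) W * e j * (C * t ^+ (k + j) * B) =
    W * C * t ^+ k * B * \sum_(0 <= j < K) s ^+ j.
  rewrite mulr_sumr; apply: eq_bigr => j _; rewrite exprD -ss !exprMn /e.
  by field; rewrite expf_neq0// gt_eqF.
have -> : W * C / (1 - s) * t ^+ k * B = W * C * t ^+ k * B * (1 - s)^-1 by ring.
apply: ler_wpM2l; first by rewrite !mulr_ge0// exprn_ge0// ltW.
by apply: geometric_sum_le; rewrite s1 ltW.
Qed.

End telescoping.

(** * Poincare and Sobolev inequalities for test functions *)

Section test_functions.
Context {R : realType} {n : nat}.
Variable Omega : set 'rV[R]_n.
Hypotheses (openO : open Omega) (boundedO : bounded_set Omega).
Implicit Types (phi psi : 'rV[R]_n -> R).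
Local Notation mu := (@lebesgue_row R n).
Local Notation tf := (test_function Omega).

(** One closure lemma for test functions then serves differences (coefficients 1, -1), midpoints,
    rescalings (s, 0) and competitors on the sphere. *)
Definition lincomb (a : R) phi (b : R) psi : 'rV[R]_n -> R := fun x => a * phi x + b * psi x.

Lemma derivable_lincomb a phi b psi x v : derivable phi x v -> derivable psi x v ->
  derivable (lincomb a phi b psi) x v.
Proof.
by move=> dp ds; apply: (@derivableD _ _ _ (a \*: phi) (b \*: psi)); exact: derivableZ.
Qed.

Lemma partial_lincomb a phi b psi i x :
  derivable phi x (delta_mx 0 i) -> derivable psi x (delta_mx 0 i) ->
  partial i (lincomb a phi b psi) x = a * partial i phi x + b * partial i psi x.
Proof.
move=> dp ds; rewrite /partial -[lincomb _ _ _ _]/((a \*: phi) + (b \*: psi)).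
have da : derivable (a \*: phi) x (delta_mx 0 i) by exact: derivableZ.
have db : derivable (b \*: psi) x (delta_mx 0 i) by exact: derivableZ.
by rewrite (deriveD da db) (deriveZ a dp) (deriveZ b ds).
Qed.

Lemma continuous_lincomb a phi b psi : continuous phi -> continuous psi ->
  continuous (lincomb a phi b psi).
Proof.
move=> cp cs x; apply: (@continuousD _ _ _ (fun x => a * phi x) (fun x => b * psi x)).
  by apply: (@continuousM _ _ (fun=> a) phi); [exact: cst_continuous|exact: cp].
by apply: (@continuousM _ _ (fun=> b) psi); [exact: cst_continuous|exact: cs].
Qed.

Lemma foldr_partial_lincomb a phi b psi s : smooth phi -> smooth psi ->
  foldr (@partial R n) (lincomb a phi b psi) s =
  lincomb a (foldr (@partial R n) phi s) b (foldr (@partial R n) psi s).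
Proof.
move=> sp ss; elim: s => [//|i s IH] /=; rewrite IH; apply/funext => x.
by rewrite partial_lincomb//; [exact: (sp s).2|exact: (ss s).2].
Qed.

Lemma smooth_lincomb a phi b psi : smooth phi -> smooth psi -> smooth (lincomb a phi b psi).
Proof.
move=> sp ss s; rewrite /= foldr_partial_lincomb//; split.
  by apply: continuous_lincomb; [exact: (sp s).1|exact: (ss s).1].
by move=> i x; apply: derivable_lincomb; [exact: (sp s).2|exact: (ss s).2].
Qed.

Lemma test_function_lincomb a phi b psi : tf phi -> tf psi -> tf (lincomb a phi b psi).
Proof.
move=> [sp kp pO] [ss ks sO].
have sub : closure [set x | lincomb a phi b psi x != 0] `<=`
    closure [set x | phi x != 0] `|` closure [set x | psi x != 0].
  rewrite -closureU; apply: closure_subset => x /=; rewrite /lincomb => h.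
  have [p0|p0] := eqVneq (phi x) 0; last by left.
  by right; apply: contraNN h => /eqP ->; rewrite p0 !mulr0 addr0.
split; first exact: smooth_lincomb.
  by apply: subclosed_compact sub; [exact: closed_closure|exact: compactU].
by move=> x /sub[/pO|/sO].
Qed.

Lemma test_function_c1 phi : tf phi -> c1 phi.
Proof.
move=> [sp _ _]; split; first exact: (sp [::]).1.
by move=> i; split; [exact: (sp [::]).2|exact: (sp [:: i]).1].
Qed.

(** Vanishing near the point, and not only at it, makes the partial derivatives vanish off [Omega]
    as well ([partial_out]), so that energies may be integrated over the whole space. *)
Lemma test_function_supp phi x : tf phi -> ~ Omega x -> \near x, phi x = 0.
Proof.
move=> [sp kp pO] Ox.
have : open_nbhs x (~` closure [set x | phi x != 0]).
  by split; [exact/closed_openC/closed_closure|move=> /pO].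
move=> /open_nbhs_nbhs; apply: filterS => y; rewrite /= => h.
by apply/eqP; apply: contrapT => /negP p0; apply: h; exact: subset_closure.
Qed.

Lemma test_function_out phi x : tf phi -> ~ Omega x -> phi x = 0.
Proof. by move=> tp Ox; exact: nbhs_singleton (test_function_supp tp Ox). Qed.

Lemma partial_out phi i x : tf phi -> ~ Omega x -> partial i phi x = 0.
Proof.
move=> tp Ox; rewrite /partial.
rewrite (@near_eq_derive _ _ _ _ (fun=> 0) _ _ (test_function_supp tp Ox)).
exact: derive_cst.
Qed.

Lemma continuous_compact_bounded phi (g : 'rV[R]_n -> R) : tf phi -> continuous g ->
  (forall x, ~ closure [set x | phi x != 0] x -> g x = 0) -> exists M, forall x, `|g x| <= M.
Proof.
move=> [sp kp pO] cg g0.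
have : compact (g @` closure [set x | phi x != 0]).
  by apply: continuous_compact => //; exact: continuous_subspaceT.
move=> /compact_bounded[M [_ /(_ (`|M| + 1))]].
have -> : M < `|M| + 1 by rewrite (le_lt_trans (ler_norm M))// ltrDl.
move=> /(_ isT) gM; exists (`|M| + 1) => x.
have [xp|xp] := pselect (closure [set x | phi x != 0] x); last by rewrite g0// normr0.
by apply: gM; exists x.
Qed.

Lemma test_function_bounded phi : tf phi -> exists M, forall x, `|phi x| <= M.
Proof.
move=> tp; apply: (continuous_compact_bounded tp); first exact: (test_function_c1 tp).1.
move=> x xp; apply/eqP; apply: contrapT => /negP p0; apply: xp; exact: subset_closure.
Qed.

Lemma partial_bounded phi i : tf phi -> exists M, forall x, `|partial i phi x| <= M.
Proof.
move=> tp; apply: (continuous_compact_bounded tp); first exact: ((test_function_c1 tp).2 i).2.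
move=> x xp; rewrite /partial (@near_eq_derive _ _ _ _ (fun=> 0)) ?derive_cst//.
have : open_nbhs x (~` closure [set x | phi x != 0]).
  by split => //; exact/closed_openC/closed_closure.
move=> /open_nbhs_nbhs; apply: filterS => y; rewrite /= => h.
by apply/eqP; apply: contrapT => /negP p0; apply: h; exact: subset_closure.
Qed.

Lemma measurable_domain : measurable Omega.
Proof. exact: open_measurable_row. Qed.

Lemma domain_bound : exists2 M : R, 0 < M & forall x, Omega x -> forall i, `|x 0 i| < M.
Proof.
have [M [_ /(_ (`|M| + 1))]] := boundedO.
have -> : M < `|M| + 1 by rewrite (le_lt_trans (ler_norm M))// ltrDl.
move=> /(_ isT) OM; exists (`|M| + 2) => [|x Ox i]; first by rewrite ltr_wpDl.
have : `|x 0 i| <= `|M| + 1.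
  apply: le_trans (OM _ Ox); rewrite [leRHS]mx_normrE.
  by rewrite (le_trans _ (le_bigmax _ _ (0, i)))//.
by move/le_lt_trans; apply; rewrite ltrD2l ltr1n.
Qed.

Lemma measure_domain_lty : (mu Omega < +oo)%E.
Proof.
have [M M0 OM] := domain_bound.
apply: (@le_lt_trans _ _ (mu (box (\row__ (- M)) (2 * M)))).
  apply: le_measure; rewrite ?inE; first exact: measurable_domain.
    exact: measurable_box.
  by move=> x /OM xM i; have := xM i; rewrite mxE ltr_norml => /andP[? ?]; apply/andP; split; lra.
rewrite [X in (X < _)%E]lebesgue_row_box ?ltry// mulr_ge0//; exact: ltW.
Qed.

Lemma bounded_integrable (g : 'rV[R]_n -> R) (M : R) : measurable_fun Omega g ->
  (forall x, Omega x -> `|g x| <= M) -> mu.-integrable Omega (EFin \o g).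
Proof.
move=> mg gM; apply: measurable_bounded_integrable => //.
- exact: measurable_domain.
- exact: measure_domain_lty.
- exists M; split; first exact: num_real.
  by move=> y My x Ox; apply: (le_trans (gM _ Ox)); exact: ltW.
Qed.

Lemma tf_measurable phi : tf phi -> measurable_fun Omega phi.
Proof. by move=> tp; apply: measurable_funTS; exact: c1_measurable (test_function_c1 tp). Qed.

Lemma tf_measurable_partial phi i : tf phi -> measurable_fun Omega (partial i phi).
Proof.
by move=> tp; apply: measurable_funTS; exact: c1_measurable_partial (test_function_c1 tp).
Qed.

Lemma tf_integrable_powR phi (q : R) : 0 <= q -> tf phi ->
  mu.-integrable Omega (EFin \o (fun x => `|phi x| `^ q)).
Proof.
move=> q0 tp; have [M pM] := test_function_bounded tp.
apply: (@bounded_integrable _ (M `^ q)).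
  exact: (measurableT_comp (measurable_abs_powR q) (tf_measurable tp)).
move=> x Ox; rewrite ger0_norm ?powR_ge0//; apply: ge0_ler_powR => //.
by rewrite nnegrE; exact: le_trans (pM x).
Qed.

Lemma tf_integrable_sqgrad phi : tf phi -> mu.-integrable Omega (EFin \o sqgrad phi).
Proof.
move=> tp; have /choice[M pM] := fun i => partial_bounded i tp.
apply: (@bounded_integrable _ (\sum_(i < n) M i ^+ 2)).
  by apply: measurable_funTS; exact: measurable_sqgrad (test_function_c1 tp).
move=> x _; rewrite ger0_norm ?sqgrad_ge0//; apply: ler_sum => i _.
by rewrite -real_normK ?num_real// lerXn2r ?nnegrE//; exact: le_trans (pM i x).
Qed.

Definition energy phi : R := \int[mu]_(x in Omega) sqgrad phi x.

Lemma energy_ge0 phi : 0 <= energy phi.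
Proof. by apply: Rintegral_ge0 => x _; exact: sqgrad_ge0. Qed.

Lemma integral_domain_out (g : 'rV[R]_n -> R) : (forall x, ~ Omega x -> g x = 0) ->
  (\int[mu]_x (g x)%:E = \int[mu]_(x in Omega) (g x)%:E)%E.
Proof.
move=> g0; rewrite [RHS]integral_mkcond; apply: eq_integral => x _.
by rewrite patchE; case: ifPn => // /negP xO; rewrite g0// => Ox; apply: xO; rewrite inE.
Qed.

Lemma integral_sqgrad phi : tf phi -> (\int[mu]_x (sqgrad phi x)%:E = (energy phi)%:E)%E.
Proof.
move=> tp; rewrite integral_domain_out.
  by rewrite fineK//; exact: (integrable_fin_num measurable_domain (tf_integrable_sqgrad tp)).
by move=> x Ox; apply: big1 => i _; rewrite partial_out// expr0n.
Qed.

Definition domain_volume : R := fine (mu Omega).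

Lemma domain_volumeE : mu Omega = domain_volume%:E.
Proof. by rewrite /domain_volume fineK// ge0_fin_numE// measure_domain_lty. Qed.

(** The inequality on a big box is compared with a place where phi vanishes: [B'] = [M, 3M)^n misses
    [Omega] (this takes n > 0) and [B] = [-M, 3M)^n contains both. For x in [Omega] and y in [B']
    the integrand (phi x - phi y)^2 of [poincare_box] is phi x ^ 2. *)
Lemma poincare : (0 < n)%N -> exists2 C : R, 0 <= C & forall phi, tf phi ->
  \int[mu]_(x in Omega) phi x ^+ 2 <= C * energy phi.
Proof.
move=> n0; have [M M0 OM] := domain_bound.
pose B := @box R n (\row__ (- M)) (4 * M).
pose B' := @box R n (\row__ M) (2 * M).
have mB : measurable B by exact: measurable_box.
have mB' : measurable B' by exact: measurable_box.
have mO := measurable_domain.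
have V0 : 0 < (2 * M) ^+ n by rewrite exprn_gt0// mulr_gt0.
have OB : Omega `<=` B.
  by move=> x /OM xM i; have := xM i; rewrite mxE ltr_norml => /andP[? ?]; apply/andP; split; lra.
have B'B : B' `<=` B.
  by move=> x xM i; have := xM i; rewrite !mxE => /andP[? ?]; apply/andP; split; lra.
have B'O x : B' x -> ~ Omega x.
  move=> xB /OM xM; have := xB (Ordinal n0); rewrite mxE => /andP[h _].
  by have := xM (Ordinal n0); rewrite ltr_norml => /andP[_]; lra.
exists (2 ^+ n * (4 * M) ^+ (n + 2) / (2 * M) ^+ n).
  by rewrite divr_ge0 ?mulr_ge0 ?exprn_ge0 ?mulr_ge0// ltW.
move=> phi tp; have cphi := test_function_c1 tp.
have mphi := c1_measurable cphi.
have i2 : mu.-integrable Omega (EFin \o (fun x => phi x ^+ 2)).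
  apply: eq_integrable (tf_integrable_powR (ler0n _ 2) tp) => //.
  by move=> x _ /=; rewrite powR_mulrn// real_normK// num_real.
rewrite mulrAC ler_pdivlMr// mulrC -lee_fin.
have -> : ((2 * M) ^+ n * \int[mu]_(x in Omega) phi x ^+ 2)%:E =
    (\int[mu]_(x in Omega) \int[mu]_(y in B') (phi x ^+ 2)%:E)%E.
  rewrite EFinM fineK; last exact: (integrable_fin_num mO i2).
  rewrite -ge0_integralZl//; last 3 first.
  - by apply/measurable_EFinP; apply: measurable_funX; exact: measurable_funTS.
  - by move=> x _; rewrite lee_fin sqr_ge0.
  - by rewrite lee_fin ltW.
  apply: eq_integral => x _; rewrite muleC.
  transitivity ((phi x ^+ 2)%:E * mu B')%E; last by rewrite -integral_cst.
  by congr (_ * _)%E; rewrite [RHS]lebesgue_row_box// mulr_ge0// ltW.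
have sq0 (r : R) : (0 <= (r ^+ 2)%:E)%E by rewrite lee_fin sqr_ge0.
have mH : measurable_fun setT (fun x => \int[mu]_(y in B) ((phi x - phi y) ^+ 2)%:E)%E.
  apply: (@measurable_integral_section _ _ _ _ _ mu B
      (fun x y => ((phi x - phi y) ^+ 2)%:E)) => //.
  apply/measurable_EFinP; apply: measurable_funX; apply: measurable_funB.
    exact: measurableT_comp measurable_fst.
  exact: measurableT_comp measurable_snd.
apply: (@le_trans _ _ (\int[mu]_(x in B) \int[mu]_(y in B) ((phi x - phi y) ^+ 2)%:E)%E).
  apply: (@le_trans _ _ (\int[mu]_(x in Omega) \int[mu]_(y in B) ((phi x - phi y) ^+ 2)%:E)%E).
    apply: ge0_le_integral => //.
    - by move=> x _; exact: integral_ge0.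
    - apply: measurable_funTS.
      apply: (@measurable_integral_section _ _ _ _ _ mu B' (fun x y => (phi x ^+ 2)%:E)) => //.
      by apply/measurable_EFinP; apply: measurable_funX; exact: measurableT_comp measurable_fst.
    - exact: measurable_funTS.
    move=> x _; apply: (@le_trans _ _ (\int[mu]_(y in B') ((phi x - phi y) ^+ 2)%:E)%E).
      rewrite le_eqVlt; apply/orP; left; apply/eqP; apply: eq_integral => y.
      by rewrite inE => /B'O/(test_function_out tp) ->; rewrite subr0.
    apply: ge0_subset_integral => //.
    apply/measurable_EFinP; apply: measurable_funX; apply: measurable_funB => //.
    exact: measurable_funTS.
  apply: ge0_subset_integral => //; first exact: measurable_funTS.
  by move=> x _; exact: integral_ge0.
have M4 : 0 <= 4 * M by rewrite mulr_ge0// ltW.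
apply: (le_trans (poincare_box (\row__ (- M)) cphi M4)); rewrite [leRHS]EFinM.
apply: lee_wpmul2l; first by rewrite lee_fin mulr_ge0 ?exprn_ge0.
rewrite -integral_sqgrad//; apply: ge0_subset_integral => //.
  by apply/measurable_EFinP; exact: measurable_sqgrad.
by move=> x _; rewrite lee_fin sqgrad_ge0.
Qed.

(** phi is split into phi - [avg k phi], controlled by [avg_approx], and [avg k phi], at most B on
    [Omega]. The generation k stays free: k = 0 leads to [sobolev], large k to
    [small_of_averages]. *)
Lemma powR_le_avg (q : R) : 2 <= q -> (n%:R - 2) * (q - 2) < 4 ->
  exists C t : R, [/\ 0 <= C, 0 < t < 1 & forall phi k B, tf phi -> 0 <= B ->
    (forall x, Omega x -> `|avg k phi x| <= B) ->
    \int[mu]_(x in Omega) `|phi x| `^ q <=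
    C * t ^+ k * energy phi `^ (q / 2) + C * B `^ q].
Proof.
move=> q2 crit; have [C [t [C0 t01 H]]] := avg_approx q2 crit.
have q0 : 0 <= q by lra.
have V0 : 0 <= domain_volume by rewrite fine_ge0.
have D0 : 0 <= 2 `^ q * (C + domain_volume) by rewrite mulr_ge0 ?powR_ge0 ?addr_ge0.
exists (2 `^ q * (C + domain_volume)), t; split => // phi k B tp B0 aB.
have mO := measurable_domain; have mphi := tf_measurable tp.
have mavg : measurable_fun Omega (avg k phi) by apply: measurable_funTS; exact: measurable_avg.
have mq (g : 'rV[R]_n -> R) : measurable_fun Omega g -> measurable_fun Omega (fun x => (`|g x| `^ q)%:E).
  by move=> mg; apply/measurable_EFinP; exact: (measurableT_comp (measurable_abs_powR q) mg).
rewrite -lee_fin fineK; last exact: (integrable_fin_num mO (tf_integrable_powR q0 tp)).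
have pt x : ((`|phi x| `^ q)%:E <=
    (2 `^ q)%:E * ((`|phi x - avg k phi x| `^ q)%:E + (`|avg k phi x| `^ q)%:E))%E.
  by rewrite -EFinD -EFinM lee_fin -{1}(subrK (avg k phi x) (phi x)) powR_normD.
have p0 (r : R) : (0 <= (r `^ q)%:E)%E by rewrite lee_fin powR_ge0.
apply: (@le_trans _ _ (\int[mu]_(x in Omega) ((2 `^ q)%:E *
    ((`|phi x - avg k phi x| `^ q)%:E + (`|avg k phi x| `^ q)%:E)))%E).
  apply: ge0_le_integral => //; first exact: mq.
  apply: measurable_funeM; apply: emeasurable_funD; last exact: mq.
  by apply: (mq (fun x => phi x - avg k phi x)); exact: measurable_funB.
rewrite ge0_integralZl//; last 2 first.
- apply: emeasurable_funD; last exact: mq.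
  by apply: (mq (fun x => phi x - avg k phi x)); exact: measurable_funB.
- by move=> x _; rewrite adde_ge0.
rewrite ge0_integralD//; last 2 first.
- by apply: (mq (fun x => phi x - avg k phi x)); exact: measurable_funB.
- exact: mq.
have h1 : (\int[mu]_(x in Omega) (`|phi x - avg k phi x| `^ q)%:E <=
    (C * t ^+ k * energy phi `^ (q / 2))%:E)%E.
  have := H phi (energy phi) (test_function_c1 tp) (test_function_bounded tp) _ k.
  rewrite integral_sqgrad// => /(_ (lexx _)); apply: le_trans.
  apply: ge0_subset_integral => //; apply/measurable_EFinP.
  apply: (measurableT_comp (measurable_abs_powR q)); apply: measurable_funB.
    exact: c1_measurable (test_function_c1 tp).
  exact: measurable_avg.
have h2 : (\int[mu]_(x in Omega) (`|avg k phi x| `^ q)%:E <= (domain_volume * B `^ q)%:E)%E.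
  apply: (@le_trans _ _ (\int[mu]_(x in Omega) cst (B `^ q)%:E x)%E).
    apply: ge0_le_integral => //; first exact: mq.
    by move=> x Ox; rewrite lee_fin; apply: ge0_ler_powR; rewrite ?nnegrE//; exact: aB.
  by rewrite integral_cst// [X in (_ * X)%E]domain_volumeE -EFinM mulrC.
apply: (@le_trans _ _ ((2 `^ q)%:E * ((C * t ^+ k * energy phi `^ (q / 2))%:E +
    (domain_volume * B `^ q)%:E))%E).
  by apply: lee_wpmul2l; [rewrite lee_fin powR_ge0|exact: leeD].
rewrite -EFinD -EFinM lee_fin mulrDr mulrA; apply: lerD.
  rewrite mulrA; apply: ler_wpM2r; first exact: powR_ge0.
  apply: ler_wpM2r; first by case/andP: t01 => /ltW ? _; exact: exprn_ge0.
  by apply: ler_wpM2l; [exact: powR_ge0|rewrite lerDl].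
rewrite mulrA; apply: ler_wpM2r; first exact: powR_ge0.
by apply: ler_wpM2l; [exact: powR_ge0|rewrite lerDr].
Qed.

Lemma tf_integrable_sqr phi : tf phi -> mu.-integrable Omega (EFin \o (fun x => phi x ^+ 2)).
Proof.
move=> tp; apply: eq_integrable (tf_integrable_powR (ler0n _ 2) tp) => //.
  exact: measurable_domain.
by move=> y _ /=; rewrite powR_mulrn// real_normK// num_real.
Qed.

Lemma sqr_avg_le k x phi : tf phi ->
  avg k phi x ^+ 2 <= (2 ^+ k) ^+ n * \int[mu]_(x in Omega) phi x ^+ 2.
Proof.
move=> tp; have mO := measurable_domain.
have [M pM] := test_function_bounded tp.
have mphi := c1_measurable (test_function_c1 tp).
have V0 : 0 < ((2 ^+ k) ^+ n)^-1 :> R by rewrite invr_gt0 !exprn_gt0.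
rewrite -lee_fin [leRHS]EFinM fineK; last exact: (integrable_fin_num mO (tf_integrable_sqr tp)).
rewrite -integral_domain_out; last by move=> y Oy; rewrite (test_function_out tp)// expr0n.
have := @jensen_sqr _ _ _ mu (cell k x) (measurable_cell k x) phi M _
  (measurable_funTS mphi) (fun y _ => pM y) _ V0.
rewrite invrK /avg => h; apply: le_trans (h _) _.
  by rewrite [LHS]lebesgue_row_cell exprVn.
apply: lee_wpmul2l; first by rewrite lee_fin !exprn_ge0.
apply: ge0_subset_integral => //; first exact: measurable_cell.
  by apply/measurable_EFinP; exact: measurable_funX.
by move=> y _; rewrite lee_fin sqr_ge0.
Qed.

(** Take k = 0 in [powR_le_avg]: an average over a unit cell is at most the L^2 norm by Jensen,
    hence at most a multiple of the root of the energy by [poincare]. *)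
Lemma sobolev (q : R) : (0 < n)%N -> 2 <= q -> (n%:R - 2) * (q - 2) < 4 ->
  exists2 C : R, 0 <= C & forall phi, tf phi ->
  \int[mu]_(x in Omega) `|phi x| `^ q <= C * energy phi `^ (q / 2).
Proof.
move=> n0 q2 crit; have [C [t [C0 t01 H]]] := powR_le_avg q2 crit.
have [P P0 HP] := poincare n0.
exists (C + C * P `^ (q / 2)); first by rewrite addr_ge0 ?mulr_ge0 ?powR_ge0.
move=> phi tp; have aB x : Omega x -> `|avg 0 phi x| <= (P * energy phi) `^ 2^-1.
  move=> Ox; rewrite -(@ler_sqr _ _ _) ?nnegrE ?powR_ge0// real_normK ?num_real//.
  have -> : (P * energy phi) `^ 2^-1 ^+ 2 = P * energy phi.
    rewrite -powR_mulrn ?powR_ge0// -powRrM mulVf ?pnatr_eq0// powRr1//.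
    by rewrite mulr_ge0// energy_ge0.
  apply: le_trans (HP _ tp); have := sqr_avg_le 0 x tp.
  by rewrite expr0 expr1n mul1r.
apply: (le_trans (H phi 0%N _ tp (powR_ge0 _ _) aB)).
rewrite expr0 mulr1 mulrDl lerD2l -mulrA ler_wpM2l//.
rewrite -powRrM -powRM ?energy_ge0// [_ / 2]mulrC le_eqVlt; apply/orP; left.
by rewrite mulrC.
Qed.

Lemma avg_lincomb k x a phi b psi : tf phi -> tf psi ->
  avg k (lincomb a phi b psi) x = a * avg k phi x + b * avg k psi x.
Proof.
move=> tp ts; have mc := measurable_cell k x.
have i_cell chi : tf chi -> mu.-integrable (cell k x) (EFin \o chi).
  move=> tc; have [M cM] := test_function_bounded tc.
  exact: (bounded_integrable_cell k x (c1_measurable (test_function_c1 tc)) cM).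
have ip := i_cell _ tp; have is_ := i_cell _ ts.
rewrite /avg (RintegralD mc (integrableZl mc a ip) (integrableZl mc b is_)).
by rewrite (RintegralZl a mc ip) (RintegralZl b mc is_); ring.
Qed.

Lemma cell_net k : exists s : seq 'rV[R]_n, forall x, Omega x -> exists2 y, y \in s & cell k y x.
Proof.
have [M M0 OM] := domain_bound.
have k0 : 0 < 2 ^+ k :> R by rewrite exprn_gt0.
pose K := (Num.truncn (2 ^+ k * M)).+1.
have KM : 2 ^+ k * M < K%:R by exact: truncnS_gt.
(* On [Omega] the floors of 2^k x_i lie in [-K, K); shifted by K they become indices of a finite
   type, and [pt] is the corner of the cell so indexed. *)
pose pt (f : {ffun 'I_n -> 'I_(K.*2).+1}) : 'rV[R]_n :=
  \row_i (((f i)%:Z - K%:Z)%:~R / 2 ^+ k).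
exists [seq pt f | f : {ffun 'I_n -> 'I_(K.*2).+1}] => x Ox.
pose z i := Num.floor (2 ^+ k * x 0 i).
pose f : {ffun 'I_n -> 'I_(K.*2).+1} := [ffun i => inord (absz (z i + K%:Z))].
exists (pt f); first by apply: map_f; rewrite mem_enum.
apply/cellP => i; rewrite [in RHS]mxE [in RHS]mulrC divfK ?gt_eqF// intrKfloor ffunE.
have /andP[xl xu] : - (K%:R) <= 2 ^+ k * x 0 i < K%:R.
  have := OM x Ox i; rewrite ltr_norml => /andP[l u].
  have h : 2 ^+ k * x 0 i < 2 ^+ k * M by rewrite ltr_pM2l.
  have h' : 2 ^+ k * (- M) < 2 ^+ k * x 0 i by rewrite ltr_pM2l.
  by apply/andP; split; [apply/ltW; rewrite mulrN in h'; lra|lra].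
have zl : - K%:Z <= z i by rewrite /z floor_ge_int intrN.
have zu : z i < K%:Z by rewrite /z floor_lt_int.
have e : (absz (z i + K%:Z))%:Z = z i + K%:Z by rewrite gez0_abs//; lia.
by rewrite inordK -/(z i); [rewrite e; lia|lia].
Qed.

(* Total boundedness in L^q of the test functions of energy at most [M], in terms of finitely
   many linear functionals. *)
Lemma small_of_averages (q M e : R) : 2 <= q -> (n%:R - 2) * (q - 2) < 4 -> 0 < e ->
  exists (s : seq (nat * 'rV[R]_n)) (eta : R), 0 < eta /\
  forall phi, tf phi -> energy phi <= M ->
    (forall z, z \in s -> `|avg z.1 phi z.2| <= eta) ->
    \int[mu]_(x in Omega) `|phi x| `^ q <= e.
Proof.
move=> q2 crit e0; have [C [t [C0 /andP[t0 t1] H]]] := powR_le_avg q2 crit.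
have q0 : 0 < q by lra.
(* Each term of [powR_le_avg] receives e / 2: a late generation k takes care of the energy term,
   then [eta] of the averages. The added 1 keeps the divisors positive. *)
pose D := (C + 1) * (`|M| `^ (q / 2) + 1).
have D0 : 0 < D by rewrite mulr_gt0 ?ltr_wpDl// powR_ge0.
have [k ke] : exists k, t ^+ k < e / 2 / D.
  have /cvgrPdist_lt/(_ (e / 2 / D)) : t ^+ m @[m --> \oo] --> 0.
    by apply: cvg_expr; rewrite gtr0_norm.
  rewrite !divr_gt0// => /(_ isT)[k _ /(_ k (leqnn k))].
  rewrite /= sub0r normrN ger0_norm ?exprn_ge0//; last exact: ltW.
  by move=> ?; exists k.
have [s Hs] := cell_net k.
pose eta := (e / 2 / (C + 1)) `^ q^-1.
have C1 : 0 < C + 1 by rewrite ltr_wpDl.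
have eta0 : 0 < eta by rewrite powR_gt0// !divr_gt0.
exists [seq (k, x) | x <- s], eta; split => // phi tp pM aeta.
have aB x : Omega x -> `|avg k phi x| <= eta.
  move=> /Hs[y ys yx]; rewrite -(avg_cell phi yx); apply: (aeta (k, y)).
  by apply/mapP; exists y.
apply: (le_trans (H phi k eta tp (ltW eta0) aB)).
rewrite /eta -powRrM mulVf ?gt_eqF// powRr1; last by rewrite !divr_ge0// ltW.
have h1 : C * t ^+ k * energy phi `^ (q / 2) <= e / 2.
  have h : energy phi `^ (q / 2) <= `|M| `^ (q / 2) + 1.
    apply: (@le_trans _ _ (`|M| `^ (q / 2))); last by rewrite lerDl.
    apply: ge0_ler_powR; rewrite ?nnegrE ?energy_ge0//; first by lra.
    by rewrite (le_trans pM)// ler_norm.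
  apply: (@le_trans _ _ ((C + 1) * t ^+ k * (`|M| `^ (q / 2) + 1))).
    have tk0 : 0 <= t ^+ k by rewrite exprn_ge0// ltW.
    apply: ler_pM => //; rewrite ?mulr_ge0 ?powR_ge0//.
    by apply: ler_wpM2r => //; rewrite lerDl.
  rewrite mulrAC -/D mulrC -ler_pdivlMr//; exact: ltW.
have h2 : C * (e / 2 / (C + 1)) <= e / 2.
  rewrite mulrCA ler_piMr ?divr_ge0//; first exact: ltW.
  by rewrite ler_pdivrMr// mul1r lerDl.
by rewrite [leRHS]splitr lerD.
Qed.

End test_functions.

(** * Minimizing sets *)

Section good_sets.
Context {R : realType} {T : Type}.
Variables (E : T -> R) (m : R).
Implicit Types S : set T.

(** Stated for sets of competitors and not for sequences: when such a set is cut in two, one piece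
    is again minimizing, and the argument can be repeated without reindexing. *)
Definition minimizing S := forall e, 0 < e -> exists2 x, S x & E x < m + e.

Lemma minimizing_split S (A : set T) : minimizing S ->
  minimizing (S `&` A) \/ minimizing (S `\` A).
Proof.
move=> gS; apply: contrapT => /not_orP[/existsNP[e1 /not_implyP[e10 h1]]].
move=> /existsNP[e2 /not_implyP[e20 h2]].
have [|x Sx] := gS (Num.min e1 e2); first by rewrite lt_min e10.
have [Ax|Ax] := pselect (A x) => xe.
  by apply: h1; exists x => //; apply: (lt_le_trans xe); rewrite lerD2l ge_min lexx.
by apply: h2; exists x => //; apply: (lt_le_trans xe); rewrite lerD2l ge_min lexx orbT.
Qed.

Lemma minimizing_sublevel S e : 0 < e -> minimizing S -> minimizing (S `&` [set x | E x < m + e]).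
Proof.
move=> e0 gS d d0; have [|x Sx] := gS (Num.min e d); first by rewrite lt_min e0.
move=> xed; exists x; last by apply: (lt_le_trans xed); rewrite lerD2l ge_min lexx orbT.
by split => //=; apply: (lt_le_trans xed); rewrite lerD2l ge_min lexx.
Qed.

Lemma minimizing_functional S (l : T -> R) (L eta : R) : 0 < eta ->
  (forall x, S x -> `|l x| <= L) -> minimizing S ->
  exists S', [/\ S' `<=` S, minimizing S' & forall x y, S' x -> S' y -> `|l x - l y| <= eta].
Proof.
move=> eta0.
(* Induction on the number N of strips of width eta that cover the range of l: either the lowest
   strip or the rest stays minimizing. N = 0 is excluded because a minimizing set is not empty. *)
have aux N : forall S a, (forall x, S x -> a <= l x < a + eta *+ N) -> minimizing S ->
    exists S', [/\ S' `<=` S, minimizing S' & forall x y, S' x -> S' y -> `|l x - l y| <= eta].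
  elim: N => [|N IH] {}S a Sa gS.
    have [x Sx _] := gS 1 ltr01; have := Sa _ Sx; rewrite mulr0n addr0 => /andP[].
    by move=> /le_lt_trans /[apply]; rewrite ltxx.
  have [g|g] := minimizing_split [set x | l x < a + eta] gS.
    exists (S `&` [set x | l x < a + eta]); split => //.
    move=> x y [/Sa/andP[? _] /= ?] [/Sa/andP[? _] /= ?].
    by rewrite ler_norml; apply/andP; split; lra.
  have [|S' [S'S gS' HS']] := IH _ (a + eta) _ g.
    move=> x [/Sa/andP[_ h] /= /negP]; rewrite -leNgt => ->/=.
    by rewrite -addrA -mulrS.
  by exists S'; split => // x /S'S[].
move=> SL gS; apply: (aux (Num.truncn (2 * L / eta)).+1 S (- L)) => // x Sx.
have := SL _ Sx; rewrite ler_norml => /andP[-> h] /=.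
apply: (le_lt_trans h); have := truncnS_gt (2 * L / eta).
by rewrite ltr_pdivrMr// -[eta *+ _]mulr_natl; lra.
Qed.

Lemma minimizing_functionals (I : eqType) (s : seq I) S (l : I -> T -> R) (eta : R) : 0 < eta ->
  (forall i, exists L, forall x, S x -> `|l i x| <= L) -> minimizing S ->
  exists S', [/\ S' `<=` S, minimizing S' &
    forall x y, S' x -> S' y -> forall i, i \in s -> `|l i x - l i y| <= eta].
Proof.
move=> eta0; elim: s S => [|i s IH] S lS gS; first by exists S; split.
have [L Li] := lS i.
have [S1 [S1S g1 H1]] := minimizing_functional eta0 Li gS.
have [|S2 [S2S g2 H2]] := IH S1 _ g1.
  by move=> j; have [L' h] := lS j; exists L' => x /S1S; exact: h.
exists S2; split => //; first by move=> x /S2S/S1S.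
move=> x y x2 y2 j; rewrite in_cons => /orP[/eqP ->|]; last exact: H2.
by apply: H1; exact: S2S.
Qed.

End good_sets.

(** * Convergence of integrals *)

Section L2_limits.
Context {d} {T : measurableType d} {R : realType} (mu : {measure set T -> \bar R}).
Variable D : set T.
Hypothesis mD : measurable D.
Implicit Types (w g : nat -> T -> R) (u : T -> R).

(** 8 is 4 times 2: weighted by 4^k, the squares still have integrals at most 2^-k. Their sum is
    therefore finite a.e., and its root is the constant C at x. *)
Lemma ae_geometric w : (forall k, measurable_fun D (w k)) ->
  (forall k, (\int[mu]_(x in D) (w k x ^+ 2)%:E <= (8 ^- k)%:E)%E) ->
  {ae mu, forall x, D x -> exists C, forall k, `|w k x| <= C * 2 ^- k}.
Proof.
move=> mw w8.
pose h k x := ((4 ^+ k * w k x ^+ 2)%:E : \bar R).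
have h0 k x : (0 <= h k x)%E by rewrite /h lee_fin mulr_ge0 ?sqr_ge0 ?exprn_ge0.
have mh k : measurable_fun D (h k).
  by apply/measurable_EFinP; apply: measurable_funM => //; exact: measurable_funX.
pose S x := (\sum_(0 <= k <oo) h k x)%E.
have S0 x : (0 <= S x)%E by exact: nneseries_ge0.
have mS : measurable_fun D S by exact: ge0_emeasurable_sum.
have iS : (\int[mu]_(x in D) S x <= 2%:E)%E.
  rewrite integral_nneseries//; apply: lime_le.
    by apply: is_cvg_nneseries => k _ _; exact: integral_ge0.
  apply: nearW => N; apply: (@le_trans _ _ (\sum_(0 <= k < N) (2^-1 ^+ k)%:E)%E).
    apply: lee_sum => k _; rewrite /h; under eq_integral do rewrite EFinM.
    rewrite ge0_integralZl//; last 2 first.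
    - by apply/measurable_EFinP; exact: measurable_funX.
    - by move=> x _; rewrite lee_fin sqr_ge0.
    apply: (@le_trans _ _ ((4 ^+ k)%:E * (8 ^- k)%:E)%E).
      by apply: lee_wpmul2l; rewrite ?lee_fin ?exprn_ge0.
    rewrite -EFinM lee_fin le_eqVlt; apply/orP; left; apply/eqP.
    rewrite -!exprVn -exprMn; congr (_ ^+ _).
    by apply: (mulIf (_ : 8 != 0 :> R)) => //; rewrite mulfVK//; lra.
  rewrite sumEFin lee_fin; apply: le_trans (geometric_sum_le _ _) _.
    by rewrite invr_ge0 ler0n invf_lt1// ltr1n.
  by rewrite le_eqVlt; apply/orP; left; apply/eqP; field.
have : mu.-integrable D S.
  apply/integrableP; split => //; under eq_integral do rewrite gee0_abs//.
  exact: le_lt_trans iS (ltry _).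
move=> /(integrable_ae mD); apply: filterS => x /[apply] fS.
exists (Num.sqrt (fine (S x))) => k.
have hS : 4 ^+ k * w k x ^+ 2 <= fine (S x).
  rewrite -lee_fin fineK//; apply: (@le_trans _ _ (\sum_(0 <= i < k.+1) h i x)%E).
    rewrite big_nat_recr//= -[leLHS]add0e; apply: leeD => //.
    by apply: sume_ge0 => i _; exact: h0.
  exact: nneseries_lim_ge.
rewrite ler_pdivlMr ?exprn_gt0// -[X in X <= _]ger0_norm ?mulr_ge0// ?exprn_ge0//.
rewrite -sqrtr_sqr ler_wsqrtr// exprMn real_normK ?num_real// mulrC.
apply: le_trans hS; rewrite ler_wpM2r ?sqr_ge0//.
by rewrite -exprM mulnC exprM lerXn2r ?nnegrE// expr2; lra.
Qed.

Lemma geometric_decay_cvg0 (v : nat -> R) C : (forall k, `|v k| <= C * 2 ^- k) ->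
  v k @[k --> \oo] --> 0.
Proof.
move=> vC; apply/norm_cvg0P; apply: (@squeeze_cvgr _ _ _ _ (fun=> 0) (fun k => C * 2 ^- k)).
- by apply: nearW => k; rewrite normr_ge0 vC.
- exact: cvg_cst.
- rewrite -[X in _ --> X](mulr0 C); apply: cvgMl_tmp; under eq_fun do rewrite -exprVn.
  by apply: cvg_expr; rewrite ger0_norm ?invr_ge0// invf_lt1// ltr1n.
Qed.

Lemma L2_ae_cvg g u : (forall k, measurable_fun D (g k)) -> measurable_fun D u ->
  (forall k, (\int[mu]_(x in D) ((g k x - u x) ^+ 2)%:E <= (8 ^- k)%:E)%E) ->
  {ae mu, forall x, D x -> g k x @[k --> \oo] --> u x}.
Proof.
move=> mg mf gu; have := @ae_geometric (fun k x => g k x - u x) _ gu.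
move=> /(_ (fun k => measurable_funB (mg k) mf)); apply: filterS => x /[apply] -[C /geometric_decay_cvg0].
by move/subr_cvg0.
Qed.

(** Riesz-Fischer with a rate: [ae_geometric] makes the increments summable at almost every point,
    and Fatou in j transfers the bound 8^-k from g_j to the limit. *)
Lemma L2_complete g : (forall k, measurable_fun D (g k)) ->
  (forall k j, (k <= j)%N -> (\int[mu]_(x in D) ((g k x - g j x) ^+ 2)%:E <= (8 ^- k)%:E)%E) ->
  exists u, [/\ measurable_fun D u,
    (forall k, (\int[mu]_(x in D) ((g k x - u x) ^+ 2)%:E <= (8 ^- k)%:E)%E) &
    {ae mu, forall x, D x -> g k x @[k --> \oo] --> u x}].
Proof.
(* The upper limit is measurable as it stands, without first choosing an exceptional set; where the
   sequence diverges its value is irrelevant. *)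
move=> mg g8; pose u x := fine (limn_esup (fun k => (g k x)%:E)).
have mf : measurable_fun D u.
  apply: (measurable_comp measurableT) => //.
  by apply: measurable_fun_limn_esup => k; exact/measurable_EFinP.
have cv : {ae mu, forall x, D x -> g k x @[k --> \oo] --> u x}.
  have := @ae_geometric (fun k x => g k x - g k.+1 x) _ (fun k => g8 _ _ (leqnSn k)).
  move=> /(_ (fun k => measurable_funB (mg k) (mg k.+1))).
  apply: filterS => x /[apply] -[C HC].
  have cg : cvgn (g ^~ x).
    have -> : g ^~ x = (fun k => g 0%N x + series (telescope (g ^~ x)) k).
      by apply/funext => k; exact: eq_sum_telescope.
    apply: is_cvgD; first exact: is_cvg_cst.
    apply: normed_cvg; apply: (@series_le_cvg _ _ (geometric C 2^-1)) => //.
    - by move=> k; rewrite /= normr_ge0.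
    - by move=> k; rewrite /= exprVn; apply: le_trans (HC k).
    - by move=> k /=; rewrite /telescope distrC; apply: le_trans (HC k) _; rewrite -exprVn.
    - by apply: is_cvg_geometric_series; rewrite ger0_norm ?invr_ge0// invf_lt1// ltr1n.
  have /cvg_limn_einf_sup[_ e] : (g k x)%:E @[k --> \oo] --> (limn (g ^~ x))%:E.
    by apply: cvg_EFin; [exact: nearW|exact: cg].
  by rewrite /u e.
exists u; split => // k; apply: (@fatou_bound _ _ _ mu D mD
    (fun j x => ((g k x - g j x) ^+ 2)%:E)).
- by move=> j; apply/measurable_EFinP; apply: measurable_funX; exact: measurable_funB.
- by apply/measurable_EFinP; apply: measurable_funX; exact: measurable_funB.
- by move=> j x _; rewrite lee_fin sqr_ge0.
- move: cv; apply: filterS => x /[apply] cv; apply: cvg_EFin; first exact: nearW.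
  by apply: (@continuous_cvg _ _ _ _ _ _ (fun r : R => r ^+ 2));
    [exact: exprn_continuous|apply: cvgB => //; exact: cvg_cst].
- by exists k => // j /= kj; exact: g8.
Qed.

End L2_limits.

(** * The modular t^2 + |t|^p and continuity of nonlinear integrals *)

Section weights.
Context {R : realType}.
Variable p : R.
Hypothesis p2 : 2 <= p.
Implicit Types a b t s : R.

Let p_gt0 : 0 < p. Proof. exact: lt_le_trans p2. Qed.

(** Convergence to 0 of the integral of this one function means convergence to 0 in L^2 and in L^p,
    without norms. For p = 2 it is 2 t^2 ([weight2E]), so that the same lemmas serve the
    gradients. *)
Definition weight t : R := t ^+ 2 + `|t| `^ p.

(* [f t * b] with [|t| <= |a| + |b|] is at most a constant times [growth a b]. *)
Definition growth a b : R := `|b| * ((`|a| + `|b|) + (`|a| + `|b|) `^ (p - 1)).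

Lemma weight_ge0 t : 0 <= weight t.
Proof. by rewrite addr_ge0 ?sqr_ge0 ?powR_ge0. Qed.

Lemma growth_ge0 a b : 0 <= growth a b.
Proof. by rewrite mulr_ge0// !addr_ge0// powR_ge0. Qed.

Lemma sqr_le_weight t : t ^+ 2 <= weight t.
Proof. by rewrite lerDl powR_ge0. Qed.

Lemma powR_le_weight t : `|t| `^ p <= weight t.
Proof. by rewrite lerDr sqr_ge0. Qed.

Lemma weightN t : weight (- t) = weight t.
Proof. by rewrite /weight sqrrN normrN. Qed.

Lemma weight0 : weight 0 = 0.
Proof. by rewrite /weight expr0n normr0 powR0 ?addr0// gt_eqF. Qed.

Lemma continuous_weight : continuous weight.
Proof.
move=> t; apply: (@continuousD _ _ _ (fun t => t ^+ 2) (fun t => `|t| `^ p)).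
  exact: exprn_continuous.
exact: continuous_abs_powR.
Qed.

Lemma measurable_weight : measurable_fun setT weight.
Proof. exact: continuous_measurable_fun continuous_weight. Qed.

Let two_le_powR : 4 <= 2 `^ p :> R.
Proof.
have -> : (4 : R) = 2 `^ 2%:R by rewrite powR_mulrn// expr2; lra.
by apply: ler_powR => //; rewrite ler1n.
Qed.

Lemma weightD t s : weight (t + s) <= 2 `^ p * (weight t + weight s).
Proof.
have h := powR_normD t s (ltW p_gt0); rewrite /weight.
have h2 : (t + s) ^+ 2 <= 4 * (t ^+ 2 + s ^+ 2).
  by have := sqr_ge0 (t - s); have := sqr_ge0 t; have := sqr_ge0 s; nra.
have h4 : 4 * (t ^+ 2 + s ^+ 2) <= 2 `^ p * (t ^+ 2 + s ^+ 2).
  by apply: ler_wpM2r => //; rewrite addr_ge0 ?sqr_ge0.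
have := lerD (le_trans h2 h4) h; set P := 2 `^ p.
by move=> /le_trans; apply; rewrite -mulrDr addrACA.
Qed.

Lemma weightM t s : weight (t * s) <= weight t * weight s.
Proof.
rewrite /weight exprMn normrM powRM//.
by rewrite mulrDl !mulrDr; apply: lerD; rewrite ?lerDl ?lerDr mulr_ge0 ?powR_ge0 ?sqr_ge0.
Qed.

(** A Young inequality, by comparing |b| with dl |a|. If |b| is smaller, then |a| + |b| <= 2 |a| and
    the growth is at most dl 2^p [weight a]; otherwise |a| + |b| <= (1 + 1 / dl) |b| and [weight b]
    absorbs everything. *)
Lemma growth_le e : 0 < e -> exists2 C, 0 <= C &
  forall a b, growth a b <= e * weight a + C * weight b.
Proof.
have p2' : 2 <= p := p2.
move=> e0; pose P := 2 `^ p; have P4 : 4 <= P := two_le_powR; have P0 : 0 < P by rewrite powR_gt0.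
pose dl := Num.min 1 (e / P); have dl0 : 0 < dl by rewrite lt_min ltr01 divr_gt0.
have dl1 : dl <= 1 by rewrite ge_min lexx.
have dle : dl * P <= e by rewrite -ler_pdivlMr// ge_min lexx orbT.
pose Q := 1 + dl^-1; have Q1 : 1 <= Q by rewrite lerDl invr_ge0 ltW.
have Q0 : 0 <= Q by lra.
exists (Q `^ p); first exact: powR_ge0.
move=> a b; set A := `|a|; set B := `|b|; rewrite /growth -/A -/B.
have A0 : 0 <= A by exact: normr_ge0.
have B0 : 0 <= B by exact: normr_ge0.
have wa : weight a = A ^+ 2 + A `^ p by rewrite /weight -real_normK ?num_real.
have wb : weight b = B ^+ 2 + B `^ p by rewrite /weight -real_normK ?num_real.
have p1 : 0 <= p - 1 by lra.
have pp : 0 < p by lra.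
have pow r : 0 <= r -> r * r `^ (p - 1) = r `^ p by move=> r0; rewrite mulr_powRB1.
have [BA|AB] := leP B (dl * A).
  apply: (@le_trans _ _ (e * weight a)); last first.
    by rewrite lerDl mulr_ge0 ?powR_ge0 ?weight_ge0.
  have BA' : B <= A by apply: (le_trans BA); rewrite ler_piMl.
  apply: (@le_trans _ _ (dl * P * weight a)); last by rewrite ler_wpM2r ?weight_ge0.
  have s2 : A + B <= 2 * A by lra.
  have h1 : B * (A + B) <= dl * P * A ^+ 2.
    apply: (@le_trans _ _ (dl * A * (2 * A))); first by apply: ler_pM => //; lra.
    rewrite expr2 mulrACA [leRHS]mulrAC -[leRHS]mulrAC.
    by apply: ler_wpM2r; [rewrite mulr_ge0|apply: ler_wpM2l; [exact: ltW|lra]].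
  have h2 : B * (A + B) `^ (p - 1) <= dl * P * A `^ p.
    apply: (@le_trans _ _ (dl * A * (2 * A) `^ (p - 1))).
      apply: ler_pM => //; first exact: powR_ge0.
      by apply: ge0_ler_powR; rewrite ?nnegrE//; lra.
    have -> : dl * A * (2 * A) `^ (p - 1) = dl * 2 `^ (p - 1) * A `^ p.
      by rewrite powRM// -(pow _ A0); ring.
    apply: ler_wpM2r; first exact: powR_ge0.
    apply: ler_wpM2l; first exact: ltW.
    by apply: ler_powR; [rewrite ler1n|lra].
  by rewrite mulrDr wa [leRHS]mulrDr lerD.
apply: (@le_trans _ _ (Q `^ p * weight b)); last first.
  by rewrite lerDr mulr_ge0 ?weight_ge0// ltW.
have sQ : A + B <= Q * B.
  rewrite /Q mulrDl mul1r addrC lerD2l mulrC ler_pdivlMr// mulrC; exact: ltW.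
have Qp : Q <= Q `^ p by apply: le1r_powR => //; lra.
rewrite mulrDr wb [leRHS]mulrDr; apply: lerD.
  apply: (@le_trans _ _ (B * (Q * B))); first by apply: ler_wpM2l.
  by rewrite mulrCA -expr2 ler_wpM2r ?sqr_ge0.
apply: (@le_trans _ _ (B * (Q * B) `^ (p - 1))).
  apply: ler_wpM2l => //; by apply: ge0_ler_powR => //; rewrite nnegrE ?addr_ge0 ?mulr_ge0.
rewrite powRM// mulrCA pow//; apply: ler_wpM2r; first exact: powR_ge0.
by apply: ler_powR => //; lra.
Qed.

End weights.

Section weighted_integrals.
Context {d} {T : measurableType d} {R : realType} (mu : {measure set T -> \bar R}).
Variables (D : set T) (p : R).
Hypotheses (mD : measurable D) (p2 : 2 <= p).
Implicit Types (u v h : T -> R).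

Definition weight_integrable u :=
  measurable_fun D u /\ mu.-integrable D (EFin \o (fun x => weight p (u x))).

Lemma measurable_weight_comp u : measurable_fun D u -> measurable_fun D (fun x => weight p (u x)).
Proof. exact: (measurableT_comp (measurable_weight p2)). Qed.

Lemma weight_integrable_le u v C : measurable_fun D u -> weight_integrable v ->
  (forall x, D x -> weight p (u x) <= C * weight p (v x)) -> weight_integrable u.
Proof.
move=> mu_ [mv iv] uv; split => //.
apply: (le_integrable mD _ _ (integrableZl mD C iv)).
  by apply/measurable_EFinP; exact: measurable_weight_comp.
move=> x Dx /=; rewrite lee_fin ger0_norm ?weight_ge0//.
by apply: le_trans (ler_norm _); exact: uv.
Qed.

Lemma weight_integrableZ a u : weight_integrable u -> weight_integrable (fun x => a * u x).
Proof.
move=> iu; apply: (@weight_integrable_le _ u (weight p a)) => //.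
  by apply: measurable_funM => //; exact: iu.1.
by move=> x _; exact: weightM.
Qed.

Lemma weight_integrableD u v : weight_integrable u -> weight_integrable v ->
  weight_integrable (fun x => u x + v x).
Proof.
move=> [mu_ iu] [mv iv]; have muv := measurable_funD mu_ mv; split => //.
have i2 := integrableZl mD (2 `^ p) (integrableD mD iu iv).
apply: (le_integrable mD _ _ i2).
  by apply/measurable_EFinP; exact: measurable_weight_comp.
move=> x Dx /=; rewrite lee_fin ger0_norm ?weight_ge0//.
by apply: le_trans (ler_norm _); exact: weightD.
Qed.

Lemma weight_integrableB u v : weight_integrable u -> weight_integrable v ->
  weight_integrable (fun x => u x - v x).
Proof.
move=> iu iv; have := weight_integrableD iu (weight_integrableZ (-1) iv).
by under eq_fun do rewrite mulN1r.
Qed.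

Lemma weight_integrable_growth K u v h : weight_integrable u -> weight_integrable v ->
  measurable_fun D h -> (forall x, D x -> `|h x| <= K * growth p (u x) (v x)) ->
  mu.-integrable D (EFin \o h).
Proof.
move=> [mu_ iu] [mv iv] mh hK; have [C C0 HC] := growth_le p2 (@ltr01 R).
have i2 := integrableZl mD `|K| (integrableD mD (integrableZl mD 1 iu) (integrableZl mD C iv)).
apply: (le_integrable mD _ _ i2); first exact/measurable_EFinP.
move=> x Dx /=; rewrite lee_fin; apply: le_trans (ler_norm _).
apply: (le_trans (hK x Dx)); apply: (@le_trans _ _ (`|K| * growth p (u x) (v x))).
  by apply: ler_wpM2r; [exact: growth_ge0|exact: ler_norm].
by apply: ler_wpM2l.
Qed.

(** In [growth_le] the bounded family [u_] receives the small coefficient and the vanishing family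
    [d_] the large one. This single estimate passes to the limit in the square, in F(u) and in f(u)
    v. *)
Lemma cvg_integral_growth K B (u_ d_ h_ : nat -> T -> R) :
  (forall k, weight_integrable (u_ k)) -> (forall k, weight_integrable (d_ k)) ->
  (forall k, measurable_fun D (h_ k)) ->
  (forall k x, D x -> `|h_ k x| <= K * growth p (u_ k x) (d_ k x)) ->
  (forall k, \int[mu]_(x in D) weight p (u_ k x) <= B) ->
  \int[mu]_(x in D) weight p (d_ k x) @[k --> \oo] --> 0 ->
  \int[mu]_(x in D) h_ k x @[k --> \oo] --> 0.
Proof.
move=> iu id mh hK uB d0; apply/cvgrPdist_le => e e0.
pose K' := `|K| + 1; have K'0 : 0 < K' by rewrite ltr_wpDl.
pose B' := `|B| + 1; have B'0 : 0 < B' by rewrite ltr_wpDl.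
pose dl := e / 2 / K' / B'; have dl0 : 0 < dl by rewrite !divr_gt0.
have [C C0 HC] := growth_le p2 dl0.
pose C' := C + 1; have C'0 : 0 < C' by rewrite ltr_wpDl.
have /cvgrPdist_le/(_ (e / 2 / K' / C')) := d0.
rewrite !divr_gt0// => /(_ isT); apply: filterS => k.
rewrite !sub0r !normrN => hd.
have ih := weight_integrable_growth (iu k) (id k) (mh k) (hK k).
have i1 := integrableZl mD dl (iu k).2; have i2 := integrableZl mD C (id k).2.
have i12 := integrableD mD i1 i2; have i3 := integrableZl mD K' i12.
apply: (le_trans (le_normr_Rintegral mD ih)).
apply: (@le_trans _ _ (\int[mu]_(x in D) (K' * (dl * weight p (u_ k x) + C * weight p (d_ k x))))).
  apply: le_Rintegral => //; first exact: integrable_norm.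
  move=> x Dx; apply: (le_trans (hK k x Dx)).
  apply: (@le_trans _ _ (K' * growth p (u_ k x) (d_ k x))).
    apply: ler_wpM2r; first exact: growth_ge0.
    by rewrite (le_trans (ler_norm _))// lerDl.
  by apply: ler_wpM2l; [exact: ltW|exact: HC].
rewrite (RintegralZl _ mD i12) (RintegralD mD i1 i2).
rewrite (RintegralZl _ mD (iu k).2) (RintegralZl _ mD (id k).2).
have hu : \int[mu]_(x in D) weight p (u_ k x) <= B'.
  by rewrite (le_trans (uB k))// (le_trans (ler_norm _))// lerDl.
have hd' := le_trans (ler_norm _) hd.
have h1 : dl * \int[mu]_(x in D) weight p (u_ k x) <= e / 2 / K'.
  by rewrite (le_trans (ler_wpM2l (ltW dl0) hu))// /dl divfK ?gt_eqF.
have h2 : C * \int[mu]_(x in D) weight p (d_ k x) <= e / 2 / K'.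
  apply: (@le_trans _ _ (C' * (e / 2 / K' / C'))); last by rewrite mulrC divfK ?gt_eqF.
  apply: ler_pM => //; first by apply: Rintegral_ge0 => x _; exact: weight_ge0.
  by rewrite lerDl.
apply: (@le_trans _ _ (K' * (e / 2 / K' + e / 2 / K'))).
  by apply: ler_wpM2l; [exact: ltW|exact: (lerD h1 h2)].
by rewrite -mulrDl mulrC divfK ?gt_eqF// -splitr.
Qed.

(** The increment bound under which u -> int H(u) is continuous for the modular. It holds for the
    square and for the primitive of f, and with a = 0 it also gives integrability. *)
Definition growth_control (H : R -> R) K := [/\ continuous H, H 0 = 0 &
  forall a b, `|H (a + b) - H a| <= K * growth p a b].

Lemma growth_control_integrable H K u : growth_control H K -> weight_integrable u ->
  mu.-integrable D (EFin \o (fun x => H (u x))).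
Proof.
move=> [cH H0 HK] iu; apply: (@weight_integrable_growth K (fun=> 0) u) => //.
- split; first exact: measurable_cst.
  apply: eq_integrable (integrable0 mu D) => // x _ /=.
  by rewrite weight0.
- by apply: (measurableT_comp (continuous_measurable_fun cH)); exact: iu.1.
- by move=> x _; have := HK 0 (u x); rewrite add0r H0 subr0.
Qed.

Lemma cvg_integral_growth_control H K B (u_ v_ : nat -> T -> R) : growth_control H K ->
  (forall k, weight_integrable (u_ k)) -> (forall k, weight_integrable (v_ k)) ->
  (forall k, \int[mu]_(x in D) weight p (u_ k x) <= B) ->
  \int[mu]_(x in D) weight p (v_ k x - u_ k x) @[k --> \oo] --> 0 ->
  (\int[mu]_(x in D) H (v_ k x) - \int[mu]_(x in D) H (u_ k x)) @[k --> \oo] --> 0.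
Proof.
move=> HH iu iv uB d0; have [cH H0 HK] := HH.
under eq_fun do rewrite -(RintegralB mD (growth_control_integrable HH (iv _))
  (growth_control_integrable HH (iu _))).
have mHu (u : T -> R) : weight_integrable u -> measurable_fun D (fun x => H (u x)).
  by move=> iu'; apply: (measurableT_comp (continuous_measurable_fun cH)); exact: iu'.1.
apply: (@cvg_integral_growth K B u_ (fun k x => v_ k x - u_ k x)) => //.
- by move=> k; exact: weight_integrableB.
- by move=> k; apply: measurable_funB; exact: mHu.
- by move=> k x _; have := HK (u_ k x) (v_ k x - u_ k x); rewrite [u_ k x + _]addrC subrK.
Qed.

Lemma cvg_integral_growth_control1 H K u (v_ : nat -> T -> R) : growth_control H K ->
  weight_integrable u -> (forall k, weight_integrable (v_ k)) ->
  \int[mu]_(x in D) weight p (v_ k x - u x) @[k --> \oo] --> 0 ->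
  \int[mu]_(x in D) H (v_ k x) @[k --> \oo] --> \int[mu]_(x in D) H (u x).
Proof.
move=> HH iu iv d0; apply/subr_cvg0.
by apply: (@cvg_integral_growth_control H K (\int[mu]_(x in D) weight p (u x)) (fun=> u)).
Qed.

Lemma growth_control_sqr : growth_control (fun t => t ^+ 2) 2.
Proof.
split; [exact: exprn_continuous|by rewrite expr0n|move=> a b].
have -> : (a + b) ^+ 2 - a ^+ 2 = b * (a + (a + b)) by ring.
rewrite normrM /growth mulrCA; apply: ler_wpM2l => //.
apply: (le_trans (ler_normD _ _)); have := ler_normD a b.
have := powR_ge0 (`|a| + `|b|) (p - 1); have := normr_ge0 b; lra.
Qed.

Lemma cvg_integral_weight_bounded u (v_ : nat -> T -> R) :
  weight_integrable u -> (forall k, weight_integrable (v_ k)) ->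
  \int[mu]_(x in D) weight p (v_ k x - u x) @[k --> \oo] --> 0 ->
  exists B, forall k, \int[mu]_(x in D) weight p (v_ k x) <= B.
Proof.
move=> iu iv d0.
have [M [_ HM]] : bounded_fun (fun k => \int[mu]_(x in D) weight p (v_ k x - u x)).
  by apply: cvg_seq_bounded; apply/cvg_ex; exists 0.
have {}HM k : \int[mu]_(x in D) weight p (v_ k x - u x) <= `|M| + 1.
  apply: le_trans (ler_norm _) _; apply: HM => //.
  by rewrite (le_lt_trans (ler_norm M))// ltrDl.
exists (2 `^ p * (\int[mu]_(x in D) weight p (u x) + (`|M| + 1))) => k.
have id := weight_integrableB (iv k) iu.
apply: (@le_trans _ _ (2 `^ p * (\int[mu]_(x in D) weight p (u x) +
   \int[mu]_(x in D) weight p (v_ k x - u x)))); last first.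
  by apply: ler_wpM2l; [exact: powR_ge0|rewrite lerD2l].
have i12 := integrableD mD iu.2 id.2.
rewrite -(RintegralD mD iu.2 id.2) -(RintegralZl _ mD i12); apply: le_Rintegral => //.
- exact: (iv k).2.
- exact: (integrableZl mD (2 `^ p) i12).
- by move=> x _; have := weightD p2 (u x) (v_ k x - u x); rewrite [u x + _]addrC subrK.
Qed.

Lemma Rintegral_sum n (h : 'I_n -> T -> R) :
  (forall i, mu.-integrable D (EFin \o h i)) ->
  \int[mu]_(x in D) (\sum_(i < n) h i x) = \sum_(i < n) \int[mu]_(x in D) h i x.
Proof.
elim: n h => [|n IH] h ih.
  rewrite big_ord0; under eq_Rintegral do rewrite big_ord0.
  by rewrite Rintegral_cst// mul0r.
rewrite big_ord_recl -IH//; under eq_Rintegral do rewrite big_ord_recl.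
rewrite RintegralD//.
by have := @integrable_sum _ _ _ mu D mD _ (index_enum _) xpredT (fun i => EFin \o h (lift ord0 i))
  (fun i _ => ih (lift ord0 i)); apply: eq_integrable => // x _ /=; rewrite sumEFin.
Qed.

End weighted_integrals.

(** * Increments of the primitive *)

Section primitive_growth.
Context {R : realType}.
Variables (p K : R) (f F : R -> R).
Hypotheses (p2 : 2 <= p) (K0 : 0 <= K).
Hypothesis dF : forall t : R, is_derive t 1 F (f t).
Hypothesis fK : forall t, `|f t| <= K * (`|t| + `|t| `^ (p - 1)).

Lemma primitive_increment a b : exists2 t, `|t| <= `|a| + `|b| & F (a + b) - F a = f t * b.
Proof.
have cF : {within [set: R], continuous F}.
  apply: continuous_subspaceT => t; apply: differentiable_continuous.
  by apply/derivable1_diffP; exact: (dF t).(ex_derive).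
have := ler_norm a; have := ler_norm (- a); have := ler_norm b; have := ler_norm (- b).
rewrite !normrN => h1 h2 h3 h4.
have [b0|b0] := leP 0 b.
  have [|c|c cI e] := @MVT_segment _ F f a (a + b) _.
  - by rewrite lerDl.
  - by apply: continuous_subspaceT => t; apply: differentiable_continuous;
      apply/derivable1_diffP; exact: (dF t).(ex_derive).
  exists c; last by rewrite e [a + b]addrC addrK.
  by move: cI; rewrite in_itv/= => /andP[? ?]; rewrite ler_norml; apply/andP; split; lra.
have [|c|c cI e] := @MVT_segment _ F f (a + b) a _.
- by rewrite gerDl ltW.
- by apply: continuous_subspaceT => t; apply: differentiable_continuous;
    apply/derivable1_diffP; exact: (dF t).(ex_derive).
exists c; last by rewrite -opprB e opprD addNKr mulrN opprK.
by move: cI; rewrite in_itv/= => /andP[? ?]; rewrite ler_norml; apply/andP; split; lra.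
Qed.

Lemma growth_bound a b t : `|t| <= `|a| + `|b| -> `|f t * b| <= K * growth p a b.
Proof.
move=> tab; rewrite normrM mulrC /growth mulrCA; apply: ler_wpM2l => //.
apply: (le_trans (fK t)); apply: ler_wpM2l => //; apply: lerD => //.
have p1 : 0 <= p - 1 by rewrite subr_ge0 (le_trans _ p2)// ler1n.
by apply: ge0_ler_powR; rewrite ?nnegrE// addr_ge0.
Qed.

Lemma growth_control_primitive : F 0 = 0 -> growth_control p F K.
Proof.
move=> F0; split => //.
  move=> t; apply: differentiable_continuous.
  by apply/derivable1_diffP; exact: (dF t).(ex_derive).
by move=> a b; have [t tab ->] := primitive_increment a b; exact: growth_bound.
Qed.

End primitive_growth.

(** * Integration by parts *)

Section integration_by_parts.
Context {R : realType}.
Implicit Types n : nat.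

Lemma ge0_integral_box' n (a : 'rV[R]_n.+1) l (g : 'rV[R]_n.+1 -> \bar R) :
  measurable_fun [set: 'rV[R]_n.+1] g -> (forall x, (0 <= g x)%E) ->
  (\int[lebesgue_row n.+1]_(x in box a l) g x =
   \int[lebesgue_row n]_(y in box (row_tail a) l)
     \int[lebesgue_measure]_(s in `[(a 0 ord0)%R, (a 0 ord0 + l)%R[) g (row_cons (s, y)))%E.
Proof.
move=> mg g0; rewrite ge0_integral_box//.
rewrite [LHS](@tonelli_swap _ _ _ _ _ lebesgue_measure (lebesgue_row n)
  `[(a 0 ord0)%R, (a 0 ord0 + l)%R[%classic (box (row_tail a) l)
  (fun s y => g (row_cons (s, y))))//; first exact: measurable_box.
have := measurableT_comp mg (@measurable_row_cons R n).
by apply: eq_measurable_fun => -[].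
Qed.

(* Adding a constant makes the integrand nonnegative, so that Tonelli suffices. *)
Lemma integral_box_eq0 n (a : 'rV[R]_n.+1) l M (h : 'rV[R]_n.+1 -> R) :
  measurable_fun [set: 'rV[R]_n.+1] h -> (forall x, `|h x| <= M) -> 0 <= l ->
  (forall s, \int[lebesgue_row n]_(y in box (row_tail a) l) (h (row_cons (s, y)))%:E = 0)%E \/
  (forall y, \int[lebesgue_measure]_(s in `[(a 0 ord0)%R, (a 0 ord0 + l)%R[)
     (h (row_cons (s, y)))%:E = 0)%E ->
  (\int[lebesgue_row n.+1]_(x in box a l) (h x)%:E = 0)%E.
Proof.
move=> mh hM l0 h0.
have M0 : 0 <= M by exact: le_trans (hM 0).
pose I := `[(a 0 ord0)%R, (a 0 ord0 + l)%R[%classic.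
have mI : lebesgue_measure I = l%:E.
  rewrite lebesgue_measure_itv/= lte_fin ltrDl; case: ifPn => [_|].
    by rewrite -EFinB addrAC subrr add0r.
  by rewrite -leNgt => l0'; congr EFin; apply/eqP; rewrite eq_le l0 l0'.
have mBox k (b : 'rV[R]_k) : measurable (box b l) by exact: measurable_box.
have bI k (b : 'rV[R]_k) (u : 'rV[R]_k -> R) : measurable_fun setT u ->
    (forall x, `|u x| <= M) -> (lebesgue_row k).-integrable (box b l) (EFin \o u).
  move=> mu uM; apply: measurable_bounded_integrable; first exact: mBox.
  - by rewrite [X in (X < _)%E]lebesgue_row_box ?ltry.
  - exact: measurable_funTS.
  - exists M; split; first exact: num_real.
    by move=> y My x _; apply: (le_trans (uM x)); exact: ltW.
have cM k : forall x : 'rV[R]_k, `|cst M x| <= M by move=> x; rewrite /cst ger0_norm.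
have icst k (b : 'rV[R]_k) : (lebesgue_row k).-integrable (box b l) (EFin \o cst M).
  by apply: bI; [exact: measurable_cst|exact: cM].
have Vcst k (b : 'rV[R]_k) :
    (\int[lebesgue_row k]_(x in box b l) (cst M x)%:E = (M * l ^+ k)%:E)%E.
  transitivity (M%:E * lebesgue_row k (box b l))%E; last by rewrite lebesgue_row_box.
  by rewrite -(integral_cst (lebesgue_row k) (mBox k b) M%:E).
have mhM : measurable_fun [set: 'rV[R]_n.+1] (fun x => (h x)%:E + (cst M x)%:E)%E.
  by apply: emeasurable_funD; exact/measurable_EFinP.
have hM0 x : (0 <= (h x)%:E + (cst M x)%:E)%E.
  by rewrite -EFinD lee_fin /cst; have := hM x; rewrite ler_norml => /andP[? _]; lra.
have mrow : measurable_fun setT (fun z : R * 'rV[R]_n => h (row_cons z)).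
  by apply: measurableT_comp => //; exact: measurable_row_cons.
have key : (\int[lebesgue_row n.+1]_(x in box a l) ((h x)%:E + (cst M x)%:E) =
    (M * l ^+ n.+1)%:E)%E.
  case: h0 => h0.
    rewrite ge0_integral_box//.
    transitivity (\int[lebesgue_measure]_(s in I) cst (M * l ^+ n)%:E s)%E.
      apply: eq_integral => s _.
      have mhs : measurable_fun setT (fun y => h (row_cons (s, y))).
        exact: (measurable_fun_pair2 s mrow).
      rewrite (integralD (mBox _ _) (bI _ _ _ mhs (fun y => hM _)) (icst _ _)) h0 add0e.
      exact: Vcst.
    rewrite integral_cst; last exact: measurable_itv.
    by rewrite [X in (_ * X)%E]mI -EFinM exprSr mulrA.
  rewrite ge0_integral_box'//.
  transitivity (\int[lebesgue_row n]_(y in box (row_tail a) l) cst (M * l)%:E y)%E.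
    apply: eq_integral => y _.
    have mhs : measurable_fun setT (fun s => h (row_cons (s, y))).
      exact: (measurable_fun_pair1 y mrow).
    have fI : (lebesgue_measure I < +oo)%E by rewrite [X in (X < _)%E]mI ltry.
    have ih : lebesgue_measure.-integrable I (EFin \o (fun s => h (row_cons (s, y)))).
      apply: measurable_bounded_integrable;
        [exact: measurable_itv|exact: fI|exact: measurable_funTS|].
      exists M; split; first exact: num_real.
      by move=> z Mz x _; apply: (le_trans (hM _)); exact: ltW.
    have ic : lebesgue_measure.-integrable I (EFin \o cst M).
      apply: measurable_bounded_integrable;
        [exact: measurable_itv|exact: fI|exact: measurable_cst|].
      exists M; split; first exact: num_real.
      by move=> z Mz x _; rewrite /cst ger0_norm//; exact: ltW.
    transitivity (\int[lebesgue_measure]_(s in I) (h (row_cons (s, y)))%:E +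
        \int[lebesgue_measure]_(s in I) (cst M s)%:E)%E.
      by apply: integralD => //; exact: measurable_itv.
    rewrite h0 add0e; transitivity (M%:E * lebesgue_measure I)%E.
      transitivity (\int[lebesgue_measure]_(s in I) cst M%:E s)%E; first by [].
      by rewrite integral_cst//; exact: measurable_itv.
    by rewrite [X in (_ * X)%E]mI.
  rewrite integral_cst; last exact: mBox.
  by rewrite [X in (_ * X)%E]lebesgue_row_box// -EFinM exprS mulrA.
rewrite (integralD (mBox _ _) (bI _ _ _ mh hM) (icst _ _)) Vcst in key.
have fin := integrable_fin_num (mBox _ _) (bI _ a _ mh hM).
move: key; rewrite -(fineK fin) -EFinD => -[] /eqP.
by rewrite -subr_eq0 addrK => /eqP ->.
Qed.

(** A derivative along another axis is a derivative of slices, settled by induction. Along the first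
    axis the fundamental theorem evaluates g on two opposite faces, and g vanishes there because the
    hypothesis speaks of the open box. *)
Lemma integral_partial_eq0 n (a : 'rV[R]_n) l M (g : 'rV[R]_n -> R) i : c1 g -> 0 <= l ->
  (forall x : 'rV[R]_n, (exists j, ~~ (a 0 j < x 0 j < a 0 j + l)) -> g x = 0) ->
  (forall (x : 'rV[R]_n) j, `|partial j g x| <= M) ->
  (\int[lebesgue_row n]_(x in box a l) (partial i g x)%:E = 0)%E.
Proof.
elim: n a g i => [|n IH] a g i cg l0 g0 dgM; first by case: i.
have row_ord0 s (y : 'rV[R]_n) : row_cons (s, y) 0 ord0 = s by rewrite mxE unlift_none.
have row_lift s (y : 'rV[R]_n) j : row_cons (s, y) 0 (lift ord0 j) = y 0 j.
  by rewrite mxE liftK.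
apply: (@integral_box_eq0 _ _ _ M) => //; first exact: c1_measurable_partial.
case: (unliftP ord0 i) => [j|] ->.
  left => s; under eq_integral do rewrite -partial_slice.
  apply: IH => //; first exact: c1_slice.
    by move=> y [k yk]; apply: g0; exists (lift ord0 k); rewrite row_lift; rewrite mxE in yk.
  by move=> y k; rewrite partial_slice.
(* The closed interval has the same integral as the half-open one, and there the fundamental theorem
   applies. *)
right => y; rewrite integral_itv_bndo_bndc; last first.
  apply: measurable_funTS; apply/measurable_EFinP.
  by apply: continuous_measurable_fun; exact: (@continuous_slice0 R n _ y (cg.2 ord0).2).
have al : a 0 ord0 <= a 0 ord0 + l by lra.
have := FTC_sub al (fun s => @derivable_slice0 R n g s y cg) (fun s => derive_slice0 g s y)
  (@continuous_slice0 R n _ y (cg.2 ord0).2).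
rewrite !g0 ?subrr; last 2 first.
- by exists ord0; rewrite row_ord0 ltxx.
- by exists ord0; rewrite row_ord0 ltxx andbF.
have ii : lebesgue_measure.-integrable `[a 0 ord0, a 0 ord0 + l]%classic
    (EFin \o (fun s => partial ord0 g (row_cons (s, y)))).
  by apply: continuous_integrable_itv; exact: continuous_slice0 (cg.2 ord0).2.
move=> h; rewrite -(fineK (integrable_fin_num _ ii)); last exact: measurable_itv.
by move: h; rewrite /Rintegral => ->.
Qed.

Lemma test_function_by_parts n (Omega : set 'rV[R]_n) phi psi i : open Omega ->
  bounded_set Omega -> test_function Omega phi -> test_function Omega psi ->
  \int[lebesgue_row n]_(x in Omega) (phi x * partial i psi x) =
  - \int[lebesgue_row n]_(x in Omega) (partial i phi x * psi x).
Proof.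
move=> oO bO tp ts; have mO := measurable_domain oO.
have [cp dp] := test_function_c1 tp; have [cs ds] := test_function_c1 ts.
have [M M0 OM] := domain_bound bO.
pose g := phi * psi.
have gE j x : partial j g x = phi x * partial j psi x + partial j phi x * psi x.
  by rewrite /partial deriveM;
    [rewrite mulrC addrC [_ *: _]mulrC [X in _ + X]mulrC addrC|exact: (dp j).1|exact: (ds j).1].
have cg : c1 g.
  split; first by move=> x; apply: continuousM; [exact: cp|exact: cs].
  move=> j; split; first by move=> x; apply: derivableM; [exact: (dp j).1|exact: (ds j).1].
  have -> : partial j g = (fun x => phi x * partial j psi x) + (fun x => partial j phi x * psi x).
    by apply/funext => x; rewrite gE.
  move=> x; apply: continuousD.
    by apply: continuousM; [exact: cp|exact: (ds j).2].
  by apply: continuousM; [exact: (dp j).2|exact: cs].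
have [Mp hMp] := test_function_bounded tp; have [Ms hMs] := test_function_bounded ts.
have /choice[Np hNp] := fun j => partial_bounded j tp.
have /choice[Ns hNs] := fun j => partial_bounded j ts.
pose a : 'rV[R]_n := \row__ (- M).
have OB (x : 'rV[R]_n) : (exists j, ~~ (a 0 j < x 0 j < a 0 j + 2 * M)) -> ~ Omega x.
  move=> [j /negP xj] /OM xM; apply: xj; have := xM j.
  by rewrite mxE ltr_norml => /andP[? ?]; apply/andP; split; lra.
pose N := \sum_j (`|Mp| * `|Ns j| + `|Np j| * `|Ms|).
have hN x j : `|partial j g x| <= N.
  rewrite gE; apply: (@le_trans _ _ (`|Mp| * `|Ns j| + `|Np j| * `|Ms|)).
    apply: (le_trans (ler_normD _ _)); rewrite !normrM; apply: lerD; apply: ler_pM => //;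
      exact: le_trans (ler_norm _).
  rewrite /N (bigD1 j)//= lerDl; apply: sumr_ge0 => k _.
  by rewrite addr_ge0 ?mulr_ge0.
have h0 : (\int[lebesgue_row n]_(x in box a (2 * M)) (partial i g x)%:E = 0)%E.
  apply: (@integral_partial_eq0 n a (2 * M) N) => //; first by rewrite mulr_ge0// ltW.
  by move=> x /OB Ox; rewrite /g -[LHS]/(phi x * psi x) (test_function_out tp) ?mul0r.
have ip : (lebesgue_row n).-integrable Omega (EFin \o (fun x => phi x * partial i psi x)).
  apply: (bounded_integrable oO bO (M := `|Mp| * `|Ns i|)).
    by apply: measurable_funM; [exact: tf_measurable|exact: tf_measurable_partial].
  by move=> x _; rewrite normrM; apply: ler_pM => //; exact: le_trans (ler_norm _).
have is_ : (lebesgue_row n).-integrable Omega (EFin \o (fun x => partial i phi x * psi x)).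
  apply: (bounded_integrable oO bO (M := `|Np i| * `|Ms|)).
    by apply: measurable_funM; [exact: tf_measurable_partial|exact: tf_measurable].
  by move=> x _; rewrite normrM; apply: ler_pM => //; exact: le_trans (ler_norm _).
apply/eqP; rewrite -addr_eq0 -(RintegralD mO ip is_); apply/eqP.
rewrite /Rintegral -[RHS]/(fine 0%E); congr fine.
rewrite -h0 [LHS]integral_mkcond [RHS]integral_mkcond; apply: eq_integral => x _.
rewrite !patchE -gE; case: ifPn => [|/negP] xO; case: ifPn => [|/negP] xB //.
- exfalso; apply: xB; rewrite inE => j; have := OM x; rewrite inE in xO => /(_ xO j).
  by rewrite mxE ltr_norml => /andP[? ?]; apply/andP; split; lra.
- have Ox : ~ Omega x by move=> Ox; apply: xO; rewrite inE.
  by rewrite gE (test_function_out tp)// (test_function_out ts)// mul0r mulr0 addr0.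
Qed.

End integration_by_parts.

(** * Strong limits of test functions *)

Section strong_limits.
Context {R : realType} {n : nat}.
Variable Omega : set 'rV[R]_n.
Hypotheses (openO : open Omega) (boundedO : bounded_set Omega) (n0 : (0 < n)%N).
Variable p : R.
Hypotheses (p2 : 2 <= p) (crit : (n%:R - 2) * (p - 2) < 4).
Implicit Types (u v w phi psi : 'rV[R]_n -> R) (G H : 'I_n -> 'rV[R]_n -> R).
Local Notation mu := (@lebesgue_row R n).
Local Notation tf := (test_function Omega).
Local Notation Iw q u := (\int[mu]_(x in Omega) weight q (u x)).
Local Notation winteg := (weight_integrable mu Omega).

Let mO : measurable Omega := measurable_domain openO.

Let p_gt0 : 0 < p. Proof. exact: lt_le_trans p2. Qed.

Let le22 : 2 <= 2 :> R. Proof. by []. Qed.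

Lemma weight_le q (t s : R) : 0 <= q -> `|t| <= `|s| -> weight q t <= weight q s.
Proof.
move=> q0 ts; apply: lerD.
  by rewrite -(real_normK (num_real t)) -(real_normK (num_real s)) lerXn2r.
exact: ge0_ler_powR.
Qed.

Lemma weight2E (t : R) : weight 2 t = 2 * t ^+ 2.
Proof. by rewrite /weight powR_mulrn// real_normK ?num_real// mulr_natl mulr2n. Qed.

Lemma bounded_weight_integrable q w M : 2 <= q -> measurable_fun Omega w ->
  (forall x, Omega x -> `|w x| <= M) -> winteg q w.
Proof.
move=> q2 mw wM; split => //; apply: (bounded_integrable openO boundedO (M := weight q M)).
  exact: measurable_weight_comp.
move=> x Ox; rewrite ger0_norm ?weight_ge0//; apply: weight_le.
  by apply: le_trans q2.
by apply: (le_trans (wM x Ox)); exact: ler_norm.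
Qed.

Lemma tf_weight_integrable q phi : 2 <= q -> tf phi -> winteg q phi.
Proof.
move=> q2 tp; have [M pM] := test_function_bounded tp.
by apply: (@bounded_weight_integrable q phi M) => //; exact: tf_measurable.
Qed.

Lemma tf_weight_integrable_partial q i phi : 2 <= q -> tf phi -> winteg q (partial i phi).
Proof.
move=> q2 tp; have [M pM] := partial_bounded i tp.
by apply: (@bounded_weight_integrable q _ M) => //; exact: tf_measurable_partial.
Qed.

Lemma weight_integrable_bound q w B : 2 <= q -> measurable_fun Omega w ->
  (\int[mu]_(x in Omega) (weight q (w x))%:E <= B%:E)%E -> winteg q w /\ Iw q w <= B.
Proof.
move=> q2 mw wB.
have iw : winteg q w.
  split => //; apply/integrableP; split.
    by apply/measurable_EFinP; exact: measurable_weight_comp.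
  under eq_integral do rewrite gee0_abs ?lee_fin ?weight_ge0//.
  exact: le_lt_trans wB (ltry _).
by split => //; rewrite -lee_fin fineK//; exact: (integrable_fin_num mO iw.2).
Qed.

Lemma weight2_integrable_bound w B : measurable_fun Omega w ->
  (\int[mu]_(x in Omega) (w x ^+ 2)%:E <= B%:E)%E -> winteg 2 w /\ Iw 2 w <= 2 * B.
Proof.
move=> mw wB; apply: weight_integrable_bound => //.
under eq_integral do rewrite weight2E EFinM.
rewrite ge0_integralZl//; last 2 first.
- by apply/measurable_EFinP; exact: measurable_funX.
- by move=> x _; rewrite lee_fin sqr_ge0.
by rewrite EFinM; apply: lee_wpmul2l.
Qed.

Lemma weight2_integrable_sqr w : winteg 2 w -> mu.-integrable Omega (EFin \o (fun x => w x ^+ 2)).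
Proof.
move=> iw; exact: (growth_control_integrable mO le22 (growth_control_sqr 2) iw).
Qed.

Lemma weight2_integralE w : winteg 2 w -> Iw 2 w = 2 * \int[mu]_(x in Omega) w x ^+ 2.
Proof.
move=> iw; rewrite -RintegralZl//; last exact: weight2_integrable_sqr.
by apply: eq_Rintegral => x _; rewrite weight2E.
Qed.

Lemma weight_integrable2 w : winteg p w -> winteg 2 w.
Proof.
move=> iw; apply: (@weight2_integrable_bound w (Iw p w) iw.1 _).1.
rewrite fineK; last exact: (integrable_fin_num mO iw.2).
apply: ge0_le_integral => //.
- by move=> x _; rewrite lee_fin sqr_ge0.
- by apply/measurable_EFinP; apply: measurable_funX; exact: iw.1.
- by apply/measurable_EFinP; exact: measurable_weight_comp iw.1.
- by move=> x _; rewrite lee_fin sqr_le_weight.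
Qed.

Lemma integral_sqr_le_weight w : winteg p w -> \int[mu]_(x in Omega) w x ^+ 2 <= Iw p w.
Proof.
move=> iw; apply: le_Rintegral => //.
- exact: weight2_integrable_sqr (weight_integrable2 iw).
- exact: iw.2.
- by move=> x _; exact: sqr_le_weight.
Qed.

Lemma energyE phi : tf phi ->
  energy Omega phi = \sum_(i < n) \int[mu]_(x in Omega) partial i phi x ^+ 2.
Proof.
move=> tp; rewrite /energy /sqgrad Rintegral_sum// => i.
exact: weight2_integrable_sqr (tf_weight_integrable_partial i le22 tp).
Qed.

Lemma partial_tf_lincomb a phi b psi i x : tf phi -> tf psi ->
  partial i (lincomb a phi b psi) x = a * partial i phi x + b * partial i psi x.
Proof.
move=> tp ts; apply: partial_lincomb.
  exact: ((test_function_c1 tp).2 i).1.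
exact: ((test_function_c1 ts).2 i).1.
Qed.

(** [weight p (Num.sqrt e)] is e + e^(p / 2), which collects the Sobolev bounds for the exponents 2
    and p. It is continuous and vanishes with the energy. *)
Lemma sobolev_weight : exists2 C : R, 0 <= C & forall phi, tf phi ->
  Iw p phi <= C * weight p (Num.sqrt (energy Omega phi)).
Proof.
have [|C2 C20 H2] := @sobolev R n Omega openO boundedO 2 n0 le22.
  by rewrite subrr mulr0.
have [Cp Cp0 Hp] := sobolev openO boundedO n0 p2 crit.
exists (C2 + Cp); first exact: addr_ge0.
move=> phi tp; have e0 := energy_ge0 Omega phi.
have i2 := tf_integrable_sqr openO boundedO tp.
have ip := tf_integrable_powR openO boundedO (ltW p_gt0) tp.
rewrite (RintegralD mO i2 ip) /weight sqr_sqrtr// ger0_norm ?sqrtr_ge0//.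
rewrite -powR12_sqrt// -powRrM [2^-1 * p]mulrC.
have h2 := H2 _ tp; have hp := Hp _ tp.
rewrite divff ?powRr1// in h2.
have {}h2 : \int[mu]_(x in Omega) phi x ^+ 2 <= C2 * energy Omega phi.
  apply: le_trans h2; rewrite le_eqVlt; apply/orP; left; apply/eqP.
  by apply: eq_Rintegral => x _; rewrite powR_mulrn// real_normK// num_real.
have pw0 : 0 <= energy Omega phi `^ (p / 2) by exact: powR_ge0.
rewrite mulrDl !mulrDr -addrA; apply: lerD => //.
apply: (le_trans hp);
apply: (@le_trans _ _ (Cp * energy Omega phi + Cp * energy Omega phi `^ (p / 2))).
  by rewrite lerDr mulr_ge0.
by rewrite lerDr mulr_ge0.
Qed.

Definition strong_limit (phi_ : nat -> 'rV[R]_n -> R) u G :=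
  [/\ forall k, tf (phi_ k), winteg p u, forall i, winteg 2 (G i),
      Iw p (fun x => phi_ k x - u x) @[k --> \oo] --> 0 &
      forall i, Iw 2 (fun x => partial i (phi_ k) x - G i x) @[k --> \oo] --> 0].

(** Of [u] and [G] only measurability is asked: the integrals are extended reals, and the rate 8^-k
    supplies integrability and, through [L2_ae_cvg], convergence a.e. *)
Definition rapid_limit (phi_ : nat -> 'rV[R]_n -> R) u G :=
  [/\ forall k, tf (phi_ k), measurable_fun Omega u, forall i, measurable_fun Omega (G i),
      forall k, (\int[mu]_(x in Omega) ((phi_ k x - u x) ^+ 2)%:E <= (8 ^- k)%:E)%E &
      forall k i,
        (\int[mu]_(x in Omega) ((partial i (phi_ k) x - G i x) ^+ 2)%:E <= (8 ^- k)%:E)%E].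

Lemma cvg_inv_expr8 (C : R) : C * 8 ^- k @[k --> \oo] --> 0.
Proof.
rewrite -[X in _ --> X](mulr0 C); apply: cvgMl_tmp; under eq_fun do rewrite -exprVn.
by apply: cvg_expr; rewrite ger0_norm ?invr_ge0// invf_lt1// ltr1n.
Qed.

(** Convergence in L^p is not among the hypotheses. It comes from the Sobolev inequality for phi_k -
    phi_j, whose energy is at most 4 n 8^-k for k <= j, and from Fatou as j grows. *)
Lemma rapid_strong_limit (phi_ : nat -> 'rV[R]_n -> R) u G :
  rapid_limit phi_ u G -> strong_limit phi_ u G.
Proof.
move=> [tp mu_ mG hu hG].
have mphi k := tf_measurable (tp k).
have mdphi k i := tf_measurable_partial i (tp k).
have wd k i := weight2_integrable_bound (measurable_funB (mdphi k i) (mG i)) (hG k i).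
have iG i : winteg 2 (G i).
  have := weight_integrableB mO le22 (tf_weight_integrable_partial i le22 (tp 0%N)) (wd 0%N i).1.
  by under eq_fun do rewrite opprB addrC subrK.
have dG i : Iw 2 (fun x => partial i (phi_ k) x - G i x) @[k --> \oo] --> 0.
  apply: (@squeeze_cvgr _ _ _ _ (fun=> 0) (fun k => 2 * 8 ^- k)).
  - apply: nearW => k; rewrite (wd k i).2 andbT.
    by apply: Rintegral_ge0 => x _; exact: weight_ge0.
  - exact: cvg_cst.
  - exact: cvg_inv_expr8.
have de k j : (k <= j)%N -> energy Omega (lincomb 1 (phi_ k) (-1) (phi_ j)) <= 4 * n%:R * 8 ^- k.
  move=> kj; rewrite energyE; last exact: test_function_lincomb.
  apply: (@le_trans _ _ (\sum_(i < n) 4 * 8 ^- k)); last first.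
    by rewrite sumr_const card_ord -[X in X <= _]mulr_natr mulrAC.
  apply: ler_sum => i _.
  have ik := (wd k i).1; have ij := (wd j i).1.
  have sk := weight2_integrable_sqr ik; have sj := weight2_integrable_sqr ij.
  have i2 := integrableZl mO 2 (integrableD mO sk sj).
  have il := weight2_integrable_sqr (tf_weight_integrable_partial i le22
    (test_function_lincomb 1 (-1) (tp k) (tp j))).
  apply: (@le_trans _ _ (\int[mu]_(x in Omega) (2 * ((partial i (phi_ k) x - G i x) ^+ 2 +
      (partial i (phi_ j) x - G i x) ^+ 2)))).
    apply: le_Rintegral => // x _; rewrite partial_tf_lincomb// mul1r mulN1r.
    set a := partial i _ x; set b := partial i _ x; set c := G i x.
    by have := sqr_ge0 (a - c + (b - c)); nra.
  rewrite (RintegralZl _ mO (integrableD mO sk sj)) (RintegralD mO sk sj).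
  have hs l : \int[mu]_(x in Omega) (partial i (phi_ l) x - G i x) ^+ 2 <= 8 ^- l.
    have := (wd l i).2; rewrite (weight2_integralE (wd l i).1) ler_pM2l//.
  have h8 : 8 ^- j <= 8 ^- k :> R.
    by rewrite lef_pV2 ?posrE ?exprn_gt0// ler_eXn2l// ltr1n.
  have key (a b c d : R) : a <= c -> b <= d -> d <= c -> 2 * (a + b) <= 4 * c by lra.
  exact: (key _ _ _ _ (hs k) (hs j) h8).
have [C C0 HC] := sobolev_weight.
pose eta k := C * weight p (Num.sqrt (4 * n%:R * 8 ^- k)).
have eta0 : eta k @[k --> \oo] --> 0.
  rewrite -[X in _ --> X](mulr0 C); apply: cvgMl_tmp.
  rewrite -(weight0 p2) -(@sqrtr0 R).
  apply: (@continuous_cvg _ _ _ _ _ _ (weight p)); first exact: (continuous_weight p2).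
  apply: (@continuous_cvg _ _ _ _ _ _ (@Num.sqrt R)); first exact: sqrt_continuous.
  exact: cvg_inv_expr8.
have wkj k j : (k <= j)%N -> Iw p (fun x => phi_ k x - phi_ j x) <= eta k.
  move=> kj; have tl := test_function_lincomb 1 (-1) (tp k) (tp j).
  have := HC _ tl; rewrite (_ : Iw p _ = Iw p (fun x => phi_ k x - phi_ j x)); last first.
    by apply: eq_Rintegral => x _; rewrite /lincomb mul1r mulN1r.
  move=> /le_trans; apply; apply: ler_wpM2l => //; apply: weight_le; first exact: ltW.
  by rewrite !ger0_norm ?sqrtr_ge0// ler_wsqrtr// de.
have ae := L2_ae_cvg mO mphi mu_ hu.
have wk k : (\int[mu]_(x in Omega) (weight p (phi_ k x - u x))%:E <= (eta k)%:E)%E.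
  have mw (g h : 'rV[R]_n -> R) : measurable_fun Omega g -> measurable_fun Omega h ->
      measurable_fun Omega (fun x => (weight p (g x - h x))%:E).
    move=> mg mh; apply/measurable_EFinP.
    by apply: (measurable_weight_comp p2 (u := fun x => g x - h x)); exact: measurable_funB.
  apply: (fatou_bound mO (f_ := fun j x => (weight p (phi_ k x - phi_ j x))%:E)).
  - by move=> j; exact: mw.
  - exact: mw.
  - by move=> j x _; rewrite lee_fin weight_ge0.
  - move: ae; apply: filterS => x /[apply] cx; apply: cvg_EFin; first exact: nearW.
    apply: (@continuous_cvg _ _ _ _ _ _ (weight p)); first exact: (continuous_weight p2).
    by apply: cvgB => //; exact: cvg_cst.
  - exists k => // j /= kj; have := wkj _ _ kj; rewrite -lee_fin fineK//.
    apply: (integrable_fin_num mO).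
    exact: (weight_integrableB mO p2 (tf_weight_integrable p2 (tp k))
      (tf_weight_integrable p2 (tp j))).2.
have wkb k := weight_integrable_bound p2 (measurable_funB (mphi k) mu_) (wk k).
split => //.
  have := weight_integrableB mO p2 (tf_weight_integrable p2 (tp 0%N)) (wkb 0%N).1.
  by under eq_fun do rewrite opprB addrC subrK.
apply: (@squeeze_cvgr _ _ _ _ (fun=> 0) eta) => //; last exact: cvg_cst.
apply: nearW => k; rewrite (wkb k).2 andbT.
by apply: Rintegral_ge0 => x _; exact: weight_ge0.
Qed.

Lemma cauchy_strong_limit (phi_ : nat -> 'rV[R]_n -> R) : (forall k, tf (phi_ k)) ->
  (forall k j, (k <= j)%N -> \int[mu]_(x in Omega) (phi_ k x - phi_ j x) ^+ 2 <= 8 ^- k) ->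
  (forall k j, (k <= j)%N -> energy Omega (lincomb 1 (phi_ k) (-1) (phi_ j)) <= 8 ^- k) ->
  exists u G, strong_limit phi_ u G.
Proof.
move=> tp hu he.
have isq w : winteg 2 w -> (\int[mu]_(x in Omega) (w x ^+ 2)%:E =
    (\int[mu]_(x in Omega) w x ^+ 2)%:E)%E.
  by move=> iw; rewrite fineK//; exact: (integrable_fin_num mO (weight2_integrable_sqr iw)).
have [u [mu_ hu' _]] : exists u, [/\ measurable_fun Omega u,
    (forall k, (\int[mu]_(x in Omega) ((phi_ k x - u x) ^+ 2)%:E <= (8 ^- k)%:E)%E) &
    {ae mu, forall x, Omega x -> phi_ k x @[k --> \oo] --> u x}].
  apply: (L2_complete mO) => [k|k j kj]; first exact: tf_measurable.
  rewrite (isq (fun x => phi_ k x - phi_ j x)) ?lee_fin ?hu//.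
  by apply: (weight_integrableB mO le22); exact: tf_weight_integrable.
have hG (i : 'I_n) : exists g : 'rV[R]_n -> R, measurable_fun Omega g /\
    (forall k, (\int[mu]_(x in Omega) ((partial i (phi_ k) x - g x) ^+ 2)%:E <= (8 ^- k)%:E)%E).
  have [|k j kj|G [mG hG _]] := @L2_complete _ _ _ mu Omega mO (fun k => partial i (phi_ k)).
  - by move=> k; exact: tf_measurable_partial.
  - rewrite (isq (fun x => partial i (phi_ k) x - partial i (phi_ j) x)); last first.
      by apply: (weight_integrableB mO le22); exact: tf_weight_integrable_partial.
    rewrite lee_fin; apply: le_trans (he k j kj).
    have tl := test_function_lincomb 1 (-1) (tp k) (tp j).
    rewrite energyE// (bigD1 i)//= (_ : Rintegral _ _ _ =
      \int[mu]_(x in Omega) partial i (lincomb 1 (phi_ k) (-1) (phi_ j)) x ^+ 2).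
      by rewrite lerDl; apply: sumr_ge0 => l _; apply: Rintegral_ge0 => x _; exact: sqr_ge0.
    by apply: eq_Rintegral => x _; rewrite partial_tf_lincomb// mul1r mulN1r.
  - by exists G.
have /choice[G HG] := hG; exists u, G; apply: rapid_strong_limit; split => //.
- by move=> i; exact: (HG i).1.
- by move=> k i; exact: (HG i).2.
Qed.

End strong_limits.

(** * Limits of real sequences *)

Section sequences.
Context {R : realType}.
Implicit Types a b : nat -> R.

Lemma cvg_scale c a l : a k @[k --> \oo] --> l -> c * a k @[k --> \oo] --> c * l.
Proof. by move=> al; apply: cvgM => //; exact: cvg_cst. Qed.

Lemma cvg_sum_ord n (a : 'I_n -> nat -> R) (l : 'I_n -> R) :
  (forall i, a i k @[k --> \oo] --> l i) ->
  \sum_(i < n) a i k @[k --> \oo] --> \sum_(i < n) l i.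
Proof.
elim: n a l => [|n IH] a l al.
  by rewrite big_ord0; under eq_fun do rewrite big_ord0; exact: cvg_cst.
rewrite big_ord_recr; under eq_fun do rewrite big_ord_recr/=.
by apply: cvgD => //; apply: IH => i; exact: al.
Qed.

Lemma squeeze_scale c a b : (forall k, 0 <= a k <= c * b k) -> b k @[k --> \oo] --> 0 ->
  a k @[k --> \oo] --> 0.
Proof.
move=> ab b0; apply: (@squeeze_cvgr _ _ _ _ (fun=> 0) (fun k => c * b k)).
- exact: nearW.
- exact: cvg_cst.
- by rewrite -[X in _ --> X](mulr0 c); exact: cvg_scale.
Qed.

Lemma cvg_le_bound a l B : a k @[k --> \oo] --> l -> (forall k, a k <= B) -> l <= B.
Proof.
move=> al aB; rewrite leNgt; apply/negP => Bl.
have : \forall k \near \oo, B < a k by exact: (cvgr_gt _ al _ Bl).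
by case=> k _ /(_ k (leqnn k)); rewrite ltNge aB.
Qed.

End sequences.

(** * Passage to the limit, and H^1_0 as the set of strong limits *)

Section sobolev_limits.
Context {R : realType} {n : nat}.
Variable Omega : set 'rV[R]_n.
Hypotheses (openO : open Omega) (boundedO : bounded_set Omega) (n0 : (0 < n)%N).
Variable p : R.
Hypotheses (p2 : 2 <= p) (crit : (n%:R - 2) * (p - 2) < 4).
Implicit Types (u v w phi psi : 'rV[R]_n -> R) (G H : 'I_n -> 'rV[R]_n -> R).
Local Notation mu := (@lebesgue_row R n).
Local Notation tf := (test_function Omega).
Local Notation Iw q u := (\int[mu]_(x in Omega) weight q (u x)).
Local Notation winteg := (weight_integrable mu Omega).

Let mO : measurable Omega := measurable_domain openO.

Let le22 : 2 <= 2 :> R. Proof. by []. Qed.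

Lemma weight_integral_ge0 q w : 0 <= Iw q w.
Proof. by apply: Rintegral_ge0 => x _; exact: weight_ge0. Qed.

Lemma weight_integralD q u v : 2 <= q -> winteg q u -> winteg q v ->
  Iw q (fun x => u x + v x) <= 2 `^ q * (Iw q u + Iw q v).
Proof.
move=> q2 iu iv; have iD := integrableD mO iu.2 iv.2.
rewrite -(RintegralD mO iu.2 iv.2) -(RintegralZl (2 `^ q) mO iD).
apply: le_Rintegral => //; first exact: (weight_integrableD mO q2 iu iv).2.
  exact: (integrableZl mO (2 `^ q) iD).
by move=> x _; exact: weightD.
Qed.

Lemma weight_integralZ q a u : 2 <= q -> winteg q u -> Iw q (fun x => a * u x) <= weight q a * Iw q u.
Proof.
move=> q2 iu; rewrite -(RintegralZl (weight q a) mO iu.2).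
apply: le_Rintegral => //; first exact: (weight_integrableZ mO q2 a iu).2.
  exact: (integrableZl mO (weight q a) iu.2).
by move=> x _; exact: weightM.
Qed.

Lemma cvg_weight_integralD q (u_ v_ : nat -> 'rV[R]_n -> R) : 2 <= q ->
  (forall k, winteg q (u_ k)) -> (forall k, winteg q (v_ k)) ->
  Iw q (u_ k) @[k --> \oo] --> 0 -> Iw q (v_ k) @[k --> \oo] --> 0 ->
  Iw q (fun x => u_ k x + v_ k x) @[k --> \oo] --> 0.
Proof.
move=> q2 iu iv u0 v0.
apply: (@squeeze_scale _ (2 `^ q) _ (fun k => Iw q (u_ k) + Iw q (v_ k))).
  by move=> k; rewrite weight_integral_ge0 weight_integralD.
by rewrite -[X in _ --> X](addr0 0); exact: (cvgD u0 v0).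
Qed.

Lemma cvg_weight_integralZ q (a_ : nat -> R) B (u_ : nat -> 'rV[R]_n -> R) : 2 <= q ->
  (forall k, winteg q (u_ k)) -> (forall k, Iw q (u_ k) <= B) -> a_ k @[k --> \oo] --> 0 ->
  Iw q (fun x => a_ k * u_ k x) @[k --> \oo] --> 0.
Proof.
move=> q2 iu uB a0.
apply: (@squeeze_cvgr _ _ _ _ (fun=> 0) (fun k => weight q (a_ k) * B)).
- apply: nearW => k; rewrite weight_integral_ge0 /=; apply: (le_trans (weight_integralZ _ q2 (iu k))).
  by apply: ler_wpM2l => //; exact: weight_ge0.
- exact: cvg_cst.
- rewrite -[X in _ --> X](mul0r B) -(weight0 q2); apply: cvgMr_tmp.
  by apply: (@continuous_cvg _ _ _ _ _ _ (weight q)) a0; exact: (continuous_weight q2).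
Qed.

(** Polarization: the integrability of products and, in [cvg_integral_mul], their convergence reduce
    to those of squares. *)
Lemma weight2_integrable_mul u v : winteg 2 u -> winteg 2 v ->
  mu.-integrable Omega (EFin \o (fun x => u x * v x)) /\
  \int[mu]_(x in Omega) (u x * v x) = 4^-1 *
    (\int[mu]_(x in Omega) (u x + v x) ^+ 2 - \int[mu]_(x in Omega) (u x - v x) ^+ 2).
Proof.
move=> iu iv.
have iD := weight2_integrable_sqr openO (weight_integrableD mO le22 iu iv).
have iB := weight2_integrable_sqr openO (weight_integrableB mO le22 iu iv).
have iS := integrableB mO iD iB.
have -> : (fun x => u x * v x) = (fun x => 4^-1 * ((u x + v x) ^+ 2 - (u x - v x) ^+ 2)).
  by apply/funext => x; field.
split; first exact: (integrableZl mO 4^-1 iS).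
by rewrite (RintegralZl 4^-1 mO iS) (RintegralB mO iD iB).
Qed.

Lemma cvg_integral_mul u v (u_ v_ : nat -> 'rV[R]_n -> R) : winteg 2 u -> winteg 2 v ->
  (forall k, winteg 2 (u_ k)) -> (forall k, winteg 2 (v_ k)) ->
  Iw 2 (fun x => u_ k x - u x) @[k --> \oo] --> 0 ->
  Iw 2 (fun x => v_ k x - v x) @[k --> \oo] --> 0 ->
  \int[mu]_(x in Omega) (u_ k x * v_ k x) @[k --> \oo] --> \int[mu]_(x in Omega) (u x * v x).
Proof.
move=> iu iv iuk ivk u0 v0.
rewrite (weight2_integrable_mul iu iv).2.
under eq_fun do rewrite (weight2_integrable_mul (iuk _) (ivk _)).2.
have du k := weight_integrableB mO le22 (iuk k) iu.
have dv k := weight_integrableB mO le22 (ivk k) iv.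
have dv' k := weight_integrableZ mO le22 (-1) (dv k).
apply: cvgMl_tmp; apply: cvgB.
  apply: (cvg_integral_growth_control1 mO le22 (growth_control_sqr 2)).
  - exact: weight_integrableD.
  - by move=> k; exact: weight_integrableD.
  - rewrite (_ : (fun k => _) = (fun k => Iw 2 (fun x => (u_ k x - u x) + (v_ k x - v x)))).
      exact: (cvg_weight_integralD le22 du dv u0 v0).
    by apply/funext => k; apply: eq_Rintegral => x _; congr weight; ring.
apply: (cvg_integral_growth_control1 mO le22 (growth_control_sqr 2)).
- exact: weight_integrableB.
- by move=> k; exact: weight_integrableB.
- rewrite (_ : (fun k => _) = (fun k => Iw 2 (fun x => (u_ k x - u x) + -1 * (v_ k x - v x)))).
    apply: (cvg_weight_integralD le22 du dv' u0).
    rewrite (_ : (fun k => _) = (fun k => Iw 2 (fun x => v_ k x - v x))); first exact: v0.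
    by apply/funext => k; apply: eq_Rintegral => x _; rewrite mulN1r weightN.
  by apply/funext => k; apply: eq_Rintegral => x _; congr weight; ring.
Qed.

Lemma dirichlet_formE G H : (forall i, winteg 2 (G i)) -> (forall i, winteg 2 (H i)) ->
  dirichlet_form Omega G H = \sum_(i < n) \int[mu]_(x in Omega) (G i x * H i x).
Proof.
move=> iG iH; rewrite /dirichlet_form Rintegral_sum// => i.
exact: (weight2_integrable_mul (iG i) (iH i)).1.
Qed.

Lemma cvg_weight2_integral u (u_ : nat -> 'rV[R]_n -> R) : winteg p u -> (forall k, winteg p (u_ k)) ->
  Iw p (fun x => u_ k x - u x) @[k --> \oo] --> 0 ->
  Iw 2 (fun x => u_ k x - u x) @[k --> \oo] --> 0.
Proof.
move=> iu iuk u0.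
have id k := weight_integrableB mO p2 (iuk k) iu.
apply: (@squeeze_scale _ 2 _ (fun k => Iw p (fun x => u_ k x - u x))) => // k.
rewrite weight_integral_ge0 (weight2_integralE openO (weight_integrable2 openO p2 (id k))).
by rewrite ler_pM2l// (integral_sqr_le_weight openO p2 (id k)).
Qed.

Section limit.
Variables (phi_ : nat -> 'rV[R]_n -> R) (u : 'rV[R]_n -> R) (G : 'I_n -> 'rV[R]_n -> R).
Hypothesis lim : strong_limit Omega p phi_ u G.

Let tp k : tf (phi_ k). Proof. by case: lim. Qed.
Let iu : winteg p u. Proof. by case: lim. Qed.
Let iG i : winteg 2 (G i). Proof. by case: lim. Qed.
Let ip k : winteg p (phi_ k). Proof. exact: tf_weight_integrable. Qed.
Let idp k i : winteg 2 (partial i (phi_ k)). Proof. exact: tf_weight_integrable_partial. Qed.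
Let u0 : Iw p (fun x => phi_ k x - u x) @[k --> \oo] --> 0.
Proof. by case: lim => _ _ _ h _; exact: h. Qed.
Let G0 i : Iw 2 (fun x => partial i (phi_ k) x - G i x) @[k --> \oo] --> 0.
Proof. by case: lim => _ _ _ _; apply. Qed.
Let iu2 : winteg 2 u. Proof. exact: (weight_integrable2 openO p2). Qed.
Let ip2 k : winteg 2 (phi_ k). Proof. exact: tf_weight_integrable. Qed.
Let u02 : Iw 2 (fun x => phi_ k x - u x) @[k --> \oo] --> 0.
Proof. exact: (cvg_weight2_integral iu ip u0). Qed.

Lemma strong_limit_control (H : R -> R) K : growth_control p H K ->
  \int[mu]_(x in Omega) H (phi_ k x) @[k --> \oo] --> \int[mu]_(x in Omega) H (u x).
Proof.
move=> HK.
exact: (@cvg_integral_growth_control1 _ _ _ mu Omega p mO p2 H K u phi_ HK iu ip u0).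
Qed.

Lemma strong_limit_sqr :
  \int[mu]_(x in Omega) phi_ k x ^+ 2 @[k --> \oo] --> \int[mu]_(x in Omega) u x ^+ 2.
Proof. exact: strong_limit_control (growth_control_sqr p). Qed.

Let cst0 q (w : 'rV[R]_n -> R) : 2 <= q -> Iw q (fun x => w x - w x) @[k --> \oo] --> (0 : R).
Proof.
move=> q2; under eq_Rintegral do rewrite subrr (weight0 q2).
by rewrite /Rintegral integral0; exact: cvg_cst.
Qed.

Lemma strong_limit_mul v : winteg 2 v ->
  \int[mu]_(x in Omega) (v x * phi_ k x) @[k --> \oo] --> \int[mu]_(x in Omega) (v x * u x).
Proof.
move=> iv.
exact: (cvg_integral_mul iv iu2 (fun=> iv) ip2 (cst0 v le22) u02).
Qed.

Lemma strong_limit_energy :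
  energy Omega (phi_ k) @[k --> \oo] --> dirichlet_form Omega G G.
Proof.
rewrite (dirichlet_formE iG iG).
under eq_fun do rewrite (energyE openO boundedO (tp _)).
apply: cvg_sum_ord => i; under eq_fun do under eq_Rintegral do rewrite expr2.
exact: (cvg_integral_mul (iG i) (iG i) (idp^~ i) (idp^~ i) (G0 i) (G0 i)).
Qed.

Lemma strong_limit_form H : (forall i, winteg 2 (H i)) ->
  dirichlet_form Omega H (fun i => partial i (phi_ k)) @[k --> \oo] -->
  dirichlet_form Omega H G.
Proof.
move=> iH; rewrite (dirichlet_formE iH iG).
under eq_fun do rewrite (dirichlet_formE iH (idp _)).
apply: cvg_sum_ord => i.
exact: (cvg_integral_mul (iH i) (iG i) (fun=> iH i) (idp^~ i) (cst0 (H i) le22) (G0 i)).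
Qed.

(** Both sides of the classical integration by parts for phi_k converge, since each pairs a fixed
    function with an L^2 convergent one. *)
Lemma strong_limit_weak_gradient : weak_gradient Omega u G.
Proof.
move=> psi i ts; have is_ := tf_weight_integrable openO boundedO le22 ts.
have ids := tf_weight_integrable_partial openO boundedO i le22 ts.
have h1 := strong_limit_mul ids.
have h2 : \int[mu]_(x in Omega) (psi x * partial i (phi_ k) x) @[k --> \oo] -->
    \int[mu]_(x in Omega) (psi x * G i x).
  exact: (cvg_integral_mul is_ (iG i) (fun=> is_) (idp^~ i) (cst0 psi le22) (G0 i)).
have h3 : \int[mu]_(x in Omega) (partial i psi x * phi_ k x) @[k --> \oo] -->
    - \int[mu]_(x in Omega) (psi x * G i x).
  rewrite (_ : (fun k => _) = (fun k => - \int[mu]_(x in Omega) (psi x * partial i (phi_ k) x))).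
    exact: cvgN.
  by apply/funext => k; rewrite (test_function_by_parts i openO boundedO ts (tp k)) opprK.
have := cvg_unique _ h1 h3.
under eq_Rintegral do rewrite mulrC.
by move=> ->//; congr (- _); apply: eq_Rintegral => x _; rewrite mulrC.
Qed.

Lemma strong_limit_lincomb a b psi : tf psi ->
  strong_limit Omega p (fun k => lincomb a (phi_ k) b psi) (lincomb a u b psi)
    (fun i => lincomb a (G i) b (partial i psi)).
Proof.
move=> ts; split.
- by move=> k; exact: test_function_lincomb.
- apply: (weight_integrableD mO p2); apply: (weight_integrableZ mO p2) => //.
  exact: tf_weight_integrable.
- move=> i; apply: (weight_integrableD mO le22); apply: (weight_integrableZ mO le22) => //.
  exact: tf_weight_integrable_partial.
- rewrite (_ : (fun k => _) = (fun k => Iw p (fun x => a * (phi_ k x - u x)))); last first.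
    by apply/funext => k; apply: eq_Rintegral => x _; congr weight; rewrite /lincomb; ring.
  have iB k := weight_integrableB mO p2 (ip k) iu.
  apply: (@squeeze_scale _ (weight p a) _ (fun k => Iw p (fun x => phi_ k x - u x))); last exact: u0.
  by move=> k; rewrite weight_integral_ge0 (weight_integralZ _ p2 (iB k)).
- move=> i.
  rewrite (_ : (fun k => _) = (fun k => Iw 2 (fun x => a * (partial i (phi_ k) x - G i x)))); last first.
    apply/funext => k; apply: eq_Rintegral => x _; congr weight.
    by rewrite (partial_tf_lincomb _ _ _ _ (tp k) ts) /lincomb; ring.
  have iB k := weight_integrableB mO le22 (idp k i) (iG i).
  apply: (@squeeze_scale _ (weight 2 a) _ (fun k => Iw 2 (fun x => partial i (phi_ k) x - G i x))).
    by move=> k; rewrite weight_integral_ge0 (weight_integralZ _ le22 (iB k)).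
  exact: G0.
Qed.

End limit.

Lemma L2norm_sqr w :
  (L2norm Omega w `^ 2 = \int[mu]_(x in Omega) (w x ^+ 2)%:E)%E.
Proof.
rewrite /L2norm powR_Lnorm// [RHS]integral_mkcond; apply: eq_integral => x _.
rewrite /= !patchE; case: ifPn => _ /=.
  by rewrite powR_mulrn// real_normK// num_real.
by rewrite normr0 powR0.
Qed.

Lemma L2normE w : winteg 2 w -> L2norm Omega w = (Num.sqrt (\int[mu]_(x in Omega) w x ^+ 2))%:E.
Proof.
move=> iw; have h := L2norm_sqr w.
have isq := weight2_integrable_sqr openO iw.
have e0 : 0 <= \int[mu]_(x in Omega) w x ^+ 2 by apply: Rintegral_ge0 => x _; exact: sqr_ge0.
have : ((L2norm Omega w `^ 2) `^ 2^-1 = (\int[mu]_(x in Omega) w x ^+ 2)%:E `^ 2^-1)%E.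
  by rewrite h fineK//; exact: integrable_fin_num.
by rewrite -poweRrM divff// poweRe1 ?Lnorm_ge0// => ->; rewrite poweR12_sqrt ?lee_fin.
Qed.

Lemma strong_limit_H10 (phi_ : nat -> 'rV[R]_n -> R) u G :
  strong_limit Omega p phi_ u G -> H10 Omega u G.
Proof.
move=> lim; have [tp iu iG u0 G0] := lim.
have iu2 := weight_integrable2 openO p2 iu.
have ip k := tf_weight_integrable openO boundedO p2 (tp k).
have L2w w : winteg 2 w -> L2 Omega w.
  by move=> iw; split; [exact: iw.1|rewrite L2normE// ltry].
have cvgL (w_ : nat -> 'rV[R]_n -> R) w : (forall k, winteg 2 (w_ k)) -> winteg 2 w ->
    Iw 2 (fun x => w_ k x - w x) @[k --> \oo] --> 0 ->
    L2norm Omega (w_ k \- w) @[k --> \oo] --> 0%E.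
  move=> iwk iw w0; have id k := weight_integrableB mO le22 (iwk k) iw.
  rewrite (_ : (fun k => _) = (fun k => (Num.sqrt (2^-1 * Iw 2 (fun x => w_ k x - w x)))%:E)).
    apply: cvg_EFin; first exact: nearW.
    rewrite -[X in _ --> X](@sqrtr0 R) -(mulr0 2^-1).
    apply: (@continuous_cvg _ _ _ _ _ _ (@Num.sqrt R)); first exact: sqrt_continuous.
      exact: cvg_scale.
  apply/funext => k; rewrite (L2normE (w := w_ k \- w) (id k)) (weight2_integralE openO (id k)).
  by rewrite mulKf.
split; first by split => //; [exact: L2w|move=> i; exact: L2w|exact: strong_limit_weak_gradient lim].
exists phi_; split => // [|i].
  exact: (cvgL phi_ u (fun k => tf_weight_integrable openO boundedO le22 (tp k)) iu2
    (cvg_weight2_integral iu ip u0)).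
exact: (cvgL (fun k => partial i (phi_ k)) (G i)
  (fun k => tf_weight_integrable_partial openO boundedO i le22 (tp k)) (iG i) (G0 i)).
Qed.

(** [H10] gives convergence in L^2 of functions and gradients, at no particular rate. Along a choice
    of indices with rate 8^-k this is a [rapid_limit], which brings the convergence in L^p. *)
Lemma H10_strong_limit u G : H10 Omega u G ->
  exists phi_ : nat -> 'rV[R]_n -> R, strong_limit Omega p phi_ u G.
Proof.
move=> [[[mu_ _] mG _] [phi_ [tp hu hG]]].
have small (w_ : nat -> 'rV[R]_n -> R) (e : R) : 0 < e ->
    L2norm Omega (w_ k) @[k --> \oo] --> 0%E ->
    \forall k \near \oo, (\int[mu]_(x in Omega) (w_ k x ^+ 2)%:E <= e%:E)%E.
  move=> e0 w0.
  have : \forall k \near \oo, (L2norm Omega (w_ k) < (Num.sqrt e)%:E)%E.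
    by move/(_ [set x | x < (Num.sqrt e)%:E]%E): w0; apply; apply: open_nbhs_nbhs; split;
      [exact: open_ereal_lt_ereal|rewrite /= lte_fin sqrtr_gt0].
  apply: filterS => k /ltW h; rewrite -L2norm_sqr.
  have -> : e%:E = ((Num.sqrt e)%:E `^ 2)%E.
    by rewrite poweR_EFin powR_mulrn ?sqrtr_ge0// sqr_sqrtr// ltW.
  by apply: gt0_ler_poweR => //; rewrite in_itv/= ?leey ?Lnorm_ge0 ?lee_fin ?sqrtr_ge0.
have /choice[j Hj] : forall k, exists j,
    (\int[mu]_(x in Omega) ((phi_ j x - u x) ^+ 2)%:E <= (8 ^- k)%:E)%E /\
    forall i, (\int[mu]_(x in Omega) ((partial i (phi_ j) x - G i x) ^+ 2)%:E <= (8 ^- k)%:E)%E.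
  move=> k; have k0 : 0 < 8 ^- k :> R by rewrite invr_gt0 exprn_gt0.
  have h1 := small (fun j => phi_ j \- u) _ k0 hu.
  have h2 : \forall j \near \oo, forall i : 'I_n,
      (\int[mu]_(x in Omega) ((partial i (phi_ j) x - G i x) ^+ 2)%:E <= (8 ^- k)%:E)%E.
    by apply: filter_forall => i; exact: (small (fun j => partial i (phi_ j) \- G i) _ k0 (hG i)).
  have [m _ hm] := filterI h1 h2; exists m; exact: (hm m (leqnn m)).
exists (phi_ \o j); apply: rapid_strong_limit => //; split => //.
- by move=> k; exact: tp.
- by move=> i; have [] := mG i.
- by move=> k; exact: (Hj k).1.
- by move=> k i; exact: (Hj k).2.
Qed.

End sobolev_limits.

(** * Constrained minimization *)

Section sphere.
Context {R : realFieldType}.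
Implicit Types L C e M rho A B P N : R.

Lemma linear_coefficient_ge0 L C e : 0 < e ->
  (forall t, 0 < t < e -> 0 <= t * L + t ^+ 2 * C) -> 0 <= L.
Proof.
move=> e0 H; rewrite leNgt; apply/negP => L0.
have C1 : 0 < 2 * (`|C| + 1) by rewrite mulr_gt0// addr_gt0// normr_ge0.
(* Small enough that t |C| <= - L / 2; then L + t C is still negative. *)
pose t := Num.min (e / 2) (- L / (2 * (`|C| + 1))).
have t0 : 0 < t by rewrite lt_min !divr_gt0// oppr_gt0.
have te : t < e by rewrite gt_min ltr_pdivrMr// ltr_pMr// ltr1n.
have := H t; rewrite t0 te => /(_ isT).
have tL : t * (2 * (`|C| + 1)) <= - L by rewrite -ler_pdivlMr// ge_min lexx orbT.
have CC := ler_norm C; rewrite expr2 -mulrA -mulrDr pmulr_rge0// => h.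
have : t * C <= t * `|C| by rewrite ler_pM2l.
lra.
Qed.

(* The curve [u -> (x u + t v) / D], [x = 1 - k t^2 - b t], [D = 1 + k t^2], stays on the sphere
   of radius [M] when [b = B / M] and [4 k M = P - B^2 / M]; its expansion at [t = 0] gives the
   stationarity condition. *)
Lemma sphere_stationary M rho A B P GP PP N NP : 0 < M -> 0 <= A -> A < rho -> B ^+ 2 <= M * P ->
  (forall a c, a ^+ 2 * M + 2 * a * c * B + c ^+ 2 * P = M ->
     a ^+ 2 * A + 2 * a * c * GP + c ^+ 2 * PP < rho ->
     0 <= 2^-1 * ((a ^+ 2 - 1) * A + 2 * a * c * GP + c ^+ 2 * PP) - (a - 1) * N - c * NP) ->
  0 <= GP - NP - (A - N) / M * B.
Proof.
move=> M0 A0 Arho BP H; have Mn0 := lt0r_neq0 M0.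
have [b BE] : exists b, B = b * M by exists (B / M); rewrite divfK.
have [k k0 PE] : exists2 k, 0 <= k & P = 4 * k * M + b ^+ 2 * M.
  exists ((P - b ^+ 2 * M) / (4 * M)); last by field.
  apply: divr_ge0; last by rewrite mulr_ge0// ltW.
  by rewrite subr_ge0 -(ler_pM2l M0); move: BP; rewrite BE exprMn mulrCA expr2 !mulrA.
(* For t <= 1, [X] bounds |x|, and A + t W bounds the numerator of the energy along the curve. The
   choice of [e] keeps this below rho, and dividing by D^2 >= 1 preserves the bound. *)
pose X := 1 + k + `|b|; pose W := (k + `|b|) * (X + 1) * A + 2 * X * `|GP| + `|PP|.
have bn := normr_ge0 b; have X0 : 0 <= X by rewrite !addr_ge0.
have W0 : 0 <= W by rewrite !addr_ge0 ?mulr_ge0 ?addr_ge0.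
pose e := Num.min 1 ((rho - A) / (W + 1)).
have e0 : 0 < e by rewrite lt_min ltr01 divr_gt0 ?subr_gt0// ltr_wpDl.
(* Coefficients of t^2, t^3 and t^4 in the energy increment multiplied by D^2; its linear
   coefficient is the quantity to be shown nonnegative. *)
pose z0 := (- (2 * k) + b ^+ 2 / 2) * A - b * GP + PP / 2 + 2 * k * N.
pose z1 := k * b * A - k * GP + k * b * N - k * NP; pose z2 := 2 * k ^+ 2 * N.
apply: (@linear_coefficient_ge0 _ (`|z0| + `|z1| + `|z2|) e) => // t /andP[t0 te].
have t1 : t <= 1 by move: te; rewrite lt_min => /andP[/ltW].
have tW : t * (W + 1) < rho - A.
  by move: te; rewrite lt_min => /andP[_]; rewrite ltr_pdivlMr// ltr_wpDl.
pose x := 1 - k * t ^+ 2 - b * t; pose D := 1 + k * t ^+ 2.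
have kt0 : 0 <= k * t ^+ 2 by rewrite mulr_ge0// sqr_ge0.
have D1 : 1 <= D by rewrite lerDl.
have Dn0 : D != 0 by rewrite gt_eqF// (lt_le_trans ltr01).
have D20 : 0 < D ^+ 2 by rewrite exprn_gt0// (lt_le_trans ltr01).
have := H (x / D) (t / D).
have -> : (x / D) ^+ 2 * M + 2 * (x / D) * (t / D) * B + (t / D) ^+ 2 * P = M.
  by rewrite BE PE /x; apply: (mulIf (lt0r_neq0 D20)); rewrite /D; field; exact: Dn0.
move=> /(_ erefl).
have numE : (x / D) ^+ 2 * A + 2 * (x / D) * (t / D) * GP + (t / D) ^+ 2 * PP =
    (x ^+ 2 * A + 2 * x * t * GP + t ^+ 2 * PP) / D ^+ 2 by field.
have tt : t ^+ 2 <= t by rewrite expr2 ler_piMr// ltW.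
have bt : `|b * t| <= `|b| * t by rewrite normrM (gtr0_norm t0).
have xB : `|x - 1| <= (k + `|b|) * t.
  have -> : x - 1 = - (k * t ^+ 2 + b * t) by rewrite /x; ring.
  rewrite normrN; apply: (le_trans (ler_normD _ _)); rewrite mulrDl; apply: lerD => //.
  by rewrite ger0_norm// ler_wpM2l.
have xX : `|x| <= X.
  have -> : x = 1 + (x - 1) by ring.
  apply: (le_trans (ler_normD _ _)); rewrite normr1 /X -[1 + k + _]addrA lerD2l; apply: (le_trans xB).
  by rewrite ler_piMr// addr_ge0.
have num : x ^+ 2 * A + 2 * x * t * GP + t ^+ 2 * PP < rho.
  have h1 : (x - 1) * (x + 1) * A <= t * ((k + `|b|) * (X + 1) * A).
    apply: (le_trans (ler_norm _)); rewrite !normrM (ger0_norm A0) !mulrA; apply: ler_wpM2r => //.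
    rewrite [t * _]mulrC; apply: ler_pM => //.
    by rewrite (le_trans (ler_normD _ _))// normr1 lerD2r.
  have h2 : 2 * x * t * GP <= t * (2 * X * `|GP|).
    apply: (le_trans (ler_norm _)); rewrite !normrM (gtr0_norm t0) normr_nat.
    rewrite -!mulrA [`|x| * _]mulrCA !mulrA [t * 2]mulrC.
    by rewrite ler_wpM2r// ler_wpM2l// mulr_ge0// ltW.
  have h3 : t ^+ 2 * PP <= t * `|PP|.
    apply: (@le_trans _ _ (t ^+ 2 * `|PP|)); first by rewrite ler_wpM2l ?sqr_ge0 ?ler_norm.
    by rewrite ler_wpM2r.
  have : x ^+ 2 * A = A + (x - 1) * (x + 1) * A by ring.
  move: tW; rewrite /W; lra.
move=> H'; have {H'} : 0 <= 2^-1 * (((x / D) ^+ 2 - 1) * A + 2 * (x / D) * (t / D) * GP +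
    (t / D) ^+ 2 * PP) - (x / D - 1) * N - t / D * NP.
  apply: H'; rewrite numE ltr_pdivrMr//; apply: (lt_le_trans num).
  by apply: ler_peMr; [exact: le_trans A0 (ltW Arho)|exact: exprn_ege1].
rewrite -(pmulr_lge0 _ D20) => h; apply: (le_trans h).
have -> : (2^-1 * (((x / D) ^+ 2 - 1) * A + 2 * (x / D) * (t / D) * GP + (t / D) ^+ 2 * PP)
    - (x / D - 1) * N - t / D * NP) * D ^+ 2 =
    2^-1 * (x ^+ 2 * A - D ^+ 2 * A + 2 * x * t * GP + t ^+ 2 * PP) - (x - D) * D * N - t * D * NP.
  by field.
have -> : 2^-1 * (x ^+ 2 * A - D ^+ 2 * A + 2 * x * t * GP + t ^+ 2 * PP) - (x - D) * D * N
    - t * D * NP = t * (GP - NP - (A - N) / M * B) + t ^+ 2 * (z0 + z1 * t + z2 * t ^+ 2).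
  by rewrite BE /x /D /z0 /z1 /z2; field.
rewrite lerD2l ler_wpM2l ?sqr_ge0//.
have n1 : z1 * t <= `|z1|.
  by rewrite (le_trans (ler_norm _))// normrM (gtr0_norm t0) ler_piMr.
have n2 : z2 * t ^+ 2 <= `|z2|.
  apply: (le_trans (ler_norm _)); rewrite normrM [`|t ^+ 2|]ger0_norm ?sqr_ge0//.
  by rewrite ler_piMr// (le_trans tt).
by rewrite !lerD// ler_norm.
Qed.

(** Equality comes from [sphere_stationary] for a direction v and for -v, which changes the signs of
    B, GP and NP. For a minimizer u of mass M: A = int |grad u|^2, B = int u v, P = int v^2, GP =
    int grad u . grad v, PP = int |grad v|^2, N = int f(u) u and NP = int f(u) v. *)
Lemma sphere_critical M rho A B P GP PP N NP : 0 < M -> 0 <= A -> A < rho -> B ^+ 2 <= M * P ->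
  (forall a c, a ^+ 2 * M + 2 * a * c * B + c ^+ 2 * P = M ->
     a ^+ 2 * A + 2 * a * c * GP + c ^+ 2 * PP < rho ->
     0 <= 2^-1 * ((a ^+ 2 - 1) * A + 2 * a * c * GP + c ^+ 2 * PP) - (a - 1) * N - c * NP) ->
  GP = (A - N) / M * B + NP.
Proof.
move=> M0 A0 Arho BP H; apply/eqP; rewrite eq_le -subr_ge0 andbC -subr_ge0.
have := sphere_stationary M0 A0 Arho BP H.
have : 0 <= - GP - (- NP) - (A - N) / M * (- B).
  apply: (@sphere_stationary M rho A (- B) P (- GP) PP N (- NP)) => //.
    by rewrite sqrrN.
  move=> a c e1 e2; have := H a (- c).
  rewrite sqrrN !mulrN !mulNr !opprK in e1 e2 *; exact.
by move=> h1 h2; apply/andP; split; lra.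
Qed.

End sphere.

(** * Expansion of mass and energy on linear combinations *)

Section quadratic_forms.
Context {R : realType} {n : nat}.
Variable Omega : set 'rV[R]_n.
Hypotheses (openO : open Omega) (boundedO : bounded_set Omega).
Implicit Types (u v phi psi : 'rV[R]_n -> R) (G H : 'I_n -> 'rV[R]_n -> R).
Local Notation mu := (@lebesgue_row R n).
Local Notation tf := (test_function Omega).
Local Notation winteg := (weight_integrable mu Omega).

Let mO : measurable Omega := measurable_domain openO.

Let le22 : 2 <= 2 :> R. Proof. by []. Qed.

Lemma integral_lincomb_sqr a u b v : winteg 2 u -> winteg 2 v ->
  \int[mu]_(x in Omega) lincomb a u b v x ^+ 2 =
  a ^+ 2 * \int[mu]_(x in Omega) u x ^+ 2 + 2 * a * b * \int[mu]_(x in Omega) (u x * v x) +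
  b ^+ 2 * \int[mu]_(x in Omega) v x ^+ 2.
Proof.
move=> iu iv.
have i1 := weight2_integrable_sqr openO iu.
have i2 := weight2_integrable_sqr openO iv.
have i3 := (weight2_integrable_mul openO iu iv).1.
rewrite -(RintegralZl (a ^+ 2) mO i1) -(RintegralZl (2 * a * b) mO i3).
rewrite -(RintegralZl (b ^+ 2) mO i2).
have j1 := integrableZl mO (a ^+ 2) i1; have j2 := integrableZl mO (b ^+ 2) i2.
have j3 := integrableZl mO (2 * a * b) i3.
rewrite -(RintegralD mO j1 j3) -(RintegralD mO (integrableD mO j1 j3) j2).
by apply: eq_Rintegral => x _; rewrite /lincomb; ring.
Qed.

Lemma dirichlet_form_lincomb a G b H : (forall i, winteg 2 (G i)) -> (forall i, winteg 2 (H i)) ->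
  dirichlet_form Omega (fun i => lincomb a (G i) b (H i)) (fun i => lincomb a (G i) b (H i)) =
  a ^+ 2 * dirichlet_form Omega G G + 2 * a * b * dirichlet_form Omega G H +
  b ^+ 2 * dirichlet_form Omega H H.
Proof.
move=> iG iH.
have iL i : winteg 2 (lincomb a (G i) b (H i)).
  by apply: (weight_integrableD mO le22); apply: (weight_integrableZ mO le22).
rewrite (dirichlet_formE openO iL iL) (dirichlet_formE openO iG iG).
rewrite (dirichlet_formE openO iG iH) (dirichlet_formE openO iH iH).
rewrite !mulr_sumr -!big_split/=; apply: eq_bigr => i _.
have sqrE (w : 'rV[R]_n -> R) :
    \int[mu]_(x in Omega) w x ^+ 2 = \int[mu]_(x in Omega) (w x * w x).
  by apply: eq_Rintegral => x _; rewrite expr2.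
by rewrite -!sqrE; exact: integral_lincomb_sqr.
Qed.

Lemma energy_form phi : tf phi ->
  energy Omega phi = dirichlet_form Omega (fun i => partial i phi) (fun i => partial i phi).
Proof.
by move=> tp; apply: eq_Rintegral => x _; apply: eq_bigr => i _; rewrite expr2.
Qed.

Lemma energy_lincomb a phi b psi : tf phi -> tf psi ->
  energy Omega (lincomb a phi b psi) = a ^+ 2 * energy Omega phi +
    2 * a * b * dirichlet_form Omega (fun i => partial i phi) (fun i => partial i psi) +
    b ^+ 2 * energy Omega psi.
Proof.
move=> tp ts; rewrite !energy_form//; last exact: test_function_lincomb.
have ip i := tf_weight_integrable_partial openO boundedO i le22 tp.
have is_ i := tf_weight_integrable_partial openO boundedO i le22 ts.
rewrite -(dirichlet_form_lincomb a b ip is_); congr dirichlet_form;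
  by apply/funext => i; apply/funext => x; rewrite (partial_tf_lincomb _ _ _ _ tp ts).
Qed.

End quadratic_forms.

(** * Existence of a minimizer and its equation *)

Section minimization.
Context {R : realType} {n : nat}.
Variable Omega : set 'rV[R]_n.
Hypotheses (openO : open Omega) (boundedO : bounded_set Omega) (n0 : (0 < n)%N).
Variable p : R.
Hypotheses (p2 : 2 <= p) (crit : (n%:R - 2) * (p - 2) < 4).
Implicit Types (u v w phi psi : 'rV[R]_n -> R) (G H : 'I_n -> 'rV[R]_n -> R).
Local Notation mu := (@lebesgue_row R n).
Local Notation tf := (test_function Omega).
Local Notation Iw q u := (\int[mu]_(x in Omega) weight q (u x)).
Local Notation winteg := (weight_integrable mu Omega).
Local Notation en := (energy Omega).
Local Notation mass u := (\int[mu]_(x in Omega) u x ^+ 2).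
Local Notation gradient phi := (fun i => partial i phi).

Let mO : measurable Omega := measurable_domain openO.

Let le22 : 2 <= 2 :> R. Proof. by []. Qed.

Lemma energy_sub_le phi psi : tf phi -> tf psi ->
  en (lincomb 1 phi (-1) psi) <= 2 * (en phi + en psi).
Proof.
move=> tp ts; have := energy_ge0 Omega (lincomb 1 phi 1 psi).
rewrite !(energy_lincomb openO boundedO _ _ tp ts).
move: (dirichlet_form _ _ _) (en phi) (en psi) => D a b; lra.
Qed.

(** The averages of [small_of_averages] are finitely many linear functionals, bounded on S by
    [sqr_avg_le] and [poincare]. Once their ranges are cut into strips, that lemma applies to the
    differences, of energy at most 4 B, for the exponents 2 and p with e / 2 each. *)
Lemma compact_minimizing (E : ('rV[R]_n -> R) -> R) m S B e : 0 < e ->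
  (forall phi, S phi -> tf phi /\ en phi <= B) -> minimizing E m S ->
  exists S', [/\ S' `<=` S, minimizing E m S' &
    forall phi psi, S' phi -> S' psi -> Iw p (fun x => phi x - psi x) <= e].
Proof.
move=> e0 SB minS; have e20 : 0 < e / 2 by rewrite divr_gt0.
have [|s2 [eta2 [eta20 H2]]] := small_of_averages openO boundedO (4 * B) le22 _ e20.
  by rewrite subrr mulr0.
have [sp [etap [etap0 Hp]]] := small_of_averages openO boundedO (4 * B) p2 crit e20.
have [C C0 HC] := poincare openO boundedO n0.
have bnd (z : nat * 'rV[R]_n) : exists L, forall phi, S phi -> `|avg z.1 phi z.2| <= L.
  exists ((2 ^+ z.1) ^+ n * (C * B) + 1) => phi /SB[tp pB].
  have h : avg z.1 phi z.2 ^+ 2 <= (2 ^+ z.1) ^+ n * (C * B).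
    apply: (le_trans (sqr_avg_le openO boundedO _ _ tp)).
    apply: ler_wpM2l; first by rewrite exprn_ge0// exprn_ge0.
    by apply: (le_trans (HC _ tp)); exact: ler_wpM2l.
  move: h; rewrite -(real_normK (num_real (avg _ _ _))).
  move: `|_| (_ * (C * B)) => a b; nra.
have eta0 : 0 < Num.min eta2 etap by rewrite lt_min eta20.
have [S' [S'S minS' clS']] := minimizing_functionals (s2 ++ sp) eta0 bnd minS.
exists S'; split => // phi psi Sphi Spsi.
have [[tp pB] [ts sB]] := (SB _ (S'S _ Sphi), SB _ (S'S _ Spsi)).
have tl := test_function_lincomb 1 (-1) tp ts.
have lB : en (lincomb 1 phi (-1) psi) <= 4 * B.
  apply: (le_trans (energy_sub_le tp ts)).
    by move: (en phi) (en psi) pB sB => x y xB yB; lra.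
have small z : z \in s2 ++ sp -> `|avg z.1 (lincomb 1 phi (-1) psi) z.2| <= Num.min eta2 etap.
  move=> zs; rewrite (avg_lincomb _ _ _ _ tp ts) mul1r mulN1r.
  exact: clS'.
have -> : Iw p (fun x => phi x - psi x) = Iw p (lincomb 1 phi (-1) psi).
  by apply: eq_Rintegral => x _; rewrite /lincomb mul1r mulN1r.
have i2 := tf_integrable_sqr openO boundedO tl.
have p0 : 0 <= p by exact: le_trans p2.
have ip := tf_integrable_powR openO boundedO p0 tl.
rewrite (RintegralD mO i2 ip) [leRHS](splitr e); apply: lerD.
  have -> : \int[mu]_(x in Omega) lincomb 1 phi (-1) psi x ^+ 2 =
      \int[mu]_(x in Omega) `|lincomb 1 phi (-1) psi x| `^ 2.
    by apply: eq_Rintegral => x _; rewrite powR_mulrn// real_normK// num_real.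
  apply: H2 => // z zs; apply: (le_trans (small z _)).
    by rewrite mem_cat zs.
  by rewrite ge_min lexx.
apply: Hp => // z zs; apply: (le_trans (small z _)).
  by rewrite mem_cat zs orbT.
by rewrite ge_min lexx orbT.
Qed.

Lemma cvg_normalizer (M : R) (q : nat -> R) : 0 < M -> q k @[k --> \oo] --> M ->
  let s (k : nat) : R := Num.sqrt (M / q k) in
  [/\ s k @[k --> \oo] --> (1 : R), s k ^+ 2 @[k --> \oo] --> (1 : R) &
      \forall k \near \oo, s k ^+ 2 * q k = M].
Proof.
move=> M0 qM s.
have s1 : s k @[k --> \oo] --> (1 : R).
  rewrite -[X in _ --> X](@sqrtr1 R) -(divff (lt0r_neq0 M0)).
  apply: (@continuous_cvg _ _ _ _ _ _ (@Num.sqrt R)); first exact: sqrt_continuous.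
  by apply: cvgM; [exact: cvg_cst|apply: cvgV => //; exact: lt0r_neq0].
split => //.
  by rewrite -[X in _ --> X](@expr1n R 2); under eq_fun do rewrite expr2; exact: cvgM.
have : \forall k \near \oo, 0 < q k by exact: (cvgr_gt M qM).
apply: filterS => k q0; rewrite sqr_sqrtr ?divr_ge0 ?ltW//.
by rewrite divfK// lt0r_neq0.
Qed.

Lemma weight_integral_energy_bound : exists2 C : R -> R, (forall B, 0 <= C B) &
  forall B phi, tf phi -> en phi <= B -> Iw p phi <= C B.
Proof.
have [C C0 HC] := sobolev_weight openO boundedO n0 p2 crit.
exists (fun B => C * weight p (Num.sqrt B)) => [B|B phi tp pB].
  by rewrite mulr_ge0// weight_ge0.
apply: (le_trans (HC _ tp)); apply: ler_wpM2l => //; apply: weight_le.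
  exact: le_trans p2.
by rewrite !ger0_norm ?sqrtr_ge0// ler_wsqrtr.
Qed.

Section functional.
Variables (K : R) (F : R -> R).
Hypothesis FK : growth_control p F K.

Definition functional phi := 2^-1 * en phi - \int[mu]_(x in Omega) F (phi x).

Variables (M rho m : R).
Hypotheses (M0 : 0 < M)
  (m_le : forall phi, tf phi -> mass phi = M -> en phi < rho -> m <= functional phi).

(* With [w = (phi + psi) / 2], [en w = (en phi + en psi) / 2 - en (phi - psi) / 4]; once [w] is
   rescaled to the sphere, [m <= functional w] bounds the last term. *)
Lemma minimizers_close rho' eps : 0 <= rho' < rho -> 0 < eps ->
  exists2 delta, 0 < delta & forall phi psi, tf phi -> tf psi ->
    mass phi = M -> mass psi = M -> en phi <= rho' -> en psi <= rho' ->
    functional phi < m + delta -> functional psi < m + delta ->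
    Iw p (fun x => phi x - psi x) <= delta ->
    en (lincomb 1 phi (-1) psi) <= eps.
Proof.
move=> /andP[rho'0 rho'_lt] eps0; apply: contrapT => no.
(* The failure of each delta = 1 / (k + 1) produces two sequences, so that the errors due to
   rescaling are treated as limits and not by explicit estimates. *)
have bad k : exists z : ('rV[R]_n -> R) * ('rV[R]_n -> R),
    [/\ tf z.1 /\ tf z.2, mass z.1 = M /\ mass z.2 = M, en z.1 <= rho' /\ en z.2 <= rho',
     functional z.1 < m + k.+1%:R^-1 /\ functional z.2 < m + k.+1%:R^-1 &
     Iw p (fun x => z.1 x - z.2 x) <= k.+1%:R^-1 /\ eps < en (lincomb 1 z.1 (-1) z.2)].
  apply: contrapT => nobad; apply: no; exists k.+1%:R^-1; first by rewrite invr_gt0.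
  move=> phi psi tp ts mp ms ep es fp fs d; rewrite leNgt; apply/negP => bad.
  apply: nobad; exists (phi, psi).
  exact: (And5 (conj tp ts) (conj mp ms) (conj ep es) (conj fp fs) (conj d bad)).
have {bad no}/choice[z Hz] := bad.
pose phi k := (z k).1; pose psi k := (z k).2.
have tp k : tf (phi k) by case: (Hz k) => [[h _] _ _ _ _]; exact: h.
have ts k : tf (psi k) by case: (Hz k) => [[_ h] _ _ _ _]; exact: h.
have mp k : mass (phi k) = M by case: (Hz k) => [_ [h _] _ _ _]; exact: h.
have ms k : mass (psi k) = M by case: (Hz k) => [_ [_ h] _ _ _]; exact: h.
have ep k : en (phi k) <= rho' by case: (Hz k) => [_ _ [h _] _ _]; exact: h.
have es k : en (psi k) <= rho' by case: (Hz k) => [_ _ [_ h] _ _]; exact: h.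
have fp k : functional (phi k) < m + k.+1%:R^-1 by case: (Hz k) => [_ _ _ [h _] _]; exact: h.
have fs k : functional (psi k) < m + k.+1%:R^-1 by case: (Hz k) => [_ _ _ [_ h] _]; exact: h.
have dle k : Iw p (fun x => phi k x - psi k x) <= k.+1%:R^-1 by case: (Hz k) => [_ _ _ _ [h _]]; exact: h.
have ed k : eps < en (lincomb 1 (phi k) (-1) (psi k)) by case: (Hz k) => [_ _ _ _ [_ h]]; exact: h.
have inv0 : k.+1%:R^-1 @[k --> \oo] --> (0 : R) by exact: cvg_harmonic.
have ip k := tf_weight_integrable openO boundedO p2 (tp k).
have is_ k := tf_weight_integrable openO boundedO p2 (ts k).
have ip2 k := tf_weight_integrable openO boundedO le22 (tp k).
have is2 k := tf_weight_integrable openO boundedO le22 (ts k).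
have id k := weight_integrableB mO p2 (ip k) (is_ k).
have d0 : Iw p (fun x => phi k x - psi k x) @[k --> \oo] --> 0.
  by apply: (@squeeze_scale _ 1 _ (fun k => k.+1%:R^-1)) => // k; rewrite weight_integral_ge0 mul1r dle.
pose q k := mass (lincomb 2^-1 (phi k) 2^-1 (psi k)).
have qE k : q k = M - 4^-1 * mass (fun x => phi k x - psi k x).
  have -> : mass (fun x => phi k x - psi k x) = mass (lincomb 1 (phi k) (-1) (psi k)).
    by apply: eq_Rintegral => x _; rewrite /lincomb mul1r mulN1r.
  rewrite /q !(integral_lincomb_sqr openO _ _ (ip2 k) (is2 k)) mp ms.
  by move: (Rintegral _ _ _) => D; field.
have md0 : mass (fun x => phi k x - psi k x) @[k --> \oo] --> 0.
  apply: (@squeeze_scale _ 1 _ (fun k => Iw p (fun x => phi k x - psi k x))) => // k.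
  rewrite mul1r (integral_sqr_le_weight openO p2 (id k)) andbT.
  by apply: Rintegral_ge0 => x _; exact: sqr_ge0.
have qM : q k @[k --> \oo] --> M.
  rewrite (_ : (fun k => q k) = (fun k => M - 4^-1 * mass (fun x => phi k x - psi k x)));
    last exact/funext.
  rewrite -[X in _ --> X]subr0; apply: cvgB; first exact: cvg_cst.
  by rewrite -[X in _ --> X](mulr0 4^-1); exact: cvg_scale.
have [s1 s21 sq] := cvg_normalizer M0 qM.
set s := fun k => Num.sqrt (M / q k) in s1 s21 sq.
pose v k := lincomb (s k / 2) (phi k) (s k / 2) (psi k).
have tv k : tf (v k) by exact: test_function_lincomb.
have iv k := tf_weight_integrable openO boundedO p2 (tv k).
have mv : \forall k \near \oo, mass (v k) = M.
  move: sq; apply: filterS => k h; transitivity (s k ^+ 2 * q k); last exact: h.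
  rewrite /q !(integral_lincomb_sqr openO _ _ (ip2 k) (is2 k)).
  by move: (s k) (Rintegral _ _ _) => t D; field.
have ev k : en (v k) = s k ^+ 2 * (2^-1 * (en (phi k) + en (psi k)) -
    4^-1 * en (lincomb 1 (phi k) (-1) (psi k))).
  rewrite !(energy_lincomb openO boundedO _ _ (tp k) (ts k)).
  by move: (s k) (en _) (en _) (dirichlet_form _ _ _) => t a b D; field.
have s2rho : \forall k \near \oo, s k ^+ 2 * rho' < rho.
  apply: (cvgr_lt rho'); last by [].
  by rewrite -[X in _ --> X](mul1r rho'); apply: cvgM => //; exact: cvg_cst.
have [C C0 HC] := weight_integral_energy_bound.
pose w k := lincomb 2^-1 (phi k) 2^-1 (psi k).
have tw k : tf (w k) by exact: test_function_lincomb.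
have iw k := tf_weight_integrable openO boundedO p2 (tw k).
have ew k : en (w k) <= rho'.
  have -> : en (w k) = 2^-1 * (en (phi k) + en (psi k)) -
      4^-1 * en (lincomb 1 (phi k) (-1) (psi k)).
    rewrite !(energy_lincomb openO boundedO _ _ (tp k) (ts k)).
    by move: (en _) (en _) (dirichlet_form _ _ _) => a b D; field.
  have := ep k; have := es k; have := ed k.
  move: (en (phi k)) (en (psi k)) (en (lincomb _ _ _ _)) => a b c; have := eps0; lra.
have s10 : s k - 1 @[k --> \oo] --> 0.
  by rewrite -[X in _ --> X](subrr 1); apply: cvgB => //; exact: cvg_cst.
(* [v] is the midpoint [w] put back on the sphere. Its difference with phi or psi is (s - 1) w, with
   s -> 1 and w bounded, plus -1/2 or 1/2 times phi - psi; both parts vanish for the modular. *)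
have close (c : R) (g : nat -> 'rV[R]_n -> R) : (forall k, tf (g k)) -> (forall k, en (g k) <= rho') ->
    (forall k x, v k x - g k x = (s k - 1) * w k x + c * (phi k x - psi k x)) ->
    (\int[mu]_(x in Omega) F (v k x) - \int[mu]_(x in Omega) F (g k x)) @[k --> \oo] --> 0.
  move=> tg eg vg; have ig k := tf_weight_integrable openO boundedO p2 (tg k).
  apply: (@cvg_integral_growth_control _ _ _ mu Omega p mO p2 F K (C rho') g v FK ig iv).
    by move=> k; exact: HC.
  under eq_fun do under eq_Rintegral do rewrite vg.
  apply: (@cvg_weight_integralD _ _ _ openO p (fun k x => (s k - 1) * w k x)
    (fun k x => c * (phi k x - psi k x)) p2).
  - by move=> k; exact: (weight_integrableZ mO p2).
  - by move=> k; exact: (weight_integrableZ mO p2).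
  - exact: (cvg_weight_integralZ openO p2 iw (fun k => HC _ _ (tw k) (ew k)) s10).
  - apply: (@squeeze_scale _ (weight p c) _ (fun k => Iw p (fun x => phi k x - psi k x))) => //.
    by move=> k; rewrite weight_integral_ge0 (weight_integralZ openO _ p2 (id k)).
have c1 := close (- 2^-1) phi tp ep; have c2 := close 2^-1 psi ts es.
have {}c1 : (\int[mu]_(x in Omega) F (v k x) - \int[mu]_(x in Omega) F (phi k x)) @[k --> \oo] --> 0.
  by apply: c1 => k x; rewrite /v /w /lincomb; field.
have {}c2 : (\int[mu]_(x in Omega) F (v k x) - \int[mu]_(x in Omega) F (psi k x)) @[k --> \oo] --> 0.
  by apply: c2 => k x; rewrite /v /w /lincomb; field.
(* The half-sum of the two almost-minimality inequalities, compared with [m <= functional (v k)],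
   forces r k > 0, while r tends to - eps / 8. *)
pose r k := `|s k ^+ 2 - 1| * (rho' / 2) + k.+1%:R^-1
  - 2^-1 * (\int[mu]_(x in Omega) F (v k x) - \int[mu]_(x in Omega) F (phi k x))
  - 2^-1 * (\int[mu]_(x in Omega) F (v k x) - \int[mu]_(x in Omega) F (psi k x))
  - s k ^+ 2 * (eps / 8).
have rlim : r k @[k --> \oo] --> `|1 - 1| * (rho' / 2) + 0 - 2^-1 * 0 - 2^-1 * 0 - 1 * (eps / 8).
  apply: cvgB; last by apply: cvgM => //; exact: cvg_cst.
  apply: cvgB; last exact: cvg_scale.
  apply: cvgB; last exact: cvg_scale.
  apply: cvgD => //; apply: cvgM; last exact: cvg_cst.
  by apply: cvg_norm; apply: cvgB => //; exact: cvg_cst.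
have rneg : \forall k \near \oo, r k < 0.
  apply: (cvgr_lt _ rlim); rewrite subrr normr0 mul0r !mulr0 mul1r !subr0 addr0 add0r oppr_lt0.
  by rewrite divr_gt0.
have [k _ /(_ k (leqnn k)) []] := filterI (filterI mv s2rho) rneg.
move=> [mvk srk] rk.
have evk : en (v k) < rho.
  apply: le_lt_trans srk; rewrite ev; apply: ler_wpM2l; first exact: sqr_ge0.
  have := ep k; have := es k; have := ed k.
  move: (en (phi k)) (en (psi k)) (en (lincomb _ _ _ _)) => a b c; have := eps0; lra.
have := m_le (tv k) mvk evk; have := fp k; have := fs k; have := ed k; have := ep k; have := es k.
have := energy_ge0 Omega (phi k); have := energy_ge0 Omega (psi k).
move: rk; rewrite /r /functional ev.
move: (en (phi k)) (en (psi k)) (en (lincomb _ _ _ _)) (Rintegral _ _ _) (Rintegral _ _ _)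
  (Rintegral _ _ _) (k.+1%:R^-1) => a b c IV IP IS dk.
have := ler_norm (s k ^+ 2 - 1); have := normr_ge0 (s k ^+ 2 - 1); have := sqr_ge0 (s k).
move: (s k ^+ 2) => t; move: `|_| => tn t0 tn0 tle.
move=> h1 b0 a0 bB aB ec h2 h3 h4.
have e1 : (t - 1) * (a + b) <= tn * (2 * rho').
  apply: (@le_trans _ _ (tn * (a + b))); first by apply: ler_wpM2r => //; exact: addr_ge0.
  by apply: ler_wpM2l => //; lra.
have e2 : t * eps <= t * c by apply: ler_wpM2l => //; exact: ltW.
lra.
Qed.

(** Nested minimizing sets with values below m + d_k and modular diameter at most d_k: any choice of
    one element in each is Cauchy, in L^2 because d_k <= 8^-k and in energy because d_k is at most
    the delta of [minimizers_close] for 8^-k. *)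
Lemma minimizing_sequence rho' S : 0 <= rho' < rho ->
  (forall phi, S phi -> [/\ tf phi, mass phi = M & en phi <= rho']) ->
  minimizing functional m S ->
  exists (phi_ : nat -> 'rV[R]_n -> R) u G, [/\ strong_limit Omega p phi_ u G,
    forall k, S (phi_ k) & functional (phi_ k) @[k --> \oo] --> m].
Proof.
move=> rho'P SP minS.
have e8 k : 0 < 8 ^- k :> R by rewrite invr_gt0 exprn_gt0.
have /choice[delta Hdelta] : forall k, exists delta, 0 < delta /\
    forall phi psi, S phi -> S psi ->
      functional phi < m + delta -> functional psi < m + delta ->
      Iw p (fun x => phi x - psi x) <= delta -> en (lincomb 1 phi (-1) psi) <= 8 ^- k.
  move=> k; have [d d0 Hd] := minimizers_close rho'P (e8 k).
  exists d; split => // phi psi /SP[tp mp ep] /SP[ts ms es]; exact: Hd.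
pose d k := Num.min (delta k) (8 ^- k).
have d0 k : 0 < d k by rewrite lt_min (Hdelta k).1 e8.
pose P (A : set ('rV[R]_n -> R)) := A `<=` S /\ minimizing functional m A.
pose Q k A A' := [/\ P A', A' `<=` A, forall phi, A' phi -> functional phi < m + d k &
  forall phi psi, A' phi -> A' psi -> Iw p (fun x => phi x - psi x) <= d k].
(* The premise stands under the existential, so that choice yields a total function which the [fix]
   below can iterate. *)
have step (z : nat * set ('rV[R]_n -> R)) : exists A', P z.2 -> Q z.1 z.2 A'.
  case: z => k A /=; case: (pselect (P A)) => [[AS minA]|nP]; last by exists set0.
  have [|A1 [A1A minA1 clA1]] := @compact_minimizing functional m A rho' (d k) (d0 k) _ minA.
    by move=> phi /AS /SP[].
  exists (A1 `&` [set phi | functional phi < m + d k]) => _; split.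
  - split; first by move=> phi [/A1A /AS].
    exact: minimizing_sublevel.
  - by move=> phi [/A1A].
  - by move=> phi [].
  - by move=> phi psi [Aphi _] [Apsi _]; exact: clA1.
have {step}/choice[g Hg] := step.
pose A := fix A k := if k is j.+1 then g (k, A j) else g (0%N, S).
have PA k : P (A k).
  elim: k => [|k IH]; first by have [] := Hg (0%N, S) (conj (@subset_refl _ S) minS).
  by have [] := Hg (k.+1, A k) IH.
have QA k : (forall phi, A k phi -> functional phi < m + d k) /\
    (forall phi psi, A k phi -> A k psi -> Iw p (fun x => phi x - psi x) <= d k).
  case: k => [|k]; first by have [] := Hg (0%N, S) (conj (@subset_refl _ S) minS).
  by have [] := Hg (k.+1, A k) (PA k).
have ASS k : A k.+1 `<=` A k by have [] := Hg (k.+1, A k) (PA k).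
have Ale k j : (k <= j)%N -> A j `<=` A k.
  elim: j => [|j IH]; first by rewrite leqn0 => /eqP ->.
  by rewrite leq_eqVlt => /orP[/eqP -> //|/IH h]; exact: (subset_trans (@ASS j) h).
have /choice[phi_ Hphi] : forall k, exists phi, A k phi.
  by move=> k; have [phi Aphi _] := (PA k).2 1 ltr01; exists phi.
have Sphi k : S (phi_ k) by exact: (PA k).1.
have tphi k : tf (phi_ k) by have [] := SP _ (Sphi k).
have close k j : (k <= j)%N -> Iw p (fun x => phi_ k x - phi_ j x) <= d k.
  by move=> kj; apply: (QA k).2 => //; exact: (Ale k j kj).
have ip k := tf_weight_integrable openO boundedO p2 (tphi k).
have [||u [G lim]] := cauchy_strong_limit openO boundedO n0 p2 crit tphi.
- move=> k j kj; have ikj := weight_integrableB mO p2 (ip k) (ip j).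
  apply: (le_trans (integral_sqr_le_weight openO p2 ikj)).
  by apply: (le_trans (close k j kj)); rewrite ge_min lexx orbT.
- move=> k j kj; have dl : d k <= delta k by rewrite ge_min lexx.
  have Ej : functional (phi_ j) < m + d k by apply: (QA k).1; exact: (Ale k j kj).
  have Ek : functional (phi_ k) < m + d k by exact: (QA k).1.
  apply: ((Hdelta k).2 _ _ (Sphi k) (Sphi j)).
  + by apply: (lt_le_trans Ek); rewrite lerD2l.
  + by apply: (lt_le_trans Ej); rewrite lerD2l.
  + exact: (le_trans (close k j kj)).
exists phi_, u, G; split => //.
apply/subr_cvg0; apply: (@squeeze_scale _ 1 _ (fun k => 8 ^- k)).
  move=> k; have [tp mp ep] := SP _ (Sphi k); rewrite subr_ge0 mul1r.
  rewrite (m_le tp mp) ?(le_lt_trans ep) ?(andP rho'P).2//= lerBlDl.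
  by apply: (le_trans (ltW ((QA k).1 _ (Hphi k)))); rewrite lerD2l ge_min lexx orbT.
by have := @cvg_inv_expr8 R 1; under eq_fun do rewrite mul1r.
Qed.

Lemma strong_limit_functional (phi_ : nat -> 'rV[R]_n -> R) u G :
  strong_limit Omega p phi_ u G ->
  functional (phi_ k) @[k --> \oo] -->
    2^-1 * dirichlet_form Omega G G - \int[mu]_(x in Omega) F (u x).
Proof.
move=> lim; apply: cvgB; last exact: (strong_limit_control openO boundedO p2 lim FK).
by apply: cvg_scale; exact: (strong_limit_energy openO boundedO lim).
Qed.

(** The competitors a u + c psi of [euler_lagrange] are not test functions. Their approximants are,
    once rescaled to mass M, and the strict inequality with rho survives the approximation. *)
Lemma functional_closure (phi_ : nat -> 'rV[R]_n -> R) v H :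
  strong_limit Omega p phi_ v H -> mass v = M -> dirichlet_form Omega H H < rho ->
  m <= 2^-1 * dirichlet_form Omega H H - \int[mu]_(x in Omega) F (v x).
Proof.
move=> lim mv Hrho; have [tp iv iH v0 H0] := lim.
have ip k := tf_weight_integrable openO boundedO p2 (tp k).
have ip2 k := tf_weight_integrable openO boundedO le22 (tp k).
have qM : mass (phi_ k) @[k --> \oo] --> M.
  by rewrite -mv; exact: (strong_limit_sqr openO boundedO p2 lim).
have [s1 s21 sq] := cvg_normalizer M0 qM.
pose s k := Num.sqrt (M / mass (phi_ k)).
pose w k := lincomb (s k) (phi_ k) 0 (phi_ k).
have tw k : tf (w k) by exact: test_function_lincomb.
have iw k := tf_weight_integrable openO boundedO p2 (tw k).
have mw : \forall k \near \oo, mass (w k) = M.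
  move: sq; apply: filterS => k h; transitivity (s k ^+ 2 * mass (phi_ k)); last exact: h.
  rewrite (integral_lincomb_sqr openO _ _ (ip2 k) (ip2 k)).
  by move: (s k) => t; ring.
have ew k : en (w k) = s k ^+ 2 * en (phi_ k).
  rewrite (energy_lincomb openO boundedO _ _ (tp k) (tp k)).
  by move: (s k) (en _) (dirichlet_form _ _ _) => t a b; ring.
have elim := strong_limit_energy openO boundedO lim.
have ewlim : en (w k) @[k --> \oo] --> dirichlet_form Omega H H.
  rewrite (_ : (fun k => en (w k)) = (fun k => s k ^+ 2 * en (phi_ k))); last exact/funext.
  by rewrite -[X in _ --> X]mul1r; apply: cvgM.
have wlim : Iw p (fun x => w k x - v x) @[k --> \oo] --> 0.
  have wE k x : w k x - v x = (s k - 1) * phi_ k x + (phi_ k x - v x).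
    by rewrite /w /lincomb; ring.
  under eq_fun do under eq_Rintegral do rewrite wE.
  have s10 : s k - 1 @[k --> \oo] --> 0.
    by rewrite -[X in _ --> X](subrr 1); apply: cvgB => //; exact: cvg_cst.
  have [B HB] := cvg_integral_weight_bounded mO p2 iv ip v0.
  apply: (@cvg_weight_integralD _ _ _ openO p (fun k x => (s k - 1) * phi_ k x)
    (fun k x => phi_ k x - v x) p2).
  - by move=> k; exact: (weight_integrableZ mO p2).
  - by move=> k; exact: (weight_integrableB mO p2).
  - exact: (cvg_weight_integralZ openO p2 ip HB s10).
  - exact: v0.
have Flim := @cvg_integral_growth_control1 _ _ _ mu Omega p mO p2 F K v w FK iv iw wlim.
have Elim : functional (w k) @[k --> \oo] -->
    2^-1 * dirichlet_form Omega H H - \int[mu]_(x in Omega) F (v x).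
  by apply: cvgB; [exact: cvg_scale|exact: Flim].
rewrite leNgt; apply/negP => bad.
have n1 : \forall k \near \oo, functional (w k) < m by exact: (cvgr_lt _ Elim _ bad).
have n2 : \forall k \near \oo, en (w k) < rho by exact: (cvgr_lt _ ewlim _ Hrho).
have [k _ /(_ k (leqnn k)) [[h1 h2] h3]] := filterI (filterI n1 n2) mw.
by move: h1; rewrite ltNge => /negP; apply; apply: m_le.
Qed.

Variable f : R -> R.
Hypotheses (f_cont : continuous f) (fK : forall a b, `|f a * b| <= K * growth p a b)
  (F_convex : forall a b, F a + f a * (b - a) <= F b).

Lemma integrable_nonlinearity u v : winteg p u -> winteg p v ->
  mu.-integrable Omega (EFin \o (fun x => f (u x) * v x)).
Proof.
move=> iu iv; apply: (weight_integrable_growth mO p2 (K := K) iu iv) => //.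
apply: measurable_funM; last exact: iv.1.
exact: (measurableT_comp (continuous_measurable_fun f_cont) iu.1).
Qed.

Lemma strong_limit_nonlinearity (phi_ : nat -> 'rV[R]_n -> R) u v H : winteg p u ->
  strong_limit Omega p phi_ v H ->
  \int[mu]_(x in Omega) (f (u x) * phi_ k x) @[k --> \oo] --> \int[mu]_(x in Omega) (f (u x) * v x).
Proof.
move=> iu [tp iv _ v0 _]; apply/subr_cvg0.
have ip k := tf_weight_integrable openO boundedO p2 (tp k).
have id k := weight_integrableB mO p2 (ip k) iv.
under eq_fun do rewrite -(RintegralB mO (integrable_nonlinearity iu (ip _))
  (integrable_nonlinearity iu iv)).
apply: (@cvg_integral_growth _ _ _ mu Omega p mO p2 K (Iw p u) (fun=> u)
  (fun k x => phi_ k x - v x)) => //.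
- move=> k; apply: measurable_funB; apply/measurable_EFinP.
    exact: measurable_int (integrable_nonlinearity iu (ip k)).
  exact: measurable_int (integrable_nonlinearity iu iv).
- by move=> k x _; rewrite -mulrBr.
Qed.

Lemma euler_lagrange (phi_ : nat -> 'rV[R]_n -> R) u G psi :
  strong_limit Omega p phi_ u G -> mass u = M -> dirichlet_form Omega G G < rho ->
  2^-1 * dirichlet_form Omega G G - \int[mu]_(x in Omega) F (u x) = m -> tf psi ->
  dirichlet_form Omega G (gradient psi) =
  (dirichlet_form Omega G G - \int[mu]_(x in Omega) (f (u x) * u x)) / M *
    \int[mu]_(x in Omega) (u x * psi x) + \int[mu]_(x in Omega) (f (u x) * psi x).
Proof.
move=> lim mM Grho um ts; have [_ iu iG _ _] := lim.
have iu2 := weight_integrable2 openO p2 iu.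
have is2 := tf_weight_integrable openO boundedO le22 ts.
have is_ := tf_weight_integrable openO boundedO p2 ts.
have ids i := tf_weight_integrable_partial openO boundedO i le22 ts.
have iN := integrable_nonlinearity iu iu; have iNP := integrable_nonlinearity iu is_.
have iF w : winteg p w -> mu.-integrable Omega (EFin \o (fun x => F (w x))).
  by move=> iw; exact: (growth_control_integrable mO p2 FK iw).
apply: (@sphere_critical _ M rho _ _ (mass psi) _ (dirichlet_form Omega (gradient psi) (gradient psi)))
  => //.
- apply: Rintegral_ge0 => x _; apply: sumr_ge0 => i _; rewrite -expr2; exact: sqr_ge0.
(* Cauchy-Schwarz: the mass of - B u + M psi equals M (M P - B^2). *)
- set B := \int[mu]_(x in Omega) (u x * psi x).
  have : 0 <= mass (lincomb (- B) u M psi).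
    by apply: Rintegral_ge0 => x _; exact: sqr_ge0.
  rewrite (integral_lincomb_sqr openO _ _ iu2 is2) mM -/B.
  move: (mass psi) => P h; rewrite -subr_ge0 -(pmulr_rge0 _ M0).
  by apply: (le_trans h); rewrite le_eqVlt; apply/orP; left; apply/eqP; ring.
- move=> a c hm hrho.
  have limv := strong_limit_lincomb openO boundedO p2 lim a c ts.
  have [_ iv _ _ _] := limv.
  have := functional_closure limv.
  rewrite (integral_lincomb_sqr openO _ _ iu2 is2) mM (dirichlet_form_lincomb openO _ _ iG ids).
  move=> /(_ hm hrho); rewrite -um.
  have iL : mu.-integrable Omega (EFin \o (fun x => f (u x) * (lincomb a u c psi x - u x))).
    exact: (integrable_nonlinearity iu (weight_integrableB mO p2 iv iu)).
  have le1 : \int[mu]_(x in Omega) F (u x) +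
      \int[mu]_(x in Omega) (f (u x) * (lincomb a u c psi x - u x)) <=
      \int[mu]_(x in Omega) F (lincomb a u c psi x).
    rewrite -(RintegralD mO (iF _ iu) iL).
    apply: (le_Rintegral mO (integrableD mO (iF _ iu) iL) (iF _ iv)) => x _.
    exact: F_convex.
  have le2 : \int[mu]_(x in Omega) (f (u x) * (lincomb a u c psi x - u x)) =
      (a - 1) * \int[mu]_(x in Omega) (f (u x) * u x) + c * \int[mu]_(x in Omega) (f (u x) * psi x).
    rewrite -(RintegralZl (a - 1) mO iN) -(RintegralZl c mO iNP).
    rewrite -(RintegralD mO (integrableZl mO (a - 1) iN) (integrableZl mO c iNP)).
    by apply: eq_Rintegral => x _; rewrite /lincomb; ring.
  move: le1; rewrite le2.
  move: (dirichlet_form _ _ _) (dirichlet_form _ _ _) (dirichlet_form _ _ _) (Rintegral _ _ _)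
    (Rintegral _ _ _) (Rintegral _ _ _) (Rintegral _ _ _) => *; lra.
Qed.

Lemma constrained_minimizer rho' S : 0 <= rho' < rho ->
  (forall phi, S phi -> [/\ tf phi, mass phi = M & en phi <= rho']) ->
  minimizing functional m S ->
  exists (phi_ : nat -> 'rV[R]_n -> R) u G, [/\ strong_limit Omega p phi_ u G,
    forall k, S (phi_ k),
    2^-1 * dirichlet_form Omega G G - \int[mu]_(x in Omega) F (u x) = m &
    normalized_solution Omega f M u
      ((dirichlet_form Omega G G - \int[mu]_(x in Omega) (f (u x) * u x)) / M)].
Proof.
move=> rho'P SP minS.
have [phi_ [u [G [lim Sphi Em]]]] := minimizing_sequence rho'P SP minS.
have [_ iu iG _ _] := lim.
have iu2 := weight_integrable2 openO p2 iu.
have um : 2^-1 * dirichlet_form Omega G G - \int[mu]_(x in Omega) F (u x) = m.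
  exact: (cvg_unique _ (strong_limit_functional lim) Em).
have mM : mass u = M.
  have h := strong_limit_sqr openO boundedO p2 lim.
  rewrite (_ : (fun k => mass (phi_ k)) = (fun=> M)) in h; last first.
    by apply/funext => k; have [] := SP _ (Sphi k).
  have hM : (fun=> M) @ \oo --> M by exact: cvg_cst.
  exact: (cvg_unique _ h hM).
have Grho : dirichlet_form Omega G G < rho.
  have [_ rr] := andP rho'P; apply: le_lt_trans rr.
  apply: (cvg_le_bound (strong_limit_energy openO boundedO lim)) => k.
  by have [] := SP _ (Sphi k).
exists phi_, u, G; split => //; exists G; split => //.
  exact: (strong_limit_H10 openO boundedO p2 lim).
(* The equation holds against test functions, and each of its terms is continuous along the strong
   limit that approximates [v]. *)
move=> v H /(H10_strong_limit openO boundedO n0 p2 crit)[psi_ limv].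
have [tpsi _ _ _ _] := limv.
have h1 := strong_limit_form openO boundedO limv iG.
have h2 := strong_limit_nonlinearity iu limv.
have h3 := strong_limit_mul openO boundedO p2 limv iu2.
set l := _ / M.
have h4 : dirichlet_form Omega G (gradient (psi_ k)) @[k --> \oo] -->
    l * \int[mu]_(x in Omega) (u x * v x) + \int[mu]_(x in Omega) (f (u x) * v x).
  rewrite (_ : (fun k => _) = (fun k => l * \int[mu]_(x in Omega) (u x * psi_ k x) +
      \int[mu]_(x in Omega) (f (u x) * psi_ k x))).
    by apply: cvgD => //; exact: cvg_scale.
  by apply/funext => k; exact: (euler_lagrange lim mM Grho um (tpsi k)).
exact: (cvg_unique _ h1 h4).
Qed.

End functional.

End minimization.

(** * The first eigenvalue *)

Section rayleigh.
Context {R : realType} {n : nat}.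
Variable Omega : set 'rV[R]_n.
Hypotheses (openO : open Omega) (boundedO : bounded_set Omega) (n0 : (0 < n)%N).
Implicit Types (u v phi psi : 'rV[R]_n -> R) (G H : 'I_n -> 'rV[R]_n -> R) (l L M e : R).
Local Notation mu := (@lebesgue_row R n).
Local Notation tf := (test_function Omega).
Local Notation en := (energy Omega).
Local Notation mass u := (\int[mu]_(x in Omega) u x ^+ 2).

Let mO : measurable Omega := measurable_domain openO.

Let le22 : 2 <= 2 :> R. Proof. by []. Qed.

Let crit2 : (n%:R - 2) * (2 - 2) < 4 :> R. Proof. by rewrite subrr mulr0. Qed.

Lemma mass_ge0 u : 0 <= mass u.
Proof. by apply: Rintegral_ge0 => x _; exact: sqr_ge0. Qed.

Lemma normalized_test_function M phi : 0 < M -> tf phi -> 0 < mass phi ->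
  exists psi, [/\ tf psi, mass psi = M & en psi = M / mass phi * en phi].
Proof.
move=> M0 tp mp; have ip := tf_weight_integrable openO boundedO le22 tp.
pose s := Num.sqrt (M / mass phi).
have s2 : s ^+ 2 = M / mass phi by rewrite sqr_sqrtr// divr_ge0// ltW.
exists (lincomb s phi 0 phi); split; first exact: test_function_lincomb.
  rewrite (integral_lincomb_sqr openO _ _ ip ip) s2 divfK ?lt0r_neq0//.
  by rewrite mulr0 mul0r addr0 expr0n mul0r addr0.
rewrite (energy_lincomb openO boundedO _ _ tp tp) s2.
by rewrite mulr0 mul0r addr0 expr0n mul0r addr0.
Qed.

Lemma mass_eq0P u : weight_integrable mu Omega 2 u ->
  mass u = 0 <-> {ae mu, forall x, Omega x -> u x = 0}.
Proof.
move=> iu; have iS := weight2_integrable_sqr openO iu.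
have absE : (\int[mu]_(x in Omega) `|(u x ^+ 2)%:E| = (mass u)%:E)%E.
  under eq_integral do rewrite gee0_abs ?lee_fin ?sqr_ge0//.
  by rewrite fineK// (integrable_fin_num mO iS).
have [h1 h2] := ae_eq_integral_abs mu mO (measurable_int _ iS).
split=> [m0|u0].
  have : (\int[mu]_(x in Omega) `|(u x ^+ 2)%:E| = 0)%E by rewrite absE m0.
  move/h1; apply: filterS => x h Ox; apply/eqP; have /= := h Ox; case=> /eqP.
  by rewrite sqrf_eq0.
have {}h2 := h2 _; apply: EFin_inj; rewrite -absE; apply: h2.
by move: u0; apply: filterS => x h Ox /=; rewrite (h Ox) expr0n.
Qed.

(** The eigenvalue equation is tested with the eigenfunction itself, to which the Rayleigh bound
    extends by approximation. *)
Lemma rayleigh_le_eigenvalue L l : (forall phi, tf phi -> L * mass phi <= en phi) ->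
  dirichlet_eigenvalue Omega l -> L <= l.
Proof.
move=> HL [u [G [uG une0 EL]]].
have [phi_ lim] := H10_strong_limit openO boundedO n0 le22 crit2 uG.
have [tp iu _ _ _] := lim.
have mu0 : 0 < mass u.
  rewrite lt_neqAle mass_ge0 andbT eq_sym; apply/negP => /eqP m0.
  by apply: une0; exact/mass_eq0P.
have := EL u G uG; under [X in _ = l * X]eq_Rintegral do rewrite -expr2.
move=> GE; rewrite -(ler_pM2r mu0) -GE.
have h1 := cvg_scale (c := L) (strong_limit_sqr openO boundedO le22 lim).
have h2 := strong_limit_energy openO boundedO lim.
rewrite -subr_le0; apply: (cvg_le_bound (cvgB h1 h2)) => k /=.
by rewrite subr_le0; exact: HL.
Qed.

Lemma rayleigh_eigenvalue L : (forall phi, tf phi -> L * mass phi <= en phi) ->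
  (forall e, 0 < e -> exists phi, [/\ tf phi, mass phi = 1 & en phi < L + e]) ->
  dirichlet_eigenvalue Omega L.
Proof.
move=> HL Hex.
have L0 : 0 <= L.
  apply/ler_addgt0Pr => e e0; have [phi [tp _ pe]] := Hex e e0.
  exact: le_trans (energy_ge0 _ _) (ltW pe).
(* With zero nonlinearity and M = 1 the functional is half the energy. The radii L + 1 and L + 2
   exceed the infimum, so the energy constraint does not interfere, and the multiplier is int |grad
   u|^2 = L. *)
pose F := fun _ : R => 0 : R.
have FK : growth_control 2 F 0.
  split; [by move=> x; exact: cvg_cst|by []|move=> a b; rewrite /F subrr normr0 mul0r//].
have F0 u : \int[mu]_(x in Omega) F (u x) = 0 by rewrite /Rintegral integral0.
have fE phi : functional Omega F phi = 2^-1 * en phi by rewrite /functional F0 subr0.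
have m_le phi : tf phi -> mass phi = 1 -> en phi < L + 2 -> 2^-1 * L <= functional Omega F phi.
  by move=> tp m1 _; rewrite fE ler_pM2l// -[L]mulr1 -m1; exact: HL.
pose S phi := [/\ tf phi, mass phi = 1 & en phi <= L + 1].
have minS : minimizing (functional Omega F) (2^-1 * L) S.
  move=> e e0; have [|phi [tp m1 pe]] := Hex (Num.min 1 e); first by rewrite lt_min ltr01.
  exists phi.
    split => //; apply: (le_trans (ltW pe)); by rewrite lerD2l ge_min lexx.
  have : en phi < L + e by apply: (lt_le_trans pe); rewrite lerD2l ge_min lexx orbT.
  by rewrite fE; move: (en phi) => a; have := e0; lra.
have rhoP : 0 <= L + 1 < L + 2 by rewrite addr_ge0//= ltrD2l ltr1n.
have f0 : continuous (F : R -> R) by move=> x; exact: cvg_cst.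
have fK a b : `|F a * b| <= 0 * growth 2 a b by rewrite /F mul0r normr0 mul0r.
have Fconv a b : F a + F a * (b - a) <= F b by rewrite /F mul0r addr0.
have [phi_ [u [G [lim _ um [G' [uG' m1 EL]]]]]] := constrained_minimizer openO boundedO n0 le22 crit2
  FK (@ltr01 R) m_le f0 fK Fconv rhoP (fun phi h => h) minS.
have F0' v : \int[mu]_(x in Omega) (F (u x) * v x) = 0.
  by under eq_Rintegral do rewrite /F mul0r; rewrite /Rintegral integral0.
exists u, G'; split => //.
  have [_ iu _ _ _] := lim.
  by move=> /(mass_eq0P iu) /eqP; rewrite m1 oner_eq0.
move=> v H vH; rewrite (EL v H vH) (F0' v) addr0; congr (_ * _).
rewrite (F0' u) subr0 divr1; move: um; rewrite F0 subr0 => h.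
by apply: (mulfI (x := 2^-1)) => //; rewrite invr_eq0 pnatr_eq0.
Qed.

(** The infimum of the empty set is 0, so a positive value means that some eigenvalue exists. Its
    eigenfunction is a limit of test functions, and these cannot all have mass 0. *)
Lemma positive_lambda1_test_function : 0 < dirichlet_lambda1 Omega ->
  exists2 phi, tf phi & 0 < mass phi.
Proof.
move=> l0; apply: contrapT => no.
have m0 phi : tf phi -> mass phi = 0.
  move=> tp; apply/eqP; rewrite eq_le mass_ge0 andbT leNgt; apply/negP => h.
  by apply: no; exists phi.
have : [set l | dirichlet_eigenvalue Omega l] !=set0.
  apply/set0P/negP => /eqP h; move: l0; by rewrite /dirichlet_lambda1 h inf0 ltxx.
move=> [l [u [G [uG une0 _]]]]; apply: une0.
have [phi_ lim] := H10_strong_limit openO boundedO n0 le22 crit2 uG.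
have [tp iu _ _ _] := lim; apply/mass_eq0P => //.
apply/eqP; rewrite eq_le mass_ge0 andbT.
by apply: (cvg_le_bound (strong_limit_sqr openO boundedO le22 lim)) => k; rewrite m0.
Qed.

(** [dirichlet_lambda1] is an infimum over eigenvalues, whereas the estimates use the infimum of the
    Rayleigh quotient over test functions. The latter is itself an eigenvalue and a lower bound for
    all of them, so the two agree. *)
Lemma dirichlet_lambda1_rayleigh : 0 < dirichlet_lambda1 Omega ->
  (forall phi, tf phi -> dirichlet_lambda1 Omega * mass phi <= en phi) /\
  (forall M e, 0 < M -> 0 < e ->
     exists phi, [/\ tf phi, mass phi = M & en phi < dirichlet_lambda1 Omega * M + e]).
Proof.
move=> l0; have [phi0 tp0 mp0] := positive_lambda1_test_function l0.
pose Q := [set en phi | phi in [set phi | tf phi /\ mass phi = 1]].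
have Q0 : Q !=set0.
  have [psi [ts ms _]] := normalized_test_function ltr01 tp0 mp0.
  by exists (en psi), psi.
have Qlb : has_lbound Q by exists 0 => _ [phi _ <-]; exact: energy_ge0.
have HL phi : tf phi -> inf Q * mass phi <= en phi.
  move=> tp; have := mass_ge0 phi; rewrite le_eqVlt => /orP[/eqP <-|mp].
    by rewrite mulr0 energy_ge0.
  have [psi [ts ms es]] := normalized_test_function ltr01 tp mp.
  have : inf Q <= en psi by apply: ge_inf => //; exists psi.
  by rewrite es div1r -ler_pdivlMr// mulrC.
have Hex e : 0 < e -> exists phi, [/\ tf phi, mass phi = 1 & en phi < inf Q + e].
  move=> e0; have [_ [phi [tp m1] <-] h] := inf_adherent e0 (conj Q0 Qlb).
  by exists phi.
have LE : dirichlet_lambda1 Omega = inf Q.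
  apply/eqP; rewrite eq_le; apply/andP; split.
    apply: ge_inf; last exact: rayleigh_eigenvalue.
    by exists (inf Q) => l; exact: rayleigh_le_eigenvalue.
  apply: lb_le_inf; first by exists (inf Q); exact: rayleigh_eigenvalue.
  by move=> l; exact: rayleigh_le_eigenvalue.
rewrite LE; split => // M e M0 e0.
have [phi [tp m1 pe]] := Hex (e / M) (divr_gt0 e0 M0).
have [|psi [ts ms es]] := normalized_test_function M0 tp; first by rewrite m1.
exists psi; split => //; rewrite es m1 divr1.
have := pe; rewrite -(ltr_pM2l M0) mulrDr [M * (e / M)]mulrC divfK ?lt0r_neq0//.
by rewrite [M * inf Q]mulrC.
Qed.

End rayleigh.

(** * The nonlinearity *)

Section nonlinearity.
Context {R : realType}.
Variable f : R -> R.
Hypothesis f_cont : continuous f.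
Implicit Types a b s t M : R.

(** [primitive] is defined by cases at 0. With a base point -M to the left of 0 and t it becomes a
    single integral up to a constant, which can be differentiated at 0 as well. *)
Lemma primitive_itv M t : 0 < M -> - M < t ->
  primitive f t = \int[lebesgue_measure]_(s in `[- M, t]) f s -
                  \int[lebesgue_measure]_(s in `[- M, 0]) f s.
Proof.
move=> M0 Mt; have ii a b := continuous_integrable_itv a b f_cont.
have N0 : - M < 0 by rewrite oppr_lt0.
rewrite /primitive; case: ifPn => [t0|]; last rewrite -ltNge => t0.
  have h1 : (BLeft (- M) <= BRight (0 : R))%O by rewrite bnd_simp ltW.
  have h2 : (BRight (0 : R) <= BRight t)%O by rewrite bnd_simp.
  rewrite (Rintegral_itvB (ii (- M) t) h1 h2).
  rewrite Rintegral_itv_obnd_cbnd//; apply: integrableS (ii 0 t) => //.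
  by apply: subset_itvr; rewrite bnd_simp.
rewrite -opprB; congr (- _).
have h1 : (BLeft (- M) <= BRight t)%O by rewrite bnd_simp ltW.
have h2 : (BRight t <= BRight (0 : R))%O by rewrite bnd_simp ltW.
rewrite (Rintegral_itvB (ii (- M) 0) h1 h2).
rewrite Rintegral_itv_obnd_cbnd//; apply: integrableS (ii t 0) => //.
by apply: subset_itvr; rewrite bnd_simp.
Qed.

Lemma is_derive_primitive t : is_derive t 1 (primitive f) (f t).
Proof.
pose M := `|t| + 1; have M0 : 0 < M by rewrite ltr_wpDl.
have Mt : - M < t by rewrite ltrNl (le_lt_trans (ler_norm (- t)))// normrN ltrDl.
have tu : t < t + 1 by rewrite ltrDl.
pose G x := \int[lebesgue_measure]_(s in `[- M, x]) f s.
have [dG GE] := continuous_FTC1_closed tu (continuous_integrable_itv (- M) (t + 1) f_cont)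
  Mt (@f_cont t).
have dG' : is_derive t 1 (fun x => G x - G 0) (f t).
  rewrite -[f t]subr0; apply: is_deriveB.
  by split; [exact: dG|rewrite -derive1E; exact: GE].
apply: near_eq_is_derive dG'.
have : \forall x \near t, - M < x by exact: lt_nbhsr.
by apply: filterS => x Mx; rewrite (primitive_itv M0 Mx).
Qed.

Lemma primitive0 : primitive f 0 = 0.
Proof. by rewrite (@primitive_itv 1)// ?subrr// oppr_lt0. Qed.

Lemma continuous_primitive : continuous (primitive f).
Proof.
move=> t; apply/differentiable_continuous/derivable1_diffP.
exact: (@ex_derive _ _ _ _ _ _ _ (is_derive_primitive t)).
Qed.

Hypotheses (f0 : f 0 = 0) (f_sign : forall t, 0 <= f t * t)
  (f_mono_neg : {in `]-oo, 0[ &, {homo (fun t => f t / `|t|) : s t / s <= t}})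
  (f_mono_pos : {in `]0, +oo[ &, {homo (fun t => f t / `|t|) : s t / s <= t}}).

Let f_pos t : 0 <= t -> 0 <= f t.
Proof.
by rewrite le_eqVlt => /orP[/eqP <-|t0]; [rewrite f0|have := f_sign t; rewrite pmulr_lge0].
Qed.

Let f_neg t : t <= 0 -> f t <= 0.
Proof.
by rewrite le_eqVlt => /orP[/eqP ->|t0]; [rewrite f0|have := f_sign t; rewrite nmulr_lge0].
Qed.

Let slope_pos s t : 0 < s -> s <= t -> f s * t <= f t * s.
Proof.
move=> s0 st; have t0 := lt_le_trans s0 st.
have := f_mono_pos _ _ st; rewrite !in_itv/= !andbT => /(_ s0 t0).
by rewrite !gtr0_norm// ler_pdivrMr// mulrAC ler_pdivlMr.
Qed.

Let slope_neg s t : t < 0 -> s <= t -> f t * s <= f s * t.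
Proof.
move=> t0 st; have s0 := le_lt_trans st t0.
have := f_mono_neg _ _ st; rewrite !in_itv/= => /(_ s0 t0).
rewrite !ltr0_norm// ler_pdivrMr ?oppr_gt0// mulrAC ler_pdivlMr ?oppr_gt0//.
by rewrite !mulrN lerN2.
Qed.

(** For 0 < s <= t one has [f s * s <= f s * t <= f t * s]; the negative side is symmetric, and the
    sign of f settles the remaining case. *)
Lemma nondecreasing_nonlinearity s t : s <= t -> f s <= f t.
Proof.
move=> st; have [s0|s0] := ltP 0 s.
  have t0 := lt_le_trans s0 st; rewrite -(ler_pM2r s0).
  by apply: le_trans (slope_pos s0 st); rewrite ler_wpM2l// f_pos// ltW.
have [t0|t0] := leP 0 t; first exact: le_trans (f_neg s0) (f_pos t0).
rewrite -(ler_nM2r t0); apply: le_trans (slope_neg t0 st).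
by apply: ler_wnM2l => //; exact: f_neg (ltW t0).
Qed.

Lemma primitive_convex a b : primitive f a + f a * (b - a) <= primitive f b.
Proof.
have dF (c : R) : is_derive c 1 (primitive f) (f c) by exact: is_derive_primitive.
have cF (A : set R) : {within A, continuous (primitive f)}.
  by apply: continuous_subspaceT => x; exact: continuous_primitive.
rewrite -lerBrDl; have [ab|ba] := leP a b.
  have [c] := MVT_segment ab (fun c _ => dF c) (cF _).
  rewrite in_itv/= => /andP[ac _] ->; apply: ler_wpM2r; first by rewrite subr_ge0.
  exact: nondecreasing_nonlinearity.
have [c] := MVT_segment (ltW ba) (fun c _ => dF c) (cF _).
rewrite in_itv/= => /andP[_ ca] h; rewrite -opprB -[leRHS]opprB mulrN lerN2 h.
by apply: ler_wpM2r; [rewrite subr_ge0 ltW|exact: nondecreasing_nonlinearity].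
Qed.

Lemma primitive_ge0 t : 0 <= primitive f t.
Proof. by have := primitive_convex 0 t; rewrite primitive0 f0 mul0r addr0. Qed.

Lemma primitive_le_half t : 2 * primitive f t <= f t * t.
Proof.
have [->|tn0] := eqVneq t 0; first by rewrite primitive0 !mulr0.
(* The derivative 2 k s = f t s / t of the parabola is the chord of f between 0 and t. On that
   interval f lies below the chord if t > 0 and above it if t < 0, so the mean value theorem gives g
   t >= g 0 = 0. *)
pose k := f t / (2 * t); pose g s := k * s ^+ 2 - primitive f s.
have dg (c : R) : is_derive c 1 g (k * (2 * c) - f c).
  have h1 : is_derive c 1 (fun s : R => s ^+ 2) (2 * c).
    have -> : 2 * c = (2%:R * (@id R) c ^+ 1) *: (1 : R) by rewrite /GRing.scale/= mulr1.
    exact: (is_deriveX 2 (is_derive_id c 1)).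
  exact: (is_deriveB (is_deriveZ k h1) (is_derive_primitive c)).
have cg (A : set R) : {within A, continuous g}.
  apply: continuous_subspaceT => x; apply/differentiable_continuous/derivable1_diffP.
  exact: (@ex_derive _ _ _ _ _ _ _ (dg x)).
suff : 0 <= g t.
  rewrite /g subr_ge0 => h; have -> : f t * t = 2 * (k * t ^+ 2) by rewrite /k; field.
  by rewrite ler_pM2l.
have g0 : g 0 = 0 by rewrite /g primitive0 expr0n mulr0 subr0.
have [t0|t0] := ltP 0 t.
  have [c] := MVT t0 (fun c _ => dg c) (cg _).
  rewrite in_itv/= g0 !subr0 => /andP[c0 ct] ->; apply: mulr_ge0; last exact: ltW.
  have -> : k * (2 * c) = f t * c / t by rewrite /k; field.
  by rewrite subr_ge0 ler_pdivlMr// slope_pos// ltW.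
have {}t0 : t < 0 by rewrite lt_neqAle tn0.
have [c] := MVT t0 (fun c _ => dg c) (cg _).
rewrite in_itv/= g0 !sub0r => /andP[tc c0] h; rewrite -oppr_le0 h.
apply: mulr_le0_ge0; last by rewrite oppr_ge0 ltW.
have -> : k * (2 * c) = f t * c / t by rewrite /k; field.
by rewrite subr_le0 ler_ndivrMr// slope_neg// ltW.
Qed.

End nonlinearity.

(** * Choice of the constants and conclusion *)

Lemma subcritical (R : realType) (N : nat) (p : R) : 2 < p ->
  (p%:E < critical_exponent R N)%E -> (N%:R - 2) * (p - 2) < 4.
Proof.
move=> p2; have p20 : 0 < p - 2 by rewrite subr_gt0.
rewrite /critical_exponent; case: ifPn => [N2 _|].
  (* For N <= 2 the left side is nonpositive, so the infinite critical exponent needs no separate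
     treatment later. *)
  apply: (@le_lt_trans _ _ 0) => //; apply: mulr_le0_ge0; last exact: ltW.
  by rewrite subr_le0 ler_nat.
rewrite -ltnNge => N2; rewrite lte_fin ltr_pdivlMr ?ltr0n ?subn_gt0//.
rewrite natrB ?(ltnW N2)// natrM; move: (N%:R : R) => x; lra.
Qed.

(** The exponent p / 2 exceeds 1, so S e^(p / 2 - 1) <= k for small e; the 1 added to S keeps the
    divisor positive. *)
Lemma small_energy_radius (R : realType) (p S k : R) : 2 < p -> 0 <= S -> 0 < k ->
  exists2 rho : R, 0 < rho & forall e, 0 <= e <= rho -> S * e `^ (p / 2) <= k * e.
Proof.
move=> p2 S0 k0; pose q := p / 2 - 1.
have q0 : 0 < q by rewrite subr_gt0 ltr_pdivlMr// mul1r.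
have S1 : 0 < S + 1 by rewrite ltr_wpDl.
have c0 : 0 < k / (S + 1) by rewrite divr_gt0.
exists ((k / (S + 1)) `^ q^-1); first exact: powR_gt0.
move=> e /andP[]; rewrite le_eqVlt => /orP[/eqP <- _|e0 erho].
  by rewrite powR0 ?mulr0// gt_eqF// divr_gt0// (lt_trans _ p2).
have -> : p / 2 = q + 1 by rewrite /q subrK.
rewrite powRD; last by rewrite (gt_eqF e0) implybT.
rewrite powRr1 ?(ltW e0)// mulrA ler_pM2r//.
have eq : e `^ q <= k / (S + 1).
  have -> : k / (S + 1) = (k / (S + 1)) `^ q^-1 `^ q by rewrite -powRrM mulVf ?gt_eqF// powRr1// ltW.
  by apply: ge0_ler_powR; rewrite ?nnegrE ?powR_ge0// ltW.
apply: (le_trans (ler_wpM2l S0 eq)); rewrite mulrCA ler_piMr ?(ltW k0)//.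
by rewrite ler_pdivrMr// mul1r lerDl.
Qed.

Theorem theorem1p1 (R : realType) (N : nat) (N_ge1 : (1 <= N)%N)
    (Omega : set 'rV[R]_N) (Omega_dom : smooth_bounded_domain Omega)
    (f : R -> R) (f_cont : continuous f)
    (f_growth : exists p K2 Kp : R,
      [/\ 2 < p, (p%:E < critical_exponent R N)%E,
          0 <= K2 < dirichlet_lambda1 Omega, 0 <= Kp &
          forall t, `|f t| <= K2 * `|t| + Kp * `|t| `^ (p - 1)])
    (f_sign : forall t, 0 <= f t * t)
    (f_mono_neg : {in `]-oo, 0[ &,
      {homo (fun t => f t / `|t|) : s t / s <= t}})
    (f_mono_pos : {in `]0, +oo[ &,
      {homo (fun t => f t / `|t|) : s t / s <= t}})
    (F_pinfty : primitive f t / t ^+ 2 @[t --> +oo] --> +oo)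
    (F_ninfty : primitive f t / t ^+ 2 @[t --> -oo] --> +oo) :
  exists2 mu0 : R, 0 < mu0 & forall mu : R, 0 < mu < mu0 ->
    exists (u : 'rV[R]_N -> R) (lambda : R),
      normalized_solution Omega f mu u lambda /\
      0 <= lambda <= dirichlet_lambda1 Omega.
Proof.
have [openO _ _ boundedO _] := Omega_dom.
have [p [K2 [Kp [p_gt2 p_crit /andP[K2_ge0 K2_lt] Kp_ge0 f_le]]]] := f_growth.
have p2 : 2 <= p := ltW p_gt2; have p0 : 0 < p := lt_trans (@ltr0n R 2) p_gt2.
have crit := subcritical p_gt2 p_crit.
have mO := measurable_domain openO.
set L := dirichlet_lambda1 Omega in K2_lt *.
have L0 : 0 < L := le_lt_trans K2_ge0 K2_lt.
have [rayleigh near_rayleigh] := dirichlet_lambda1_rayleigh openO boundedO N_ge1 L0.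
have f0 : f 0 = 0.
  apply/eqP; rewrite -normr_le0; apply: (le_trans (f_le 0)).
  by rewrite normr0 mulr0 powR0 ?mulr0 ?addr0// gt_eqF// subr_gt0 (lt_trans _ p_gt2)// ltr1n.
pose F := primitive f.
have dF (t : R) : is_derive t 1 F (f t) by exact: is_derive_primitive.
have Fconv a b : F a + f a * (b - a) <= F b by exact: primitive_convex.
have F_half t : 2 * F t <= f t * t by exact: primitive_le_half.
have F_ge0 t : 0 <= F t by exact: primitive_ge0.
pose K := K2 + Kp; have K0 : 0 <= K by rewrite addr_ge0.
have fK t : `|f t| <= K * (`|t| + `|t| `^ (p - 1)).
  apply: (le_trans (f_le t)); rewrite mulrDr; apply: lerD; apply: ler_wpM2r;
    rewrite ?normr_ge0 ?powR_ge0 ?lerDl ?lerDr//.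
have FK : growth_control p F K by apply: (growth_control_primitive p2 K0 dF fK); exact: primitive0.
have fgK a b : `|f a * b| <= K * growth p a b.
  by apply: (growth_bound p2 K0 fK); rewrite lerDl.
have ft_le t : f t * t <= K2 * t ^+ 2 + Kp * `|t| `^ p.
  apply: (le_trans (ler_norm _)); rewrite normrM.
  apply: (le_trans (ler_wpM2r (normr_ge0 t) (f_le t))).
  rewrite mulrDl -!mulrA -expr2 real_normK ?num_real// lerD2l; apply: ler_wpM2l => //.
  have [->|tn0] := eqVneq t 0; first by rewrite normr0 mulr0 powR_ge0.
  rewrite -{2}[`|t|]powRr1// -powRD; last by rewrite normr_eq0 tn0 implybT.
  by rewrite subrK.
(* [k] is half of the gap 1 - K2 / lambda_1. By the Rayleigh bound the quadratic part of f takes a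
   share [a] of the energy, the power part takes at most [k] below energy rho, and since a + k = 1 -
   k a share [k] is left over. *)
pose a := K2 / L; pose k := (1 - a) / 2.
have a0 : 0 <= a by rewrite divr_ge0// ltW.
have a1 : a < 1 by rewrite ltr_pdivrMr// mul1r.
have k0 : 0 < k by rewrite divr_gt0// subr_gt0.
have ak : a + k <= 1 - k by rewrite /k; lra.
have K2E : K2 = a * L by rewrite divfK// gt_eqF.
have [C C0 HC] := sobolev openO boundedO N_ge1 p2 crit.
(* The factor 2^p is kept in reserve for the limit u, where |u|^p is compared with 2^p (|u -
   phi_j|^p + |phi_j|^p). *)
pose S := Kp * 2 `^ p * C.
have S0 : 0 <= S by rewrite !mulr_ge0// powR_ge0.
have [rho rho0 Hrho] := small_energy_radius p_gt2 S0 k0.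
(* Chosen so that L M < rho k / 4. Since m <= L M / 2 and the functional is at least k / 2 times the
   energy, competitors with value below m + rho k / 8 have energy below rho / 2, away from the
   boundary. *)
pose mu0 := rho * k / (4 * L).
have mu00 : 0 < mu0 by apply: divr_gt0; exact: mulr_gt0.
exists mu0 => // M /andP[M0 Mmu0].
have LM : L * M < rho * k / 4.
  have -> : rho * k / 4 = L * mu0 by rewrite /mu0; field; rewrite gt_eqF.
  by rewrite ltr_pM2l.
have k1 : k < 1 by move: a0; rewrite /k; lra.
have LMrho : L * M < rho.
  apply: (lt_trans LM); rewrite -mulrA gtr_pMr//; move: k0; lra.
pose lm := @lebesgue_row R N.
have sob phi : test_function Omega phi -> energy Omega phi <= rho ->
    Kp * 2 `^ p * \int[lm]_(x in Omega) `|phi x| `^ p <= k * energy Omega phi.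
  move=> tp ep; apply: le_trans (Hrho _ _); last by rewrite energy_ge0.
  by rewrite /S -[leRHS]mulrA; apply: ler_wpM2l; [rewrite mulr_ge0// powR_ge0|exact: HC].
have two1 : 1 <= 2 `^ p :> R by rewrite -[leLHS](powRr0 2) ler_powR ?ler1n// ltW.
have E_ge phi : test_function Omega phi -> energy Omega phi <= rho ->
    2^-1 * k * energy Omega phi <= functional Omega F phi.
  move=> tp ep.
  have ip := tf_weight_integrable openO boundedO p2 tp.
  have iF : lm.-integrable Omega (EFin \o (fun x => F (phi x))).
    exact: (growth_control_integrable mO p2 FK ip).
  have i1 := tf_integrable_sqr openO boundedO tp.
  have i2 := tf_integrable_powR openO boundedO (ltW p0) tp.
  have j1 := integrableZl mO K2 i1; have j2 := integrableZl mO Kp i2.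
  have : 2 * \int[lm]_(x in Omega) F (phi x) <=
      K2 * \int[lm]_(x in Omega) phi x ^+ 2 + Kp * \int[lm]_(x in Omega) `|phi x| `^ p.
    rewrite -(RintegralZl 2 mO iF) -(RintegralZl K2 mO i1) -(RintegralZl Kp mO i2).
    rewrite -(RintegralD mO j1 j2).
    apply: (le_Rintegral mO (integrableZl mO 2 iF) (integrableD mO j1 j2)) => x _.
    exact: le_trans (F_half _) (ft_le _).
  have : K2 * \int[lm]_(x in Omega) phi x ^+ 2 <= a * energy Omega phi.
    by rewrite K2E -[leLHS]mulrA; apply: ler_wpM2l => //; exact: rayleigh.
  have : Kp * \int[lm]_(x in Omega) `|phi x| `^ p <= k * energy Omega phi.
    apply: le_trans (sob _ tp ep); rewrite mulrAC; apply: ler_peMr => //.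
    by apply: mulr_ge0 => //; apply: Rintegral_ge0 => x _; exact: powR_ge0.
  have : (a + k) * energy Omega phi <= (1 - k) * energy Omega phi.
    by apply: ler_wpM2r => //; exact: energy_ge0.
  rewrite /functional -/lm.
  move: (energy _ _) (Rintegral _ _ _) (Rintegral _ _ _) (Rintegral _ _ _) => e I1 I2 I3.
  rewrite !mulrDl; lra.
pose T phi := [/\ test_function Omega phi, \int[lm]_(x in Omega) phi x ^+ 2 = M &
  energy Omega phi < rho].
pose m := inf [set functional Omega F phi | phi in T].
have lbT : has_lbound [set functional Omega F phi | phi in T].
  exists 0 => _ [phi [tp _ ep] <-]; apply: le_trans (E_ge _ tp (ltW ep)).
  by rewrite mulr_ge0 ?energy_ge0// mulr_ge0// ltW.
have m_le phi : test_function Omega phi -> \int[lm]_(x in Omega) phi x ^+ 2 = M ->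
    energy Omega phi < rho -> m <= functional Omega F phi.
  by move=> tp mp ep; apply: ge_inf => //; exists phi.
have E_le phi : functional Omega F phi <= 2^-1 * energy Omega phi.
  by rewrite /functional gerBl; apply: Rintegral_ge0 => x _; exact: F_ge0.
have T0 : [set functional Omega F phi | phi in T] !=set0.
  have [|phi [tp mp ep]] := near_rayleigh M (rho - L * M) M0; first by rewrite subr_gt0.
  by exists (functional Omega F phi), phi => //; split => //; move: ep; rewrite addrC subrK.
(* A near-optimal function for the Rayleigh quotient is an admissible competitor because L M < rho,
   and F >= 0 makes its value at most half its energy. *)
have m_half : 2 * m <= L * M.
  apply/ler_addgt0Pr => e e0.
  have [|phi [tp mp ep]] := near_rayleigh M (Num.min e (rho - L * M)) M0.
    by rewrite lt_min e0 subr_gt0.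
  have e1 : energy Omega phi < L * M + e by apply: (lt_le_trans ep); rewrite lerD2l ge_min lexx.
  have e2 : energy Omega phi < rho.
    by apply: (lt_le_trans ep); rewrite -lerBrDl ge_min lexx orbT.
  have := m_le _ tp mp e2; have := E_le phi; move: e1.
  move: (energy _ _) (functional _ _ _) => x y; lra.
pose St := T `&` [set phi | functional Omega F phi < m + rho * k / 8].
have minS : minimizing (functional Omega F) m St.
  apply: minimizing_sublevel; first by rewrite divr_gt0// mulr_gt0.
  by move=> e e0; have [_ [phi Tphi <-] h] := inf_adherent e0 (conj T0 lbT); exists phi.
have StP phi : St phi -> [/\ test_function Omega phi, \int[lm]_(x in Omega) phi x ^+ 2 = M &
    energy Omega phi <= rho / 2].
  move=> [[tp mp ep] /= h]; split => //.
  have h2 := E_ge _ tp (ltW ep); rewrite -(ler_pM2l k0).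
  have -> : k * (rho / 2) = rho * k / 2 by ring.
  move: h h2 m_half LM; move: (rho * k) => y.
  have -> : 2^-1 * k * energy Omega phi = (k * energy Omega phi) / 2 by ring.
  move: (k * _) (functional _ _ _) => x z; lra.
have rhoP : 0 <= rho / 2 < rho by move: rho0 => r0; apply/andP; split; lra.
have [phi_ [u [G [lim Sphi um sol]]]] := constrained_minimizer openO boundedO N_ge1 p2 crit
  FK M0 m_le f_cont fgK Fconv rhoP StP minS.
have [tphi iu iG u0 _] := lim.
set I := \int[_]_(x in Omega) (f (u x) * u x) in sol.
set A := dirichlet_form Omega G G in um sol.
exists u, ((A - I) / M); split => //.
have iN : lm.-integrable Omega (EFin \o (fun x => f (u x) * u x)).
  exact: (integrable_nonlinearity openO p2 f_cont fgK iu iu).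
have iF : lm.-integrable Omega (EFin \o (fun x => F (u x))).
  exact: (growth_control_integrable mO p2 FK iu).
have elim := strong_limit_energy openO boundedO lim.
have mlim := strong_limit_sqr openO boundedO p2 lim.
have ip k' := tf_weight_integrable openO boundedO p2 (tphi k').
have i1 := weight2_integrable_sqr openO (weight_integrable2 openO p2 iu).
have powR_int w : weight_integrable lm Omega p w ->
    lm.-integrable Omega (EFin \o (fun x => `|w x| `^ p)).
  move=> [mw iw]; apply: (le_integrable mO _ _ iw) => [|x _ /=].
    apply/measurable_EFinP; exact: (measurableT_comp (measurable_abs_powR p) mw).
  by rewrite lee_fin [leLHS]ger0_norm ?powR_ge0// [leRHS]ger0_norm ?weight_ge0// powR_le_weight.
have i2 := powR_int _ iu.
have lam_le : A - I <= L * M.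
  have : 2 * \int[lm]_(x in Omega) F (u x) <= I.
    rewrite -(RintegralZl 2 mO iF).
    by apply: (le_Rintegral mO (integrableZl mO 2 iF) iN) => x _; exact: F_half.
  move: um m_half; rewrite -/lm; move: (Rintegral _ _ _) => J; lra.
have sqr_le : K2 * \int[lm]_(x in Omega) u x ^+ 2 <= a * A.
  rewrite -subr_le0;
  apply: (cvg_le_bound (cvgB (cvg_scale (c := K2) mlim) (cvg_scale (c := a) elim))).
  move=> j /=; rewrite subr_le0 K2E -[leLHS]mulrA; apply: ler_wpM2l => //; exact: rayleigh.
(* The estimate [sob] holds for test functions of energy at most rho. For u it is obtained by
   inserting phi_j, at the cost of the factor 2^p contained in [sob], and letting j tend to
   infinity. *)
have powR_le : Kp * \int[lm]_(x in Omega) `|u x| `^ p <= k * A.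
  have hlim : (fun j => Kp * \int[lm]_(x in Omega) `|u x| `^ p -
      (Kp * 2 `^ p * \int[lm]_(x in Omega) weight p (phi_ j x - u x) + k * energy Omega (phi_ j)))
      @ \oo --> Kp * \int[lm]_(x in Omega) `|u x| `^ p - (Kp * 2 `^ p * 0 + k * A).
    apply: cvgB; first exact: cvg_cst.
    by apply: cvgD; apply: cvg_scale.
  rewrite -subr_le0; move: hlim; rewrite mulr0 add0r => /cvg_le_bound; apply => j.
  rewrite subr_le0.
  have id := weight_integrableB mO p2 (ip j) iu.
  have ij := powR_int _ (ip j); have iD := integrableD mO id.2 ij.
  have : \int[lm]_(x in Omega) `|u x| `^ p <= 2 `^ p *
      (\int[lm]_(x in Omega) weight p (phi_ j x - u x) + \int[lm]_(x in Omega) `|phi_ j x| `^ p).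
    rewrite -(RintegralD mO id.2 ij) -(RintegralZl (2 `^ p) mO iD).
    apply: (le_Rintegral mO i2 (integrableZl mO (2 `^ p) iD)) => x _.
    have -> : `|u x| = `|(u x - phi_ j x) + phi_ j x| by rewrite subrK.
    apply: (le_trans (powR_normD _ _ (ltW p0))); apply: ler_wpM2l; first exact: powR_ge0.
    by rewrite lerD2r distrC powR_le_weight.
  move=> /(ler_wpM2l Kp_ge0) /le_trans; apply.
  rewrite mulrA mulrDr lerD2l; apply: sob => //.
  by have [[_ _ /ltW]] := Sphi j.
(* The growth bound on f gives I <= (a + k) A <= (1 - k) A, so A - I is at least k A. *)
have lam_ge : 0 <= A - I.
  have j1 := integrableZl mO K2 i1; have j2 := integrableZl mO Kp i2.
  have : I <= K2 * \int[lm]_(x in Omega) u x ^+ 2 + Kp * \int[lm]_(x in Omega) `|u x| `^ p.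
    rewrite -(RintegralZl K2 mO i1) -(RintegralZl Kp mO i2) -(RintegralD mO j1 j2).
    by apply: (le_Rintegral mO iN (integrableD mO j1 j2)) => x _; exact: ft_le.
  have A0 : 0 <= A.
    by apply: Rintegral_ge0 => x _; apply: sumr_ge0 => i _; rewrite -expr2; exact: sqr_ge0.
  have : (a + k) * A <= (1 - k) * A by apply: ler_wpM2r.
  have : 0 <= k * A by rewrite mulr_ge0// ltW.
  move: sqr_le powR_le; rewrite mulrDl mulrBl mul1r.
  move: (a * A) (k * A) (Rintegral _ _ _) (Rintegral _ _ _) => x y z w; lra.
by rewrite divr_ge0 ?(ltW M0)//= ler_pdivrMr.
Qed.
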